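(* Let $\Delta^+$ be an $\omega$-adapted positive system of sign $\varepsilon$, let $M$ be a unitary highest weight representation of $\mathfrak g$ (with respect to $\omega$) of highest weight $\Lambda$ with respect to $\Delta^+$, and let $L_0(\mu)$ be a $\mathfrak g_{\bar0}$-constituent of $M\otimes M(\mathfrak g_{\bar1})$. Then $$-\varepsilon\bigl((\mu+\rho_{\bar1}+2\rho,\ \mu+\rho_{\bar1})-(\Lambda+2\rho,\Lambda)\bigr)\ge0 .$$
   Context: Lie superalgebra. $\mathfrak g=\mathfrak g_{\bar0}\oplus\mathfrak g_{\bar1}$ is one of the complex Lie superalgebras $\mathfrak{sl}(m|n)$ ($m,n\ge1$, $m\neq n$), $\mathfrak{gl}(n|n)$ ($n\ge1$), $\mathfrak{osp}(m|2n)$ ($m,n\ge1$), or the exceptional $F(4)$ ($\mathfrak g_{\bar0}=\mathfrak{so}(7)\oplus\mathfrak{sl}(2)$, $\mathfrak g_{\bar1}=$ spin $\otimes\,\mathbb C^2$). The invariant form $(X,Y)$ is $\mathrm{str}(XY)$ for $\mathfrak{sl},\mathfrak{gl}$, $\frac12\mathrm{str}(XY)$ for $\mathfrak{osp}$, $\frac16\mathrm{str}_{\mathfrak g}(\mathrm{ad}X\,\mathrm{ad}Y)$ for $F(4)$; it induces the form $(\cdot,\cdot)$ on $\mathfrak h^*$; $B=\frac12(\cdot,\cdot)$ on $\mathfrak g$. With $\Omega_n=\begin{pmatrix}0&I_n\\-I_n&0\end{pmatrix}$, $\mathfrak{osp}(m|2n)$ consists of the block matrices $\begin{pmatrix}A&B\\C&D\end{pmatrix}\in\mathfrak{gl}(m|2n)$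 with $A=-A^T$, $D=\Omega_nD^T\Omega_n$, $C=-\Omega_nB^T$. Cartan subalgebra $\mathfrak h\subseteq\mathfrak g_{\bar0}$: diagonal matrices for $\mathfrak{sl},\mathfrak{gl}$, with coordinates $\epsilon_i$ (entry $i\leq m$), $\delta_a$ (entry $m+a$); for $\mathfrak{osp}(m|2n)$, $r=\lfloor m/2\rfloor$, the matrices $H=\mathrm{diag}(t_1K,\dots,t_rK,0_{m-2r},i\Omega_n\mathrm{diag}(D,D))$ with $K=\begin{pmatrix}0&i\\-i&0\end{pmatrix}$, $D=\mathrm{diag}(d_1,\dots,d_n)$, $\epsilon_i(H)=t_i$, $\delta_a(H)=d_a$; for $F(4)$ the complexification of a Cartan subalgebra of a maximal compact subalgebra of the even real form below. Fixed even positive system $\Delta_{\bar0}^+$: $\{\epsilon_i-\epsilon_j,\delta_a-\delta_b:i<j,a<b\}$ for $\mathfrak{sl},\mathfrak{gl}$; $\{\delta_a\pm\delta_b\ (a<b),2\delta_a,\epsilon_i\pm\epsilon_j\ (i<j)\}$, plus $\{\epsilon_i\}$ if $m$ is odd, for $\mathfrak{osp}$; $\{\delta,\epsilon_i,\epsilon_i\pm\epsilon_j\ (i<j)\}$ for $F(4)$. A positive system $\Delta^+=\Delta_{\bar0}^+\sqcup\Delta_{\bar1}^+$ extends this; $\rho=\rho_{\bar0}-\rho_{\bar1}$, $\rho_{\bar z}=\frac12\sum_{\alpha\in\Delta_{\bar z}^+}\alpha$; $\mathfrak n_{\bar1}^\pm=\bigoplus_{\alpha\in\Delta_{\bar1}^+}\mathfrak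 g^{\pm\alpha}$. $L_0(\mu)$ is the simple highest weight $\mathfrak g_{\bar0}$-module with respect to $\Delta_{\bar0}^+$. Real forms. $\omega$ is a conjugate-linear anti-involution of $\mathfrak g$ (parity preserving, $\omega^2=\mathrm{id}$, $\omega([X,Y])=[\omega(Y),\omega(X)]$) of one of these types: $\omega(X)=J^{-1}\overline X^{\,t}J$ with $J=\mathrm{diag}(I_p,-I_q,\pm I_n)$, $p+q=m$, for $\mathfrak{sl},\mathfrak{gl}$; $J=\mathrm{diag}(\pm I_m,i\Omega_n)$ for $\mathfrak{osp}(m|2n)$, or, if $m=2r$, $J=\mathrm{diag}(i\bigoplus_{i=1}^r\Omega_1,\pm I_{2n})$; for $F(4)$, an anti-involution defining a real form with even part $\mathfrak{so}(7)\oplus\mathfrak{sl}(2,\mathbb R)$ or $\mathfrak{so}(2,5)\oplus\mathfrak{su}(2)$ (the even real form is $\{X\in\mathfrak g_{\bar0}:\omega(X)=-X\}$). $\Delta^+$ is $\omega$-adapted with sign $\varepsilon\in\{\pm1\}$ if there are bases $\{\partial_i\}_{i=1}^N$ of $\mathfrak n_{\bar1}^+$ and $\{x_i\}_{i=1}^N$ of $\mathfrak n_{\bar1}^-$ with $(\partial_i,x_j)=\delta_{ij}$ and $\omega(x_i)=\varepsilon\partial_i$ for all $i,j$; fix such bases. A $\mathfrak g$-representation $M$ is unitary if it carries a positive definite Hermitian form with $\langle M_{\bar0},M_{\bar1}\rangle=0$ and $\langle Xv,w\rangle=\langle v,\omega(X)w\rangle$. Oscillator module. $\mathscr W(\mathfrak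 g_{\bar1})$ is the algebra of polynomial differential operators in $x_1,\dots,x_N$ with $\partial_i=\partial/\partial x_i$, and $M(\mathfrak g_{\bar1})=\mathbb C[x_1,\dots,x_N]$. $\mathfrak g_{\bar0}$ acts on $M(\mathfrak g_{\bar1})$ through $\alpha:\mathfrak g_{\bar0}\to\mathscr W(\mathfrak g_{\bar1})$, $$\alpha(X)=\sum_{i,j}\bigl(B(X,[\partial_i,\partial_j])x_ix_j+B(X,[x_i,x_j])\partial_i\partial_j\bigr)-2\sum_{i,j}B(X,[x_i,\partial_j])x_j\partial_i-\sum_lB(X,[\partial_l,x_l]),$$ and on $M\otimes M(\mathfrak g_{\bar1})$ by $X\otimes1+1\otimes\alpha(X)$; this module is completely reducible, and its constituents are its simple $\mathfrak g_{\bar0}$-summands. *)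

(* Defs.v *)
From HB Require Import structures.
From mathcomp Require Import all_boot all_order all_algebra.
From mathcomp Require Import finmap complex reals.
From mathcomp Require Import monalg mpoly ring.

Set Implicit Arguments.
Unset Strict Implicit.
Unset Printing Implicit Defensive.

Import Order.TTheory GRing.Theory Num.Theory.
Local Open Scope ring_scope.

(* Parities are booleans: false is even, true is odd.                        *)

Record lieSuper (F : fieldType) := LieSuper {
  ls_sort :> vectType F;
  ls_part : bool -> {vspace ls_sort};
  ls_br : ls_sort -> ls_sort -> ls_sort;
  ls_partI : (ls_part false :&: ls_part true = 0)%VS;
  ls_partD : (ls_part false + ls_part true = fullv)%VS;
  ls_brDl : forall Y, linear (fun X => ls_br X Y);
  ls_brDr : forall X, linear (ls_br X);
  ls_br_part : forall a b X Y,
    X \in ls_part a -> Y \in ls_part b -> ls_br X Y \in ls_part (a (+) b);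
  ls_skew : forall a b X Y, X \in ls_part a -> Y \in ls_part b ->
    ls_br X Y = - ((-1) ^+ (a && b) *: ls_br Y X);
  ls_jacobi : forall a b X Y Z, X \in ls_part a -> Y \in ls_part b ->
    ls_br X (ls_br Y Z) =
      ls_br (ls_br X Y) Z + (-1) ^+ (a && b) *: ls_br Y (ls_br X Z)
}.

Section Roots.
Variables (F : fieldType) (g : lieSuper F) (h : {vspace g}).

Definition weight := 'Hom(subvs_of h, F^o).

Definition rootsp (z : bool) (al : weight) : {vspace g} :=
  (ls_part g z :&:
   lker (linfun (fun X : g => linfun (fun H : subvs_of h =>
     ls_br (vsval H) X - (al H : F) *: X))))%VS.

Definition is_root (z : bool) (al : weight) : bool :=
  (al != 0) && (rootsp z al != 0%VS).

Definition positive_system (D0 D1 : {fset weight}) : Prop :=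
  let D := (D0 `|` D1)%fset in
  [/\ forall al, is_root false al = (al \in D0) || (- al \in D0),
      forall al, is_root true al = (al \in D1) || (- al \in D1),
      forall al, al \in D -> - al \notin D
    & forall al be, al \in D -> be \in D ->
        is_root false (al + be) || is_root true (al + be) -> al + be \in D].

Definition half_sum (D : {fset weight}) : weight := 2^-1 *: \sum_(al <- D) al.

Definition n1_plus (D1 : {fset weight}) : {vspace g} :=
  (\sum_(al <- D1) rootsp true al)%VS.
Definition n1_minus (D1 : {fset weight}) : {vspace g} :=
  (\sum_(al <- D1) rootsp true (- al))%VS.

(* The form on h^* induced by a form on g that is nondegenerate on h:        *)
(* H |-> (H, .) is then an isomorphism from h onto h^*, along which the form *)
(* on h is transported.                                                      *)
Variable form : g -> g -> F.

Definition flat : 'Hom(subvs_of h, weight) :=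
  linfun (fun H : subvs_of h => linfun (fun H' : subvs_of h =>
    form (vsval H) (vsval H') : F^o) : weight).

Definition wform (la mu : weight) : F :=
  form (vsval ((flat^-1)%VF la)) (vsval ((flat^-1)%VF mu)).

End Roots.

Record srep (F : fieldType) (g : lieSuper F) := SRep {
  sr_sort :> lmodType F;
  sr_part : bool -> sr_sort -> Prop;
  sr_act : g -> sr_sort -> sr_sort;
  sr_part0 : forall z, sr_part z 0;
  sr_partD : forall z a u v,
    sr_part z u -> sr_part z v -> sr_part z (a *: u + v);
  sr_partI : forall v, sr_part false v -> sr_part true v -> v = 0;
  sr_split : forall v, exists v0 v1,
    [/\ sr_part false v0, sr_part true v1 & v = v0 + v1];
  sr_actDl : forall v, linear (fun X => sr_act X v);
  sr_actDr : forall X, linear (sr_act X);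
  sr_act_part : forall a b X v,
    X \in ls_part g a -> sr_part b v -> sr_part (a (+) b) (sr_act X v);
  sr_act_br : forall a b X Y v, X \in ls_part g a -> Y \in ls_part g b ->
    sr_act (ls_br X Y) v =
      sr_act X (sr_act Y v) - (-1) ^+ (a && b) *: sr_act Y (sr_act X v)
}.

Section Modules.
Variables (F : fieldType) (g : lieSuper F) (h : {vspace g}).

Section Action.
Variables (V : lmodType F) (act : g -> V -> V).

Definition hw_vector (D0 D1 : {fset weight h}) (la : weight h) (v : V) : Prop :=
  [/\ v != 0,
      forall al X, al \in D0 -> X \in rootsp false al -> act X v = 0,
      forall al X, al \in D1 -> X \in rootsp true al -> act X v = 0
    & forall H : subvs_of h, act (vsval H) v = (la H : F) *: v].

Definition submod (L : {vspace g}) (S : V -> Prop) : Prop :=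
  [/\ S 0, forall a u v, S u -> S v -> S (a *: u + v)
    & forall X v, X \in L -> S v -> S (act X v)].

Definition simple_submod (L : {vspace g}) (S : V -> Prop) : Prop :=
  [/\ submod L S, exists2 v, S v & v != 0
    & forall T : V -> Prop, submod L T -> (forall v, T v -> S v) ->
        (forall v, T v -> v = 0) \/ (forall v, S v -> T v)].

(* The g_0-submodule S is isomorphic to L_0(mu): it is simple and has a      *)
(* highest weight vector of weight mu for D0.                                *)
Definition is_L0 (D0 : {fset weight h}) (mu : weight h) (S : V -> Prop) :=
  simple_submod (ls_part g false) S /\
  exists2 v, S v & hw_vector D0 fset0 mu v.

Definition has_constituent_L0 (D0 : {fset weight h}) (mu : weight h) : Prop :=
  exists S S' : V -> Prop,
  [/\ is_L0 D0 mu S, submod (ls_part g false) S',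
      forall v, S v -> S' v -> v = 0
    & forall v, exists s s', [/\ S s, S' s' & v = s + s']].

End Action.

Definition highest_weight_rep (M : srep g) (D0 D1 : {fset weight h})
    (La : weight h) : Prop :=
  exists v : M, hw_vector (@sr_act _ _ M) D0 D1 La v /\
    forall S : M -> Prop, submod (@sr_act _ _ M) fullv S -> S v ->
      forall w, S w.

End Modules.

Definition unitary (C : numClosedFieldType) (g : lieSuper C) (omega : g -> g)
    (M : srep g) : Prop :=
  exists ip : M -> M -> C,
  [/\ forall w, linear (fun v => ip v w : C^o),
      forall v w, ip w v = (ip v w)^*,
      forall v, v != 0 -> 0 < ip v v,
      forall v w, sr_part false v -> sr_part true w -> ip v w = 0
    & forall X v w, ip (sr_act X v) w = ip v (sr_act (omega X) w)].

(* Over a field F, M (x) F[x_1, ..., x_N] is realized as the space of        *)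
(* finitely supported families of elements of M indexed by the monomials;    *)
(* m (x) p is the family k |-> p_k m.                                        *)
Definition tpoly (F : fieldType) (M : lmodType F) (N : nat) : Type :=
  monalg.malg 'X_{1..N} M.
HB.instance Definition _ (F : fieldType) (M : lmodType F) N :=
  GRing.Zmodule.on (tpoly M N).

HB.lock Definition tp_coef (F : fieldType) (M : lmodType F) (N : nat)
    (u : tpoly M N) (k : 'X_{1..N}) : M :=
  monalg.mcoeff k u.

HB.lock Definition tp_mono (F : fieldType) (M : lmodType F) (N : nat)
    (m : M) (k : 'X_{1..N}) : tpoly M N :=
  monalg.mkmalgU k m.

HB.lock Definition tp_scale (F : fieldType) (M : lmodType F) (N : nat)
    (c : F) (u : tpoly M N) : tpoly M N :=
  \sum_(k <- monalg.msupp u) tp_mono (c *: tp_coef u k) k.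

Section TPoly.
Variables (F : fieldType) (M : lmodType F) (N : nat).
Implicit Types (u v : tpoly M N) (c : F).

Lemma tp_coefD u v k : tp_coef (u + v) k = tp_coef u k + tp_coef v k.
Proof. by rewrite unlock; exact: monalg.mcoeffD. Qed.

Lemma tp_coef_mono (m : M) (k l : 'X_{1..N}) : tp_coef (tp_mono m k) l = m *+ (k == l).
Proof. by rewrite unlock [tp_mono]unlock; exact: (@monalg.mcoeffU _ M). Qed.

Lemma tp_ext u v : (forall k, tp_coef u k = tp_coef v k) -> u = v.
Proof. by rewrite unlock => uv; apply/monalg.malgP. Qed.

Lemma tp_expand u : u = \sum_(k <- monalg.msupp u) tp_mono (tp_coef u k) k.
Proof. rewrite [tp_coef]unlock [tp_mono]unlock; exact: monalg.monalgE. Qed.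

Lemma tp_coef0 k : tp_coef (0 : tpoly M N) k = 0.
Proof. by apply: (addrI (tp_coef 0 k)); rewrite -tp_coefD !addr0. Qed.

Lemma tp_coef_sum (I : Type) (r : seq I) (f : I -> tpoly M N) k :
  tp_coef (\sum_(i <- r) f i) k = \sum_(i <- r) tp_coef (f i) k.
Proof. exact: (big_morph (fun u => tp_coef u k) (fun u v => tp_coefD u v k) (tp_coef0 k)). Qed.

Lemma tp_scaleE c u k : tp_coef (tp_scale c u) k = c *: tp_coef u k.
Proof.
rewrite [tp_scale]unlock tp_coef_sum [in RHS](tp_expand u) tp_coef_sum scaler_sumr.
by apply: eq_bigr => i _; rewrite !tp_coef_mono scalerMnr.
Qed.

Lemma tp_scaleA c1 c2 u : tp_scale c1 (tp_scale c2 u) = tp_scale (c1 * c2) u.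
Proof. by apply: tp_ext => k; rewrite 3!tp_scaleE scalerA. Qed.

Lemma tp_scale1 : left_id 1 (@tp_scale F M N).
Proof. by move=> u; apply: tp_ext => k; rewrite tp_scaleE scale1r. Qed.

Lemma tp_scaleDr : right_distributive (@tp_scale F M N) +%R.
Proof.
by move=> c u v; apply: tp_ext => k; rewrite tp_coefD 3!tp_scaleE tp_coefD scalerDr.
Qed.

Lemma tp_scaleDl u : {morph (@tp_scale F M N)^~ u : a b / a + b}.
Proof.
by move=> a b; apply: tp_ext => k; rewrite tp_coefD 3!tp_scaleE scalerDl.
Qed.

HB.instance Definition _ := GRing.Zmodule_isLmodule.Build F (tpoly M N)
  tp_scaleA tp_scale1 tp_scaleDr tp_scaleDl.

Definition tp_pure (m : M) (p : mpoly.mpoly N F) : tpoly M N :=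
  \sum_(k <- mpoly.msupp p) tp_mono (mpoly.mcoeff k p *: m) k.

Definition tp_map (f : M -> M) (q : mpoly.mpoly N F -> mpoly.mpoly N F)
    (u : tpoly M N) : tpoly M N :=
  \sum_(k <- monalg.msupp u) tp_pure (f (tp_coef u k)) (q 'X_[k]).

End TPoly.

Section Oscillator.
Variables (F : fieldType) (g : lieSuper F) (form : g -> g -> F).
Variables (N : nat) (d x : N.-tuple g).

Let B (X Y : g) : F := form X Y / 2.

Definition alpha (X : g) (p : mpoly.mpoly N F) : mpoly.mpoly N F :=
  \sum_(i < N) \sum_(j < N)
     (B X (ls_br (tnth d i) (tnth d j)) *: ('X_i * 'X_j * p)
      + B X (ls_br (tnth x i) (tnth x j)) *: mderiv i (mderiv j p))
  - 2 *: \sum_(i < N) \sum_(j < N)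
     B X (ls_br (tnth x i) (tnth d j)) *: ('X_j * mderiv i p)
  - \sum_(l < N) B X (ls_br (tnth d l) (tnth x l)) *: p.

Definition osc_act (M : srep g) (X : g) (u : tpoly M N) : tpoly M N :=
  tp_map (sr_act X) id u + tp_map id (alpha X) u.

Definition omega_adapted (h : {vspace g}) (omega : g -> g)
    (D1 : {fset weight h}) (eps : F) : Prop :=
  [/\ basis_of (n1_plus D1) d, basis_of (n1_minus D1) x,
      forall i j, form (tnth d i) (tnth x j) = (i == j)%:R
    & forall i, omega (tnth x i) = eps *: tnth d i].

End Oscillator.

Section MatrixSuper.
Variables (F : fieldType) (p q : nat).
Implicit Types (X Y Z : 'M[F]_(p + q)).

Definition mxpart (z : bool) X : 'M[F]_(p + q) :=
  if z then block_mx 0 (ursubmx X) (dlsubmx X) 0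
  else block_mx (ulsubmx X) 0 0 (drsubmx X).

Definition sbr X Y : 'M[F]_(p + q) :=
  \sum_(a : bool) \sum_(b : bool)
    (mxpart a X *m mxpart b Y - (-1) ^+ (a && b) *: (mxpart b Y *m mxpart a X)).

Definition str X : F := \tr (ulsubmx X) - \tr (drsubmx X).

Fact mxpart_is_linear z : linear (mxpart z).
Proof.
move=> a X Y; rewrite /mxpart /ulsubmx /ursubmx /dlsubmx /drsubmx; case: z;
rewrite !linearP /= scale_block_mx add_block_mx;
by rewrite !scaler0 !addr0.
Qed.
HB.instance Definition _ z := GRing.isLinear.Build F _ _ _ (mxpart z)
  (mxpart_is_linear z).

Lemma mxpartD X : mxpart false X + mxpart true X = X.
Proof. by rewrite /mxpart add_block_mx !(add0r, addr0) submxK. Qed.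

Lemma mxpartK z z' X : mxpart z (mxpart z' X) = if z == z' then mxpart z X else 0.
Proof.
case: z z' => -[] //=; rewrite /mxpart /= ?(block_mxKul, block_mxKur, block_mxKdl, block_mxKdr) //;
by rewrite block_mx_const.
Qed.

Lemma mxpart_other a X : mxpart a X = X -> mxpart (~~ a) X = 0.
Proof. by move=> <-; rewrite mxpartK; case: a. Qed.

Lemma mxpart_mul a b X Y : mxpart a X = X -> mxpart b Y = Y ->
  mxpart (a (+) b) (X *m Y) = X *m Y.
Proof.
move=> <- <-; rewrite /mxpart; case: a; case: b => /=; rewrite mulmx_block;
by rewrite !(mulmx0, mul0mx, addr0, add0r)
  ?(block_mxKul, block_mxKur, block_mxKdl, block_mxKdr).
Qed.

Lemma sbrE a b X Y : mxpart a X = X -> mxpart b Y = Y ->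
  sbr X Y = X *m Y - (-1) ^+ (a && b) *: (Y *m X).
Proof.
move=> hX hY; rewrite /sbr !big_bool /=.
have := mxpart_other hX; have := mxpart_other hY.
by case: a hX; case: b hY => /= -> -> -> ->;
  rewrite !(mulmx0, mul0mx, scaler0, oppr0, addr0, add0r).
Qed.

Lemma sbr_is_linear_l Y : linear (fun X => sbr X Y).
Proof.
move=> c X X'; rewrite /sbr scaler_sumr -big_split /=; apply: eq_bigr => a _.
rewrite scaler_sumr -big_split /=; apply: eq_bigr => b _.
rewrite linearP /= mulmxDl mulmxDr -scalemxAl -scalemxAr !scalerDr !scalerN.
by rewrite opprD addrACA !scalerA [_ * c]mulrC.
Qed.

Lemma sbr_is_linear_r X : linear (sbr X).
Proof.
move=> c Y Y'; rewrite /sbr scaler_sumr -big_split /=; apply: eq_bigr => a _.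
rewrite scaler_sumr -big_split /=; apply: eq_bigr => b _.
rewrite linearP /= mulmxDl mulmxDr -scalemxAl -scalemxAr !scalerDr !scalerN.
by rewrite opprD addrACA !scalerA [_ * c]mulrC.
Qed.

Lemma mxpart_sbr a b X Y : mxpart a X = X -> mxpart b Y = Y ->
  mxpart (a (+) b) (sbr X Y) = sbr X Y.
Proof.
move=> hX hY; rewrite (sbrE hX hY) linearB linearZ /= mxpart_mul //.
by rewrite addbC mxpart_mul.
Qed.

Lemma sbr_skew a b X Y : mxpart a X = X -> mxpart b Y = Y ->
  sbr X Y = - ((-1) ^+ (a && b) *: sbr Y X).
Proof.
move=> hX hY; rewrite (sbrE hX hY) (sbrE hY hX) [b && a]andbC scalerBr scalerA.
by rewrite -expr2 sqrr_sign scale1r opprB.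
Qed.

Lemma sbr_jacobi a b X Y Z : mxpart a X = X -> mxpart b Y = Y ->
  sbr X (sbr Y Z) = sbr (sbr X Y) Z + (-1) ^+ (a && b) *: sbr Y (sbr X Z).
Proof.
move=> hX hY.
have hom c Z' : mxpart c Z' = Z' ->
  sbr X (sbr Y Z') = sbr (sbr X Y) Z' + (-1) ^+ (a && b) *: sbr Y (sbr X Z').
  move=> hZ.
  rewrite (sbrE hX (mxpart_sbr hY hZ)) (sbrE (mxpart_sbr hX hY) hZ).
  rewrite (sbrE hY (mxpart_sbr hX hZ)) (sbrE hX hY) (sbrE hX hZ) (sbrE hY hZ).
  rewrite !(mulmxBl, mulmxBr) -!(scalemxAl, scalemxAr) !mulmxA.
  rewrite !scalerBr !scalerA.
  move: (X *m Y *m Z') (X *m Z' *m Y) (Y *m X *m Z') (Y *m Z' *m X)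
    (Z' *m X *m Y) (Z' *m Y *m X) => t1 t2 t3 t4 t5 t6.
  apply/matrixP => i j; rewrite !mxE.
  by case: a b c {hX hY hZ} => -[] [] /=; rewrite ?(expr0, expr1); ring.
rewrite -[Z]mxpartD.
have addr_ W W1 W2 : sbr W (W1 + W2) = sbr W W1 + sbr W W2.
  by have := sbr_is_linear_r W 1 W1 W2; rewrite !scale1r.
rewrite !addr_ scalerDr addrACA.
by congr (_ + _); [apply: (hom false) | apply: (hom true)]; rewrite mxpartK eqxx.
Qed.

End MatrixSuper.

(* A graded subspace of matrices closed under the super-bracket is a Lie     *)
(* superalgebra, with carrier subvs_of U.                                    *)
Section SubSuper.
Variables (F : fieldType) (p q : nat) (U : {vspace 'M[F]_(p + q)}).
Hypothesis U_part : forall z X, X \in U -> mxpart z X \in U.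
Hypothesis U_br : forall X Y, X \in U -> Y \in U -> sbr X Y \in U.

Definition subs_part (z : bool) : {vspace subvs_of U} :=
  lker (linfun (fun X : subvs_of U => vsproj U (vsval X - mxpart z (vsval X)))).

Definition subs_br (X Y : subvs_of U) : subvs_of U :=
  vsproj U (sbr (vsval X) (vsval Y)).

Lemma subs_partP z (X : subvs_of U) :
  (X \in subs_part z) = (mxpart z (vsval X) == vsval X).
Proof.
have lin : linear (fun X : subvs_of U => vsproj U (vsval X - mxpart z (vsval X))).
  move=> c Y Z; rewrite -[RHS]linearP; congr (vsproj U _).
  rewrite [vsval (_ + _)]linearP [mxpart z (_ + _)]linearP /=.
  by rewrite scalerBr opprD addrACA.
  pose f : {linear subvs_of U -> subvs_of U} :=
  HB.pack (fun X : subvs_of U => vsproj U (vsval X - mxpart z (vsval X)))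
    (GRing.isLinear.Build F _ _ _ _ lin).
rewrite memv_ker (lfunE f) /=.
have mU : vsval X - mxpart z (vsval X) \in U.
  by rewrite rpredB ?U_part // subvsP.
by rewrite -(inj_eq val_inj) /= vsprojK // subr_eq0 eq_sym.
Qed.

Fact subs_partI : (subs_part false :&: subs_part true = 0)%VS.
Proof.
apply/eqP; rewrite -subv0; apply/subvP => X; rewrite memv_cap !subs_partP memv0.
move=> /andP[/eqP h0 /eqP h1]; apply/eqP/val_inj => /=.
by rewrite -[LHS]h1 (mxpart_other h0).
Qed.

Fact subs_partD : (subs_part false + subs_part true = fullv)%VS.
Proof.
apply/eqP; rewrite eqEsubv subvf /=; apply/subvP => X _.
have -> : X = vsproj U (mxpart false (vsval X)) + vsproj U (mxpart true (vsval X)).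
  by rewrite -linearD /= mxpartD vsvalK.
by apply: memv_add; rewrite subs_partP vsprojK ?mxpartK // U_part ?subvsP.
Qed.

Fact subs_brDl (Y : subvs_of U) : linear (fun X => subs_br X Y).
Proof.
by move=> c X X'; rewrite /subs_br linearP /= sbr_is_linear_l linearP.
Qed.

Fact subs_brDr (X : subvs_of U) : linear (subs_br X).
Proof.
by move=> c Y Y'; rewrite /subs_br linearP /= sbr_is_linear_r linearP.
Qed.

Lemma subs_brE (X Y : subvs_of U) : vsval (subs_br X Y) = sbr (vsval X) (vsval Y).
Proof. by rewrite vsprojK // U_br ?subvsP. Qed.

Fact subs_br_part a b (X Y : subvs_of U) :
  X \in subs_part a -> Y \in subs_part b -> subs_br X Y \in subs_part (a (+) b).
Proof.
rewrite !subs_partP subs_brE => /eqP hX /eqP hY.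
by rewrite mxpart_sbr.
Qed.

Fact subs_skew a b (X Y : subvs_of U) : X \in subs_part a -> Y \in subs_part b ->
  subs_br X Y = - ((-1) ^+ (a && b) *: subs_br Y X).
Proof.
rewrite !subs_partP => /eqP hX /eqP hY; apply: val_inj.
by rewrite /= !subs_brE (sbr_skew hX hY).
Qed.

Fact subs_jacobi a b (X Y Z : subvs_of U) :
  X \in subs_part a -> Y \in subs_part b ->
  subs_br X (subs_br Y Z) =
    subs_br (subs_br X Y) Z + (-1) ^+ (a && b) *: subs_br Y (subs_br X Z).
Proof.
rewrite !subs_partP => /eqP hX /eqP hY; apply: val_inj.
by rewrite /= !subs_brE (sbr_jacobi _ hX hY).
Qed.

Definition sub_lieSuper : lieSuper F :=
  LieSuper subs_partI subs_partD subs_brDl subs_brDr subs_br_part subs_skew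
    subs_jacobi.

End SubSuper.

Section ClassicalAlgebras.
Variable F : fieldType.

Section GL.
Variables p q : nat.

Fact gl_part z (X : 'M[F]_(p + q)) : X \in fullv -> mxpart z X \in fullv.
Proof. by move=> _; rewrite memvf. Qed.
Fact gl_br (X Y : 'M[F]_(p + q)) :
  X \in fullv -> Y \in fullv -> sbr X Y \in fullv.
Proof. by move=> _ _; rewrite memvf. Qed.

Definition gl_lieSuper : lieSuper F := sub_lieSuper gl_part gl_br.

Definition sl_space : {vspace 'M[F]_(p + q)} :=
  lker (linfun (fun X : 'M[F]_(p + q) => str X : F^o)).

Fact str_is_linear : linear (fun X : 'M[F]_(p + q) => str X : F^o).
Proof.
move=> c X Y; rewrite /str /ulsubmx /drsubmx !linearP /=.
by rewrite scalerBr opprD addrACA.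
Qed.

Lemma sl_spaceP X : (X \in sl_space) = (str X == 0).
Proof.
pose f : {linear 'M[F]_(p + q) -> F^o} := HB.pack (fun X => str X : F^o)
  (GRing.isLinear.Build F _ _ _ _ str_is_linear).
by rewrite memv_ker (lfunE f).
Qed.

Fact sl_part z X : X \in sl_space -> mxpart z X \in sl_space.
Proof.
rewrite !sl_spaceP => /eqP hX; apply/eqP.
rewrite /str /mxpart; case: z.
  by rewrite block_mxKul block_mxKdr !mxtrace0 subrr.
by rewrite block_mxKul block_mxKdr.
Qed.

Lemma str_homog a b (X Y : 'M[F]_(p + q)) : mxpart a X = X -> mxpart b Y = Y ->
  str (X *m Y) = (-1) ^+ (a && b) * str (Y *m X).
Proof.
move=> <- <-; rewrite /str /mxpart; case: a; case: b => /=;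
rewrite !mulmx_block ?(block_mxKul, block_mxKdr);
rewrite !(mulmx0, mul0mx, addr0, add0r, mxtrace0, oppr0, addr0, mulr0) //.
  by rewrite expr1 mulN1r opprB; congr (_ - _); apply: mxtrace_mulC.
by rewrite expr0 mul1r; congr (_ - _); apply: mxtrace_mulC.
Qed.

Fact sl_br X Y : X \in sl_space -> Y \in sl_space -> sbr X Y \in sl_space.
Proof.
move=> _ _; rewrite /sbr; apply: rpred_sum => a _; apply: rpred_sum => b _.
rewrite sl_spaceP; apply/eqP.
rewrite -scaleNr addrC str_is_linear.
rewrite scaleNr (@str_homog a b (mxpart a X) (mxpart b Y)) ?mxpartK ?eqxx //.
exact: addNr.
Qed.

Definition sl_lieSuper : lieSuper F := sub_lieSuper sl_part sl_br.

End GL.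

Definition Omega (n : nat) : 'M[F]_(n + n) := block_mx 0 1%:M (- 1%:M) 0.

Section OSP.
Variables m n : nat.

Definition osp_defect (X : 'M[F]_(m + (n + n))) : 'M[F]_(m + (n + n)) :=
  block_mx (ulsubmx X + (ulsubmx X)^T) 0
    (dlsubmx X + Omega n *m (ursubmx X)^T)
    (drsubmx X - Omega n *m (drsubmx X)^T *m Omega n).

Definition osp_space : {vspace 'M[F]_(m + (n + n))} := lker (linfun osp_defect).

Fact osp_defect_is_linear : linear osp_defect.
Proof.
move=> c X Y; rewrite /osp_defect /ulsubmx /ursubmx /dlsubmx /drsubmx.
rewrite scale_block_mx add_block_mx scaler0 addr0.
rewrite !linearP /= ?mulmxDl -?scalemxAl !scalerDr ?scalerN.
by congr block_mx; rewrite ?opprD addrACA.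
Qed.

Lemma osp_spaceP X : reflect
  [/\ ulsubmx X = - (ulsubmx X)^T,
      dlsubmx X = - (Omega n *m (ursubmx X)^T)
    & drsubmx X = Omega n *m (drsubmx X)^T *m Omega n]
  (X \in osp_space).
Proof.
pose f : {linear 'M[F]_(m + (n + n)) -> 'M[F]_(m + (n + n))} :=
  HB.pack osp_defect (GRing.isLinear.Build F _ _ _ _ osp_defect_is_linear).
rewrite memv_ker (lfunE f) /= /osp_defect; apply: (iffP eqP).
  rewrite -[0 in RHS](@block_mx0 _ m (n + n) m (n + n)).
  move/eq_block_mx => [hA _ hC hD]; split; apply/eqP.
  - by rewrite -addr_eq0 hA.
  - by rewrite -addr_eq0 hC.
  - by rewrite -subr_eq0 hD.
case=> hA hC hD.
by rewrite -hD subrr {1}hA {1}hC !addNr block_mx0.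
Qed.

Lemma tr_Omega : (Omega n)^T = - Omega n.
Proof.
rewrite /Omega tr_block_mx !trmx0 linearN /= trmx1 opp_block_mx !oppr0 opprK.
by [].
Qed.

Lemma Omega_sqr : Omega n *m Omega n = - 1%:M.
Proof.
rewrite /Omega mulmx_block !(mul0mx, mulmx0, mul1mx, mulmx1, addr0, add0r).
by rewrite [in RHS]scalar_mx_block opp_block_mx oppr0.
Qed.

Fact osp_part z X : X \in osp_space -> mxpart z X \in osp_space.
Proof.
move=> /osp_spaceP[hA hC hD]; apply/osp_spaceP.
rewrite /mxpart; case: z;
rewrite ?(block_mxKul, block_mxKur, block_mxKdl, block_mxKdr).
  by rewrite !trmx0 oppr0 mulmx0 mul0mx.
by rewrite !trmx0 mulmx0 oppr0.
Qed.

Lemma osp_block A B C D : block_mx A B C D \in osp_space ->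
  [/\ A^T = - A, C = - (Omega n *m B^T), C^T = B *m Omega n
    & D^T = Omega n *m D *m Omega n].
Proof.
move=> /osp_spaceP; rewrite block_mxKul block_mxKur block_mxKdl block_mxKdr.
case=> hA hC hD; split=> //.
- by rewrite [in RHS]hA opprK.
- by rewrite hC linearN /= trmx_mul trmxK tr_Omega mulmxN opprK.
- rewrite [D in RHS]hD !mulmxA Omega_sqr mulNmx mul1mx -mulmxA Omega_sqr.
  by rewrite mulNmx mulmxN mulmx1 opprK.
Qed.

Lemma osp_sbr_homog a b X Y : X \in osp_space -> Y \in osp_space ->
  mxpart a X *m mxpart b Y - (-1) ^+ (a && b) *: (mxpart b Y *m mxpart a X)
    \in osp_space.
Proof.
have OmO k (M : 'M_(n + n, k)) : Omega n *m (Omega n *m M) = - M.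
  by rewrite mulmxA Omega_sqr mulNmx mul1mx.
have MOO k (M : 'M_(k, n + n)) : M *m Omega n *m Omega n = - M.
  by rewrite -mulmxA Omega_sqr mulmxN mulmx1.
have ev_od X' Y' : X' \in osp_space -> Y' \in osp_space ->
    mxpart false X' *m mxpart true Y' - mxpart true Y' *m mxpart false X'
      \in osp_space.
  rewrite -[X']submxK -[Y']submxK.
  move: (ulsubmx X') (ursubmx X') (dlsubmx X') (drsubmx X') => A B C D.
  move: (ulsubmx Y') (ursubmx Y') (dlsubmx Y') (drsubmx Y') => A' B' C' D'.
  move=> /osp_block[hA hC hCt hD] /osp_block[hA' hC' hCt' hD'].
  rewrite /mxpart !(block_mxKul, block_mxKur, block_mxKdl, block_mxKdr).
  rewrite !mulmx_block !(mulmx0, mul0mx, addr0, add0r).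
  rewrite opp_block_mx add_block_mx !oppr0 !addr0.
  apply/osp_spaceP.
  rewrite !(block_mxKul, block_mxKur, block_mxKdl, block_mxKdr).
  split; rewrite ?trmx0 ?mulmx0 ?mul0mx ?oppr0 //.
  rewrite linearB /= !trmx_mul hA hD hC' mulmxBr mulmxN mulNmx !mulmxN.
  by rewrite opprB opprK !mulmxA Omega_sqr !mulNmx mul1mx opprK addrC.
case: a; case: b => hX hY; rewrite /= ?expr0 ?scale1r; last 1 first.
- move: hX hY; rewrite -{1}[X]submxK -{1}[Y]submxK.
  move=> /osp_block[hA _ _ hD] /osp_block[hA' _ _ hD'].
  rewrite /mxpart !mulmx_block !(mulmx0, mul0mx, addr0, add0r).
  rewrite opp_block_mx add_block_mx !oppr0 !addr0.
  apply/osp_spaceP.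
  rewrite !(block_mxKul, block_mxKur, block_mxKdl, block_mxKdr).
  split; rewrite ?trmx0 ?mulmx0 ?mul0mx ?oppr0 //.
    by rewrite linearB /= !trmx_mul hA hA' !mulmxN !mulNmx !opprK opprB.
  rewrite linearB /= !trmx_mul hD hD' mulmxBr mulmxBl -!mulmxA !OmO !mulmxN.
  by rewrite !Omega_sqr !(mulmxN, mulmx1, opprK) addrC.
- move: hX hY; rewrite -{1}[X]submxK -{1}[Y]submxK.
  move=> /osp_block[_ hC hCt _] /osp_block[_ hC' hCt' _].
  rewrite expr1 scaleN1r opprK.
  rewrite /mxpart !mulmx_block !(mulmx0, mul0mx, addr0, add0r).
  rewrite add_block_mx !addr0.
  apply/osp_spaceP.
  rewrite !(block_mxKul, block_mxKur, block_mxKdl, block_mxKdr).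
  split; rewrite ?trmx0 ?mulmx0 ?mul0mx ?oppr0 //.
    rewrite linearD /= !trmx_mul hCt hCt' hC hC'.
    by rewrite !mulmxN !mulmxA opprD addrC.
  rewrite linearD /= !trmx_mul hCt hCt' hC hC' mulmxDr mulmxDl.
  by rewrite !mulmxA !MOO !mulNmx addrC.
- rewrite -opprB rpredN; exact: ev_od.
- exact: ev_od.
Qed.

Fact osp_br X Y : X \in osp_space -> Y \in osp_space -> sbr X Y \in osp_space.
Proof.
move=> hX hY; rewrite /sbr; apply: rpred_sum => a _; apply: rpred_sum => b _.
exact: osp_sbr_homog.
Qed.

Definition osp_lieSuper : lieSuper F := sub_lieSuper osp_part osp_br.

End OSP.
End ClassicalAlgebras.

(* A Lie superalgebra with its invariant form, Cartan subalgebra, fixed even *)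
(* positive system and conjugate-linear anti-involution.                     *)
Record datum (C : numClosedFieldType) := Datum {
  dg : lieSuper C;
  dform : dg -> dg -> C;
  dh : {vspace dg};
  dpos0 : {fset weight dh};
  domega : dg -> dg
}.

Definition ltpairs (n : nat) : seq ('I_n * 'I_n) :=
  [seq ij : 'I_n * 'I_n <- enum {: 'I_n * 'I_n} | (ij.1 < ij.2)%N].

Section MatrixData.
Variables (C : numClosedFieldType) (p q : nat) (U : {vspace 'M[C]_(p + q)}).
Hypothesis U_part : forall z X, X \in U -> mxpart z X \in U.
Hypothesis U_br : forall X Y, X \in U -> Y \in U -> sbr X Y \in U.

Let g := sub_lieSuper U_part U_br.

Definition mx_form (c : C) (X Y : subvs_of U) : C :=
  c * str (vsval X *m vsval Y).

Definition mx_omega (J : 'M[C]_(p + q)) (X : subvs_of U) : subvs_of U :=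
  vsproj U (invmx J *m (map_mx Num.conj (vsval X))^T *m J).

Definition diag_cartan : {vspace g} :=
  lker (linfun (fun X : subvs_of U =>
    vsval X - diag_mx (\row_i vsval X i i))).

Definition diag_coord (i : 'I_(p + q)) : weight diag_cartan :=
  linfun (fun H : subvs_of diag_cartan =>
    vsval (vsval H : subvs_of U) i i : C^o).

Definition diag_pos0 : {fset weight diag_cartan} :=
  let eps i := diag_coord (lshift q i) in
  let del a := diag_coord (rshift p a) in
  [fset al in ([seq eps ij.1 - eps ij.2 | ij <- ltpairs p]
            ++ [seq del ab.1 - del ab.2 | ab <- ltpairs q])%R]%fset.

Definition diag_datum (J : 'M[C]_(p + q)) : datum C :=
  @Datum C g (mx_form 1) diag_cartan diag_pos0 (mx_omega J).

End MatrixData.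

Section ClassicalData.
Variable C : numClosedFieldType.

(* diag(I_r, -I_(m-r), (-1)^s I_n)                                           *)
Definition A_J (m n r : nat) (s : bool) : 'M[C]_(m + n) :=
  block_mx (diag_mx (\row_(i < m) (if (i < r)%N then 1 else -1))) 0
           0 ((-1) ^+ s)%:M.

Definition sl_datum (m n r : nat) (s : bool) : datum C :=
  diag_datum (@sl_part C m n) (@sl_br C m n) (A_J m n r s).

Definition gl_datum (n r : nat) (s : bool) : datum C :=
  diag_datum (@gl_part C n n) (@gl_br C n n) (A_J n n r s).

Fact od_subproof m (k : 'I_(m./2)) : (k.*2.+1 < m)%N.
Proof.
have := ltn_ord k; rewrite -(leq_double k.+1) doubleS => h.
by apply: leq_trans h _; rewrite -[leqRHS](odd_double_half m) leq_addl.
Qed.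
Fact ev_subproof m (k : 'I_(m./2)) : (k.*2 < m)%N.
Proof. exact: ltnW (od_subproof k). Qed.

(* The rows 2k and 2k + 1 (counted from 0) carry the k-th 2 x 2 block.       *)
Definition ev m (k : 'I_(m./2)) : 'I_m := Ordinal (ev_subproof k).
Definition od m (k : 'I_(m./2)) : 'I_m := Ordinal (od_subproof k).

Section OSPData.
Variables m n : nat.

(* The block K = (0 i; -i 0) = i Omega_1 in position k.                      *)
Definition Kmx (k : 'I_(m./2)) : 'M[C]_m :=
  'i *: (delta_mx (ev k) (od k) - delta_mx (od k) (ev k)).

Definition osp_H (t : 'rV[C]_(m./2)) (d : 'rV[C]_n) : 'M[C]_(m + (n + n)) :=
  block_mx (\sum_k t 0 k *: Kmx k) 0
           0 ('i *: (Omega C n *m block_mx (diag_mx d) 0 0 (diag_mx d))).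

Definition osp_cartan : {vspace osp_lieSuper C m n} :=
  limg (linfun (fun td : 'rV[C]_(m./2) * 'rV[C]_n =>
    vsproj (osp_space C m n) (osp_H td.1 td.2))).

Definition osp_eps (k : 'I_(m./2)) : weight osp_cartan :=
  linfun (fun H : subvs_of osp_cartan =>
    - 'i * vsval (vsval H : subvs_of (osp_space C m n))
             (lshift (n + n) (ev k)) (lshift (n + n) (od k)) : C^o).

Definition osp_del (a : 'I_n) : weight osp_cartan :=
  linfun (fun H : subvs_of osp_cartan =>
    - 'i * vsval (vsval H : subvs_of (osp_space C m n))
             (rshift m (lshift n a)) (rshift m (rshift n a)) : C^o).

Definition osp_pos0 : {fset weight osp_cartan} :=
  [fset al in
      ([seq osp_del ab.1 + osp_del ab.2 | ab <- ltpairs n]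
    ++ [seq osp_del ab.1 - osp_del ab.2 | ab <- ltpairs n]
    ++ [seq osp_del a *+ 2 | a : 'I_n]
    ++ [seq osp_eps ij.1 + osp_eps ij.2 | ij <- ltpairs (m./2)]
    ++ [seq osp_eps ij.1 - osp_eps ij.2 | ij <- ltpairs (m./2)]
    ++ (if odd m then [seq osp_eps i | i : 'I_(m./2)] else [::]))%R]%fset.

Definition osp_J1 (s : bool) : 'M[C]_(m + (n + n)) :=
  block_mx ((-1) ^+ s)%:M 0 0 ('i *: Omega C n).

Definition osp_J2 (s : bool) : 'M[C]_(m + (n + n)) :=
  block_mx (\sum_k Kmx k) 0 0 ((-1) ^+ s)%:M.

Definition osp_datum (J : 'M[C]_(m + (n + n))) : datum C :=
  @Datum C (osp_lieSuper C m n) (mx_form 2^-1) osp_cartan osp_pos0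
    (mx_omega J).

End OSPData.
End ClassicalData.

Section ExceptionalData.
Variables (C : numClosedFieldType) (g : lieSuper C).

Definition so_mx n (A : 'M[C]_n) : Prop := A^T = - A.
Definition sl2_mx (B : 'M[C]_2) : Prop := \tr B = 0.

(* f is an isomorphism over the scalars K from the Lie algebra P (+) Q of    *)
(* matrices onto the Lie subalgebra u of g_0.                                *)
Definition lie_iso (K : {pred C}) (P : 'M[C]_7 -> Prop) (Q : 'M[C]_2 -> Prop)
    (u : g -> Prop) (f : 'M[C]_7 -> 'M[C]_2 -> g) : Prop :=
  [/\ forall A B, P A -> Q B -> u (f A B),
      forall a A A' B B', a \in K -> P A -> P A' -> Q B -> Q B' ->
        f (a *: A + A') (a *: B + B') = a *: f A B + f A' B',
      forall A A' B B', P A -> P A' -> Q B -> Q B' ->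
        f (A *m A' - A' *m A) (B *m B' - B' *m B) = ls_br (f A B) (f A' B'),
      forall A B, P A -> Q B -> f A B = 0 -> A = 0 /\ B = 0
    & forall X, u X -> exists A B, [/\ P A, Q B & X = f A B]].

Definition simple_lieSuper : Prop :=
  (exists X Y : g, ls_br X Y != 0) /\
  forall I : {vspace g},
    I = ((I :&: ls_part g false) + (I :&: ls_part g true))%VS ->
    (forall X Y, Y \in I -> ls_br X Y \in I) ->
    I = 0%VS \/ I = fullv.

Definition clifford (gam : 'I_7 -> 'M[C]_8) : Prop :=
  forall i j, gam i *m gam j + gam j *m gam i = (2 *+ (i == j))%:M.

(* The action of so(7) on an 8-dimensional module over its Clifford algebra. *)
Definition spin (gam : 'I_7 -> 'M[C]_8) (A : 'M[C]_7) : 'M[C]_8 :=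
  4^-1 *: \sum_i \sum_j A i j *: (gam i *m gam j).

(* F(4) is the simple Lie superalgebra with even part so(7) (+) sl(2) and    *)
(* odd part spin (x) C^2; 8 x 2 matrices realize spin (x) C^2.               *)
Definition is_F4 : Prop :=
  simple_lieSuper /\
  exists (f : 'M[C]_7 -> 'M[C]_2 -> g) (gam : 'I_7 -> 'M[C]_8)
         (psi : {linear 'M[C]_(8, 2) -> g}),
  [/\ lie_iso predT (@so_mx 7) sl2_mx (fun X => X \in ls_part g false) f,
      clifford gam,
      injective psi,
      forall X, X \in ls_part g true <-> exists S, X = psi S
    & forall A B S, so_mx A -> sl2_mx B ->
        ls_br (f A B) (psi S) = psi (spin gam A *m S + S *m B^T)].

Definition endo_trace (f : 'End(g)) : C :=
  \sum_(i < \dim {:g}) coord (vbasis {:g}) i (f (vbasis {:g})`_i).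

Definition endo_str (f : 'End(g)) : C :=
  endo_trace ((daddv_pi (ls_part g false) (ls_part g true)
               - daddv_pi (ls_part g true) (ls_part g false)) \o f)%VF.

Definition F4_form (X Y : g) : C :=
  6^-1 * endo_str (linfun (ls_br X) \o linfun (ls_br Y))%VF.

Definition conj_antiinvolution (omega : g -> g) : Prop :=
  [/\ forall a X Y, omega (a *: X + Y) = a^* *: omega X + omega Y,
      forall z X, X \in ls_part g z -> omega X \in ls_part g z,
      forall X, omega (omega X) = X
    & forall X Y, omega (ls_br X Y) = ls_br (omega Y) (omega X)].

Definition real_even (omega : g -> g) (X : g) : Prop :=
  X \in ls_part g false /\ omega X = - X.

Definition so7R (A : 'M[C]_7) : Prop := A \is a mxOver Num.real /\ so_mx A.
Definition sl2R (B : 'M[C]_2) : Prop := B \is a mxOver Num.real /\ sl2_mx B.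
Definition so25R (A : 'M[C]_7) : Prop :=
  let eta : 'M[C]_7 := diag_mx (\row_i (if (i < 2)%N then 1 else -1)) in
  A \is a mxOver Num.real /\ A^T *m eta + eta *m A = 0.
Definition su2 (B : 'M[C]_2) : Prop :=
  (map_mx Num.conj B)^T = - B /\ \tr B = 0.

Definition F4_omega (omega : g -> g) : Prop :=
  conj_antiinvolution omega /\
  ((exists f, lie_iso Num.real so7R sl2R (real_even omega) f) \/
   (exists f, lie_iso Num.real so25R su2 (real_even omega) f)).

Definition real_subalgebra (T : g -> Prop) : Prop :=
  [/\ T 0, forall a X Y, a \is Num.real -> T X -> T Y -> T (a *: X + Y)
    & forall X Y, T X -> T Y -> T (ls_br X Y)].

(* K is compactly embedded in u: some inner product on u is ad(K)-invariant. *)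
Definition compact_subalgebra (u K : g -> Prop) : Prop :=
  [/\ real_subalgebra K, forall X, K X -> u X
    & exists ip : g -> g -> C,
      [/\ forall X Y, u X -> u Y -> ip X Y \is Num.real /\ ip X Y = ip Y X,
          forall a X Y Z, a \is Num.real -> u X -> u Y -> u Z ->
            ip (a *: X + Y) Z = a * ip X Z + ip Y Z,
          forall X, u X -> X != 0 -> 0 < ip X X
        & forall Z X Y, K Z -> u X -> u Y ->
            ip (ls_br Z X) Y = - ip X (ls_br Z Y)]].

Definition maximal_compact (u K : g -> Prop) : Prop :=
  compact_subalgebra u K /\
  forall K' : g -> Prop, compact_subalgebra u K' ->
    (forall X, K X -> K' X) -> forall X, K' X -> K X.

Definition cartan_subalgebra (K T : g -> Prop) : Prop :=
  [/\ real_subalgebra T, forall X, T X -> K X,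
      exists n, forall (s : n.-tuple g) X, (forall i, T (tnth s i)) -> T X ->
        foldr (@ls_br _ g) X s = 0
    & forall X, K X -> (forall Y, T Y -> T (ls_br X Y)) -> T X].

Definition F4_cartan (omega : g -> g) (h : {vspace g}) : Prop :=
  exists K T : g -> Prop,
  [/\ maximal_compact (real_even omega) K, cartan_subalgebra K T
    & forall X, X \in h <-> exists Y Z, [/\ T Y, T Z & X = Y + 'i *: Z]].

Definition F4_pos0 (h : {vspace g}) (e : 'I_3 -> weight h) (d : weight h) :
    {fset weight h} :=
  [fset al in (d :: [seq e i | i : 'I_3]
    ++ [seq e ij.1 + e ij.2 | ij <- ltpairs 3]
    ++ [seq e ij.1 - e ij.2 | ij <- ltpairs 3])%R]%fset.

(* The coordinates e_1, e_2, e_3, d on h in which the even roots have their  *)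
(* standard form.                                                            *)
Definition F4_coordinates (h : {vspace g}) (e : 'I_3 -> weight h)
    (d : weight h) : Prop :=
  basis_of fullv (d :: [seq e i | i : 'I_3]) /\
  forall al, is_root false al =
    (al \in F4_pos0 e d) || (- al \in F4_pos0 e d).

End ExceptionalData.

Inductive admissible (C : numClosedFieldType) : datum C -> Prop :=
| admissible_sl m n r s of (0 < m)%N & (0 < n)%N & m <> n & (r <= m)%N :
    admissible (sl_datum C m n r s)
| admissible_gl n r s of (0 < n)%N & (r <= n)%N :
    admissible (gl_datum C n r s)
| admissible_osp1 m n s of (0 < m)%N & (0 < n)%N :
    admissible (osp_datum (osp_J1 C m n s))
| admissible_osp2 m n s of (0 < m)%N & (0 < n)%N & ~~ odd m :
    admissible (osp_datum (osp_J2 C m n s))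
| admissible_F4 (g : lieSuper C) (h : {vspace g}) (e : 'I_3 -> weight h)
    (d : weight h) (omega : g -> g) of
    is_F4 g & F4_omega omega & F4_cartan omega h & F4_coordinates e d :
    admissible (@Datum C g (@F4_form C g) h (F4_pos0 e d) omega).

(* Main.v *)
(* Let e_a run through the basis (d_i, x_i) of g_1 and let c^a be the dual elements
   of the Weyl algebra, acting on C[x].  The Dirac operator D = sum_a e_a (x) c^a on
   M (x) C[x] satisfies 2 D^2 = Omega_0(diag) - Omega (x) 1 - 1 (x) alpha(Omega_0),
   where Omega, Omega_0 are the Casimir elements of g, g_0 and diag is the diagonal
   action of g_0.  The last term is a scalar, because the symmetrized quartic part of
   alpha(Omega_0) vanishes by the Bianchi identity; its value is read off at the
   constant 1, a highest weight vector of weight -rho_1.  Hence on a highest weight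
   vector of weight mu, 2 D^2 is the difference in the statement.  For the product of
   the form of M with the Fischer product, x_i and d/dx_i are adjoint and omega(x_i) =
   eps d_i, so that D^* = - eps D and - eps D^2 = D^* D is nonnegative.

   This needs g_0 to be spanned by root spaces, h to be the zero weight space, and root
   spaces to be at most one-dimensional.  For matrices these are read off from an
   equivariant embedding of g into matrices with entries of known weights.  For F(4),
   the even part follows from counting dimensions, 24 = 4 + 20; two independent odd
   root vectors of the same root al would contradict the one-dimensionality of an even
   root space, of root 2 al if al is not isotropic and of a root not orthogonal to al
   otherwise. *)

Require Import Defs.
From HB Require Import structures.
From mathcomp Require Import all_boot all_order all_algebra.
From mathcomp Require Import finmap complex reals.
From mathcomp Require Import monalg mpoly ring.

Set Implicit Arguments.
Unset Strict Implicit.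
Unset Printing Implicit Defensive.

Import Order.TTheory GRing.Theory Num.Theory.
Local Open Scope ring_scope.

(** * Invariant forms *)

(** The form is alternating on g_1, so the natural algebra on g_1 is a Weyl algebra, and its
    commutators play the part that anticommutators of a Clifford algebra play in the Dirac operator
    of a reductive pair. With d_i paired with multiplication by x_i, and x_i with - d/dx_i, D =
    sum_i (d_i (x) x_i - x_i (x) d/dx_i); the relative minus sign is where the sign of - eps comes
    from. Only the highest weight vector u of weight mu enters, and the inequality is 2 <Du, Du> >=
    0 divided by <u, u>.

    The roots of h are not given by a table, and much is extracted from the pairing of the adapted
    bases: it forces g_1 to be n_1^+ + n_1^- and the form to be nondegenerate there. For F(4) it
    also exhibits a nonzero value of the form, whose radical, a graded ideal of a simple algebra,
    then vanishes; no value of the form is computed. This explains the two records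
    [weight_structure] and [root_structure]: the second adds multiplicity one, which for odd roots
    of F(4) is deduced from the first together with the adapted bases. *)

Section Brackets.
Variables (F : fieldType) (g : lieSuper F).
Implicit Types X Y Z : g.

HB.instance Definition _ X := GRing.isLinear.Build F g g _ (@ls_br F g X) (@ls_brDr F g X).

Lemma brDl X Y Z : ls_br (X + Y) Z = ls_br X Z + ls_br Y Z.
Proof. by have := ls_brDl Z 1 X Y; rewrite !scale1r. Qed.

Lemma br0l Y : ls_br (0 : g) Y = 0.
Proof. by apply: (addrI (ls_br 0 Y)); rewrite -brDl !addr0. Qed.

Lemma brZl a X Y : ls_br (a *: X) Y = a *: ls_br X Y.
Proof. by have := ls_brDl Y a X 0; rewrite !addr0 br0l addr0. Qed.

Lemma brZr a X Y : ls_br X (a *: Y) = a *: ls_br X Y.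
Proof. exact: linearZ. Qed.

Lemma br_sumr (I : Type) (r : seq I) (P : pred I) (f : I -> g) X :
  ls_br X (\sum_(i <- r | P i) f i) = \sum_(i <- r | P i) ls_br X (f i).
Proof. exact: linear_sum. Qed.

Lemma brNr X Y : ls_br X (- Y) = - ls_br X Y.
Proof. exact: linearN. Qed.

Lemma brDr X Y Z : ls_br X (Y + Z) = ls_br X Y + ls_br X Z.
Proof. exact: linearD. Qed.

Lemma br0r X : ls_br X (0 : g) = 0.
Proof. exact: linear0. Qed.

Lemma br_suml (I : Type) (r : seq I) (P : pred I) (f : I -> g) Y :
  ls_br (\sum_(i <- r | P i) f i) Y = \sum_(i <- r | P i) ls_br (f i) Y.
Proof.
exact: (big_morph (fun X => ls_br X Y) (fun X X' => brDl X X' Y) (br0l Y)).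
Qed.

Lemma br_skew0 z X Y : X \in ls_part g false -> Y \in ls_part g z ->
  ls_br X Y = - ls_br Y X.
Proof. by move=> hX hY; rewrite (ls_skew hX hY) /= expr0 scale1r. Qed.

Lemma br_sym1 X Y : X \in ls_part g true -> Y \in ls_part g true ->
  ls_br X Y = ls_br Y X.
Proof. by move=> hX hY; rewrite (ls_skew hX hY) /= expr1 scaleN1r opprK. Qed.

(** Against an even X the sign of the Jacobi identity is trivial for both components of Y, so Y need
    not be homogeneous. *)
Lemma jacobi0 X Y Z : X \in ls_part g false ->
  ls_br X (ls_br Y Z) = ls_br (ls_br X Y) Z + ls_br Y (ls_br X Z).
Proof.
have -> : Y = daddv_pi (ls_part g false) (ls_part g true) Y
            + daddv_pi (ls_part g true) (ls_part g false) Y.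
  by rewrite daddv_pi_add ?ls_partI // ls_partD memvf.
move=> hX; rewrite !brDl !linearD /= !brDl.
rewrite (@ls_jacobi _ _ false false _ _ _ hX (memv_pi _ _ _)).
rewrite (@ls_jacobi _ _ false true _ _ _ hX (memv_pi _ _ _)).
by rewrite !expr0 !scale1r addrACA.
Qed.

Lemma jacobi11 X Y Z : X \in ls_part g true -> Y \in ls_part g true ->
  ls_br X (ls_br Y Z) = ls_br (ls_br X Y) Z - ls_br Y (ls_br X Z).
Proof. by move=> hX hY; rewrite (ls_jacobi Z hX hY) /= expr1 scaleN1r. Qed.

Lemma lie_cases (P : g -> Prop) : (forall X Y, P X -> P Y -> P (X + Y)) ->
  (forall z X, X \in ls_part g z -> P X) -> forall X, P X.
Proof.
move=> PD Pz X.
rewrite -(daddv_pi_add (ls_partI g) (w := X)) ?ls_partD ?memvf //.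
by apply: PD; apply: Pz; apply: memv_pi.
Qed.

(** An even supersymmetric invariant form. It is alternating on the odd part, where it serves as the
    commutator form of a Weyl algebra. With the arguments in this order invariance carries no
    sign. *)
Record invariant_form (form : g -> g -> F) : Prop := InvariantForm {
  formDl : forall Y, linear (fun X => form X Y : F^o);
  formDr : forall X, linear (form X : g -> F^o);
  form_parity : forall z X Y, X \in ls_part g z -> Y \in ls_part g (~~ z) ->
    form X Y = 0;
  form_skew : forall z X Y, X \in ls_part g z -> Y \in ls_part g z ->
    form X Y = (-1) ^+ z * form Y X;
  form_inv : forall X Y Z, form (ls_br X Y) Z = form X (ls_br Y Z)
}.

End Brackets.

Section FormTheory.
Variables (F : fieldType) (g : lieSuper F) (form : g -> g -> F).
Hypothesis form_ok : invariant_form form.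
Implicit Types X Y Z : g.

Let form_lr X : {linear g -> F^o} := HB.pack (form X : g -> F^o)
  (GRing.isLinear.Build F g F^o _ _ (formDr form_ok X)).
Let form_ll Y : {linear g -> F^o} := HB.pack (fun X => form X Y : F^o)
  (GRing.isLinear.Build F g F^o _ _ (formDl form_ok Y)).

Lemma form_sumr (I : Type) (r : seq I) (P : pred I) (f : I -> g) X :
  form X (\sum_(i <- r | P i) f i) = \sum_(i <- r | P i) form X (f i).
Proof. exact: (linear_sum (form_lr X)). Qed.

Lemma form_suml (I : Type) (r : seq I) (P : pred I) (f : I -> g) Y :
  form (\sum_(i <- r | P i) f i) Y = \sum_(i <- r | P i) form (f i) Y.
Proof. exact: (linear_sum (form_ll Y)). Qed.

Lemma formZr a X Y : form X (a *: Y) = a * form X Y.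
Proof. by rewrite -[LHS]/(form_lr X (a *: Y)) linearZ. Qed.

Lemma formZl a X Y : form (a *: X) Y = a * form X Y.
Proof. by rewrite -[LHS]/(form_ll Y (a *: X)) linearZ. Qed.

Lemma form_addr X Y Z : form X (Y + Z) = form X Y + form X Z.
Proof. exact: (linearD (form_lr X)). Qed.

Lemma form_addl X Y Z : form (X + Y) Z = form X Z + form Y Z.
Proof. exact: (linearD (form_ll Z)). Qed.

Lemma formNr X Y : form X (- Y) = - form X Y.
Proof. exact: (linearN (form_lr X)). Qed.

Lemma formNl X Y : form (- X) Y = - form X Y.
Proof. exact: (linearN (form_ll Y)). Qed.

Lemma form0r X : form X 0 = 0.
Proof. exact: (linear0 (form_lr X)). Qed.

Lemma form0l Y : form 0 Y = 0.
Proof. exact: (linear0 (form_ll Y)). Qed.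

Lemma form_sym0 X Y : X \in ls_part g false -> Y \in ls_part g false ->
  form X Y = form Y X.
Proof. by move=> hX hY; rewrite (form_skew form_ok hX hY) expr0 mul1r. Qed.

Lemma form_skew1 X Y : X \in ls_part g true -> Y \in ls_part g true ->
  form X Y = - form Y X.
Proof. by move=> hX hY; rewrite (form_skew form_ok hX hY) expr1 mulN1r. Qed.

Lemma form_br0 z X Y Z : X \in ls_part g false -> Y \in ls_part g z ->
  form (ls_br X Y) Z = - form Y (ls_br X Z).
Proof.
by move=> hX hY; rewrite (br_skew0 hX hY) formNl (form_inv form_ok).
Qed.

(* The Bianchi identity, which makes the fully symmetrized quartic vanish. *)
Lemma bianchi X Y Z U : X \in ls_part g true -> Y \in ls_part g true ->
  Z \in ls_part g true ->
  form (ls_br X Y) (ls_br Z U) + form (ls_br Y Z) (ls_br X U)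
    + form (ls_br Z X) (ls_br Y U) = 0.
Proof.
move=> hX hY hZ; rewrite -!(form_inv form_ok) -!form_addl.
have hYZ : ls_br Y Z \in ls_part g false by exact: (ls_br_part hY hZ).
have hZX : ls_br Z X \in ls_part g false by exact: (ls_br_part hZ hX).
have -> : ls_br (ls_br X Y) Z = ls_br X (ls_br Y Z) + ls_br Y (ls_br X Z).
  by rewrite (jacobi11 Z hX hY) subrK.
rewrite (br_skew0 hYZ hX) (br_skew0 hZX hY) (br_sym1 hZ hX).
by rewrite addrAC addrK subrr form0l.
Qed.

End FormTheory.

(** * Quartics in the Weyl algebra and the square of the Dirac operator *)

Section WeylQuartic.
Variables (F : numFieldType) (T : lmodType F) (I : finType).
Variables (c : I -> {linear T -> T}) (J : I -> I -> F).
Hypothesis cC : forall a b u, c a (c b u) = c b (c a u) + J a b *: u.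
(** The model is R_ijkl = ([e_i, e_j], [e_k, e_l]) for odd e_i: the symmetries of a curvature
    tensor, except that each pair of indices is symmetric. *)
Variable R : I -> I -> I -> I -> F.
Hypothesis R12 : forall i j k l, R j i k l = R i j k l.
Hypothesis R_pair : forall i j k l, R k l i j = R i j k l.
Hypothesis R_cyc : forall i j k l, R i j k l + R j k i l + R k i j l = 0.

Let sum4 (f : I -> I -> I -> I -> T) := \sum_a \sum_b \sum_k \sum_l f a b k l.

Let eq_sum4 f1 f2 : (forall a b k l, f1 a b k l = f2 a b k l) ->
  sum4 f1 = sum4 f2.
Proof. by move=> h; do 4!(apply: eq_bigr => ? _). Qed.

Let sw12 f : sum4 f = sum4 (fun a b => f b a).
Proof. exact: exchange_big. Qed.

Let sw23 f : sum4 f = sum4 (fun a b k => f a k b).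
Proof. by apply: eq_bigr => a _; apply: exchange_big. Qed.

Let sw34 f : sum4 f = sum4 (fun a b k l => f a b l k).
Proof. by apply: eq_bigr => a _; apply: eq_bigr => b _; apply: exchange_big. Qed.

Let sum4D f1 f2 : sum4 (fun a b k l => f1 a b k l + f2 a b k l) = sum4 f1 + sum4 f2.
Proof.
rewrite /sum4 -big_split; apply: eq_bigr => a _; rewrite -big_split.
apply: eq_bigr => b _; rewrite -big_split; apply: eq_bigr => k _.
by rewrite -big_split.
Qed.

Let sum4N f : sum4 (fun a b k l => - f a b k l) = - sum4 f.
Proof.
rewrite /sum4 -sumrN; apply: eq_bigr => a _; rewrite -sumrN.
apply: eq_bigr => b _; rewrite -sumrN; apply: eq_bigr => k _.
by rewrite -sumrN.
Qed.

(** Exchanging c_a and c_b twice is the identity. Skewness is stated against a vector u because T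
    may be zero. *)
Lemma weyl_skew a b (u : T) : J a b *: u = - (J b a *: u).
Proof.
apply/eqP; rewrite -addr_eq0; apply/eqP; apply: (addrI (c b (c a u))).
by rewrite addr0 addrA -cC -cC.
Qed.

(* With S the sum below, S2 the sum of the R_ijkl c_i c_k c_j c_l and L the sum
   of the R_ijkl J_jk c_i c_l, reordering gives S = S2 + L, and the cyclic
   identity gives S = - (S2 - L) - S2; hence S = L.  As R_ijkl J_jk is
   antisymmetric in i and l, L is scalar. *)
Lemma weyl_quartic u :
  sum4 (fun i j k l => R i j k l *: c i (c j (c k (c l u)))) =
  (2^-1 * \sum_i \sum_j \sum_k \sum_l R i j k l * J j k * J i l) *: u.
Proof.
set S := LHS.
pose S2 := sum4 (fun i j k l => R i j k l *: c i (c k (c j (c l u)))).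
pose L := sum4 (fun i j k l => (R i j k l * J j k) *: c i (c l u)).
have SE : S = S2 + L.
  rewrite -sum4D; apply: eq_sum4 => i j k l.
  by rewrite (cC j k) linearD scalerDr linearZ /= scalerA.
have S1E : sum4 (fun i j k l => R i j k l *: c k (c i (c j (c l u)))) = S2 - L.
  rewrite -sum4N [X in _ = _ + X]sw12 -sum4D.
  apply: eq_sum4 => i j k l; rewrite R12 (cC k i) scalerDr.
  by congr (_ + _); rewrite -!scalerA weyl_skew scalerN.
pose w i j k l := c i (c j (c k (c l u))).
have S1r : sum4 (fun i j k l => R j k i l *: w i j k l) = S2 - L.
  by rewrite -S1E [RHS]sw23 [RHS]sw12.
have S2r : sum4 (fun i j k l => R k i j l *: w i j k l) = S2.
  by rewrite sw23; apply: eq_sum4 => i j k l; rewrite R12.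
have cyc : S + (S2 - L) + S2 = 0.
  rewrite -S1r -[in X in _ + X = _]S2r -!sum4D; apply: big1 => i _; apply: big1 => j _.
  apply: big1 => k _; apply: big1 => l _.
  by rewrite -!scalerDl R_cyc scale0r.
have SL : S = L.
  have S2E : S2 = S - L by rewrite SE addrK.
  move: cyc; rewrite S2E => cyc.
  have : 3%:R *: (S - L) = 0.
    rewrite -cyc -[3%N]/(1 + 1 + 1)%N !natrD !scalerDl !scale1r.
    by congr (_ + _); rewrite -addrA; congr (_ + _); rewrite addrC.
  by move/eqP; rewrite scaler_eq0 pnatr_eq0 /= subr_eq0 => /eqP.
have LL : L + L = sum4 (fun i j k l => (R i j k l * J j k * J i l) *: u).
  have -> : L + L = L + sum4 (fun i j k l => - ((R i j k l * J j k) *: c l (c i u))).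
    (* These transpositions compose to the reversal of the four indices, which fixes R and turns
       J_jk into J_kj. *)
    congr (_ + _); rewrite [LHS]sw12 [LHS]sw23 [LHS]sw34 [LHS]sw12 [LHS]sw23 [LHS]sw12.
    apply: eq_sum4 => i j k l.
    by rewrite -R_pair R12 -R_pair R12 -R_pair -!scalerA weyl_skew scalerN.
  rewrite -sum4D; apply: eq_sum4 => i j k l.
  by rewrite -scalerBr (cC i l) addrAC subrr add0r scalerA.
have two0 : 2 != 0 :> F by rewrite pnatr_eq0.
rewrite SL -scalerA; apply: (scalerI two0).
rewrite [RHS]scalerA divff // scale1r -[2%:R]/(1 + 1 : F) scalerDl !scale1r LL.
rewrite /sum4 !scaler_suml; apply: eq_bigr => i _; rewrite scaler_suml.
apply: eq_bigr => j _; rewrite scaler_suml; apply: eq_bigr => k _.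
by rewrite scaler_suml.
Qed.
End WeylQuartic.

Lemma lin_sum (F : fieldType) (U V : lmodType F) (f : U -> V) (hf : linear f)
    (I : Type) (r : seq I) (k : I -> F) (w : I -> U) :
  f (\sum_(i <- r) k i *: w i) = \sum_(i <- r) k i *: f (w i).
Proof.
pose f' : {linear U -> V} := HB.pack f (GRing.isLinear.Build F U V _ f hf).
rewrite -[f]/(f' : U -> V) linear_sum; apply: eq_bigr => i _.
by rewrite linearZ.
Qed.

Lemma lin_sum1 (F : fieldType) (U V : lmodType F) (f : U -> V) (hf : linear f)
    (I : Type) (r : seq I) (w : I -> U) :
  f (\sum_(i <- r) w i) = \sum_(i <- r) f (w i).
Proof.
pose f' : {linear U -> V} := HB.pack f (GRing.isLinear.Build F U V _ f hf).
by rewrite -[f]/(f' : U -> V) linear_sum.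
Qed.

Lemma lin_Z (F : fieldType) (U V : lmodType F) (f : U -> V) (hf : linear f) a u :
  f (a *: u) = a *: f u.
Proof.
pose f' : {linear U -> V} := HB.pack f (GRing.isLinear.Build F U V _ f hf).
by rewrite -[f]/(f' : U -> V) linearZ.
Qed.

(** * Dual families and the invariance of the Casimir tensor *)

Section DualFamilies.
Variables (F : numFieldType) (g : lieSuper F) (form : g -> g -> F).
Hypothesis form_ok : invariant_form form.

(** Duality is expressed by the two expansions. A list of pairs, rather than two indexed bases,
    allows the Cartan part and both orders of each root pair to be concatenated. *)
Record even_dual (K : seq (g * g)) : Prop := EvenDual {
  even_dual1 : forall p, p \in K -> p.1 \in ls_part g false;
  even_dual2 : forall p, p \in K -> p.2 \in ls_part g false;
  even_dual_exp2 : forall Y, Y \in ls_part g false ->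
    Y = \sum_(p <- K) form Y p.1 *: p.2;
  even_dual_exp1 : forall Y, Y \in ls_part g false ->
    Y = \sum_(p <- K) form Y p.2 *: p.1
}.

(** The last field expresses a Darboux basis: the Gram matrix of e is up to sign its own inverse, so
    it also produces the dual basis. *)
Record odd_dual (I : finType) (e e' : I -> g) : Prop := OddDual {
  odd_dual1 : forall a, e a \in ls_part g true;
  odd_dual2 : forall a, e' a \in ls_part g true;
  odd_dual_exp1 : forall Y, Y \in ls_part g true ->
    Y = \sum_a form Y (e' a) *: e a;
  odd_dual_exp2 : forall Y, Y \in ls_part g true ->
    Y = \sum_a form (e a) Y *: e' a;
  odd_dualE : forall m, e' m = - \sum_b form (e b) (e m) *: e b
}.

Variables (K : seq (g * g)) (I : finType) (e e' : I -> g).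
Hypotheses (hK : even_dual K) (he : odd_dual e e').

Section Bilinear.
Variables (V : lmodType F) (f : g -> g -> V).
Hypotheses (fl : forall Y, linear (f^~ Y)) (fr : forall X, linear (f X)).

(** Expanding second components in first ones turns both sides into the same double sum of the
    [form p.2 q.2 *: f p.1 q.1]. The arbitrary bilinear f stands for the tensor product. *)
Lemma even_dualC : \sum_(p <- K) f p.1 p.2 = \sum_(p <- K) f p.2 p.1.
Proof.
transitivity (\sum_(p <- K) \sum_(q <- K) form p.2 q.2 *: f p.1 q.1).
  apply: eq_big_seq => p pK; rewrite {1}(even_dual_exp1 hK (even_dual2 hK pK)).
  by rewrite (lin_sum (fr _)).
rewrite exchange_big; apply: eq_big_seq => q qK.
rewrite {2}(even_dual_exp1 hK (even_dual2 hK qK)) (lin_sum (fl _)).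
apply: eq_big_seq => p pK.
by rewrite (form_sym0 form_ok (even_dual2 hK pK) (even_dual2 hK qK)).
Qed.
End Bilinear.

Section Invariance.
Variables (V : lmodType F) (f : g -> g -> V).
Hypotheses (fl : forall Y, linear (f^~ Y)) (fr : forall X, linear (f X)).

Lemma even_dual_inv0 X : X \in ls_part g false ->
  \sum_(p <- K) f (ls_br X p.1) p.2 = - \sum_(p <- K) f p.1 (ls_br X p.2).
Proof.
move=> hX.
have hfl Y : linear (fun Z => f Z (ls_br X Y)) by move=> a u v; apply: fl.
have hfr Y : linear (fun Z => f Y (ls_br X Z)).
  by move=> a u v; rewrite ls_brDr fr.
rewrite [in RHS](even_dualC hfl hfr) -sumrN.
transitivity (\sum_(p <- K) \sum_(q <- K) form (ls_br X p.1) q.1 *: f q.2 p.2).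
  apply: eq_big_seq => p pK.
  have h : ls_br X p.1 \in ls_part g false by exact: (ls_br_part hX (even_dual1 hK pK)).
  by rewrite {1}(even_dual_exp2 hK h) (lin_sum (fl _)).
rewrite exchange_big; apply: eq_big_seq => q qK.
have h : ls_br X q.1 \in ls_part g false by exact: (ls_br_part hX (even_dual1 hK qK)).
rewrite (even_dual_exp2 hK h) (lin_sum (fr _)) -sumrN; apply: eq_big_seq => p pK.
rewrite (form_br0 form_ok _ hX (even_dual1 hK pK)) scaleNr.
by rewrite (form_sym0 form_ok (even_dual1 hK pK) h).
Qed.

Lemma odd_dual_inv0 X : X \in ls_part g false ->
  \sum_a f (ls_br X (e a)) (e' a) = - \sum_a f (e a) (ls_br X (e' a)).
Proof.
move=> hX; rewrite -sumrN.
transitivity (\sum_a \sum_b form (ls_br X (e a)) (e' b) *: f (e b) (e' a)).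
  apply: eq_bigr => a _.
  have h : ls_br X (e a) \in ls_part g true by exact: (ls_br_part hX (odd_dual1 he a)).
  by rewrite {1}(odd_dual_exp1 he h) (lin_sum (fl _)).
rewrite exchange_big; apply: eq_bigr => b _.
have h : ls_br X (e' b) \in ls_part g true by exact: (ls_br_part hX (odd_dual2 he b)).
rewrite (odd_dual_exp2 he h) (lin_sum (fr _)) -sumrN; apply: eq_bigr => a _.
by rewrite (form_br0 form_ok _ hX (odd_dual1 he a)) scaleNr.
Qed.

(** An odd X carries the even half of the Casimir tensor into its odd half, with coefficients
    matched by invariance of the form. Together with [dual_inv1r] this makes the two halves cancel
    in [casimir_comm]. *)
Lemma dual_inv1l X : X \in ls_part g true ->
  \sum_(p <- K) f (ls_br X p.1) p.2 = - \sum_a f (e a) (ls_br X (e' a)).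
Proof.
move=> hX; rewrite -sumrN.
transitivity (\sum_(p <- K) \sum_b form (ls_br X p.1) (e' b) *: f (e b) p.2).
  apply: eq_big_seq => p pK.
  have h : ls_br X p.1 \in ls_part g true by exact: (ls_br_part hX (even_dual1 hK pK)).
  by rewrite {1}(odd_dual_exp1 he h) (lin_sum (fl _)).
rewrite exchange_big; apply: eq_bigr => b _.
have h : ls_br X (e' b) \in ls_part g false by exact: (ls_br_part hX (odd_dual2 he b)).
rewrite (even_dual_exp2 hK h) (lin_sum (fr _)) -sumrN; apply: eq_big_seq => p pK.
have hp := even_dual1 hK pK.
rewrite -scaleNr; congr (_ *: _).
by rewrite (form_sym0 form_ok h hp) -(form_inv form_ok) (br_skew0 hp hX) formNl // opprK.
Qed.

Lemma dual_inv1r X : X \in ls_part g true ->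
  \sum_(p <- K) f p.1 (ls_br X p.2) = \sum_a f (ls_br X (e a)) (e' a).
Proof.
move=> hX.
transitivity (\sum_(p <- K) \sum_b form (e b) (ls_br X p.2) *: f p.1 (e' b)).
  apply: eq_big_seq => p pK.
  have h : ls_br X p.2 \in ls_part g true by exact: (ls_br_part hX (even_dual2 hK pK)).
  by rewrite {1}(odd_dual_exp2 he h) (lin_sum (fr _)).
rewrite exchange_big; apply: eq_bigr => b _.
have h : ls_br X (e b) \in ls_part g false by exact: (ls_br_part hX (odd_dual1 he b)).
rewrite (even_dual_exp1 hK h) (lin_sum (fl _)); apply: eq_big_seq => p pK.
by rewrite -(form_inv form_ok) (br_sym1 hX (odd_dual1 he b)).
Qed.
End Invariance.

End DualFamilies.

(** * The Casimir element of g *)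

Section Casimir.
Variables (F : numFieldType) (g : lieSuper F) (form : g -> g -> F).
Hypothesis form_ok : invariant_form form.
Variables (K : seq (g * g)) (I : finType) (e e' : I -> g).
Hypotheses (hK : even_dual form K) (he : odd_dual form e e').
Variable M : srep g.
Local Notation A := (@sr_act F g M).

HB.instance Definition _ X := GRing.isLinear.Build F M M _ (A X) (@sr_actDr F g M X).

Lemma actNl X v : A (- X) v = - A X v.
Proof.
have h := sr_actDl v.
have A0 : A 0 v = 0 by have := h 1 0 0; rewrite !scale1r !addr0 => /esym/eqP;
  rewrite -subr_eq0 addrK => /eqP.
by have := h (-1) X 0; rewrite !addr0 !scaleN1r A0 addr0.
Qed.

Lemma act_br0 X Y v : X \in ls_part g false ->
  A X (A Y v) = A (ls_br X Y) v + A Y (A X v).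
Proof.
move=> hX; elim/(@lie_cases _ g): Y => [Y Z hY hZ|z Y hY].
  have D U V w : A (U + V) w = A U w + A V w.
    by have := sr_actDl w 1 U V; rewrite !scale1r.
  by rewrite D linearD /= D hY hZ linearD /= D addrACA.
by rewrite (sr_act_br v hX hY) /= expr0 scale1r subrK.
Qed.

Lemma act_br1 X Y v : X \in ls_part g true -> Y \in ls_part g true ->
  A X (A Y v) = A (ls_br X Y) v - A Y (A X v).
Proof. by move=> hX hY; rewrite (sr_act_br v hX hY) /= expr1 scaleN1r opprK addrK. Qed.

Lemma act_br10 X Y v : X \in ls_part g true -> Y \in ls_part g false ->
  A X (A Y v) = A (ls_br X Y) v + A Y (A X v).
Proof. by move=> hX hY; rewrite (sr_act_br v hX hY) /= expr0 scale1r subrK. Qed.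

Lemma actDl X Y v : A (X + Y) v = A X v + A Y v.
Proof. by have := sr_actDl v 1 X Y; rewrite !scale1r. Qed.

(** The minus sign is what lets the sum of the even and odd halves commute with odd elements. *)
Definition casimir_odd (v : M) := - \sum_a A (e a) (A (e' a) v).
Definition casimir (v : M) := \sum_(p <- K) A p.1 (A p.2 v) + casimir_odd v.

Lemma casimir_is_linear : linear casimir.
Proof.
move=> a u v; rewrite /casimir /casimir_odd scalerDr scalerN !scaler_sumr.
rewrite addrACA -opprD -!big_split /=.
by congr (_ - _); apply: eq_bigr => i _; rewrite !linearP.
Qed.

(** Invariance of the Casimir tensor. It spreads the eigenvalue found on a highest weight vector
    over the module that this vector generates. *)
Lemma casimir_comm X v : A X (casimir v) = casimir (A X v).
Proof.
pose f w Y Z := A Y (A Z w).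
have fl w Y : linear (f w ^~ Y) by move=> a U V; apply: sr_actDl.
have fr w Y : linear (f w Y) by move=> a U V; rewrite /f sr_actDl linearP.
elim/(@lie_cases _ g): X => [Y Z hY hZ|[] X hX].
- rewrite !actDl hY hZ -[casimir (A Y v)]scale1r -casimir_is_linear.
  by rewrite scale1r.
- rewrite /casimir /casimir_odd linearD linearN /= !linear_sum /= !sumrN.
  have -> : \sum_(p <- K) A X (A p.1 (A p.2 v)) =
      \sum_(p <- K) f v (ls_br X p.1) p.2 + \sum_(p <- K) f v p.1 (ls_br X p.2)
      + \sum_(p <- K) A p.1 (A p.2 (A X v)).
    rewrite -!big_split; apply: eq_big_seq => p pK /=.
    rewrite (act_br10 _ hX (even_dual1 hK pK)) -addrA; congr (_ + _).
    by rewrite (act_br10 _ hX (even_dual2 hK pK)) linearD.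
  have -> : \sum_a A X (A (e a) (A (e' a) v)) =
      \sum_a f v (ls_br X (e a)) (e' a) - \sum_a f v (e a) (ls_br X (e' a))
      + \sum_a A (e a) (A (e' a) (A X v)).
    rewrite -sumrB -!big_split; apply: eq_bigr => a _ /=.
    rewrite (act_br1 _ hX (odd_dual1 he a)) -addrA; congr (_ + _).
    by rewrite (act_br1 _ hX (odd_dual2 he a)) linearB opprB addrC.
  rewrite (dual_inv1l form_ok hK he (fl v) (fr v) hX).
  rewrite (dual_inv1r form_ok hK he (fl v) (fr v) hX).
  set S1 := \sum_a f v (ls_br _ _) _; set S2 := \sum_a f v _ (ls_br _ _).
  by rewrite [- S2 + S1]addrC opprD addrACA subrr add0r.
- rewrite /casimir /casimir_odd linearD linearN /= !linear_sum /= !sumrN.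
  have -> : \sum_(p <- K) A X (A p.1 (A p.2 v)) =
      \sum_(p <- K) f v (ls_br X p.1) p.2 + \sum_(p <- K) f v p.1 (ls_br X p.2)
      + \sum_(p <- K) A p.1 (A p.2 (A X v)).
    rewrite -!big_split; apply: eq_big_seq => p pK /=.
    rewrite (act_br0 _ _ hX) -addrA; congr (_ + _).
    by rewrite (act_br0 _ _ hX) linearD.
  have -> : \sum_a A X (A (e a) (A (e' a) v)) =
      \sum_a f v (ls_br X (e a)) (e' a) + \sum_a f v (e a) (ls_br X (e' a))
      + \sum_a A (e a) (A (e' a) (A X v)).
    rewrite -!big_split; apply: eq_bigr => a _ /=.
    rewrite (act_br0 _ _ hX) -addrA; congr (_ + _).
    by rewrite (act_br0 _ _ hX) linearD.
  rewrite (even_dual_inv0 form_ok hK (fl v) (fr v) hX).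
  rewrite (odd_dual_inv0 form_ok he (fl v) (fr v) hX).
  by rewrite !addNr !add0r.
Qed.
End Casimir.

(** * The even part inside the Weyl algebra *)

Section Dirac.
Variables (F : numFieldType) (g : lieSuper F) (form : g -> g -> F).
Hypothesis form_ok : invariant_form form.
Variables (K : seq (g * g)) (I : finType) (e e' : I -> g).
Hypotheses (hK : even_dual form K) (he : odd_dual form e e').
Variables (T : lmodType F) (c : I -> {linear T -> T}).
Hypothesis cC : forall a b u, c a (c b u) = c b (c a u) + form (e a) (e b) *: u.

(** The symmetric form of [alpha]: all pairs of odd basis vectors occur in both orders, and the
    normal ordering in [osc_actE] produces the constant term of [alpha]. *)
Definition osc (X : g) (u : T) : T :=
  2^-1 *: \sum_a \sum_b form X (ls_br (e a) (e b)) *: c a (c b u).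

Let br11 X Y : X \in ls_part g true -> Y \in ls_part g true ->
  ls_br X Y \in ls_part g false.
Proof. exact: ls_br_part. Qed.

Lemma osc_is_linear X : linear (osc X).
Proof.
move=> a u v; rewrite /osc scalerA [a * _]mulrC -scalerA -scalerDr; congr (_ *: _).
rewrite scaler_sumr -big_split; apply: eq_bigr => i _ /=.
rewrite scaler_sumr -big_split; apply: eq_bigr => j _ /=.
by rewrite !linearP.
Qed.

Lemma osc_is_linear_l u : linear (osc^~ u).
Proof.
move=> a X Y; rewrite /osc scalerA [a * _]mulrC -scalerA -scalerDr; congr (_ *: _).
rewrite scaler_sumr -big_split; apply: eq_bigr => i _ /=.
rewrite scaler_sumr -big_split; apply: eq_bigr => j _ /=.
by rewrite (formDl form_ok) scalerDl scalerA.
Qed.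

(** Commuting with c_m contracts either of the two generators in [osc]. The two contributions agree,
    as the bracket of odd elements is symmetric, and this cancels the factor 1/2. For even X the
    identity says that the generators transform like odd vectors. *)
Lemma osc_comm X m u :
  osc X (c m u) = c m (osc X u) - \sum_a form X (ls_br (e a) (e' m)) *: c a u.
Proof.
have cc a b : c a (c b (c m u)) = c m (c a (c b u))
    + (form (e b) (e m) *: c a u + form (e a) (e m) *: c b u).
  by rewrite [c b (c m u)]cC linearD linearZ /= [c a (c m _)]cC -addrA [X in _ + X = _]addrC.
have two0 : 2 != 0 :> F by rewrite pnatr_eq0.
rewrite /osc linearZ; apply: (scalerI two0).
rewrite scalerDr !scalerA divff // !scale1r.
rewrite linear_sum.
transitivity (\sum_a c m (\sum_b form X (ls_br (e a) (e b)) *: c a (c b u))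
  + (\sum_a \sum_b (form X (ls_br (e a) (e b)) * form (e b) (e m)) *: c a u
  + \sum_a \sum_b (form X (ls_br (e a) (e b)) * form (e a) (e m)) *: c b u)).
  rewrite -!big_split; apply: eq_bigr => a _ /=.
  rewrite linear_sum -!big_split; apply: eq_bigr => b _ /=.
  by rewrite cc scalerDr linearZ scalerDr !scalerA.
congr (_ + _).
have E1 : \sum_a \sum_b (form X (ls_br (e a) (e b)) * form (e b) (e m)) *: c a u =
    - \sum_a form X (ls_br (e a) (e' m)) *: c a u.
  rewrite -sumrN; apply: eq_bigr => a _; rewrite -scaler_suml -scaleNr; congr (_ *: _).
  rewrite (odd_dualE he) brNr formNr // opprK br_sumr form_sumr //.
  by apply: eq_bigr => b _; rewrite brZr formZr // mulrC.
rewrite [X in _ + X]exchange_big.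
under [X in _ + X]eq_bigr do under eq_bigr do
  rewrite (br_sym1 (odd_dual1 he _) (odd_dual1 he _)).
by rewrite E1 -[2%:R]/(1 + 1 : F) scalerDl scale1r.
Qed.

(** The commutator with [osc X] is a derivation, so [osc_comm] applies to each of the two generators
    in [osc Y]. *)
Lemma osc_br X Y u : X \in ls_part g false -> Y \in ls_part g false ->
  osc (ls_br X Y) u = osc X (osc Y u) - osc Y (osc X u).
Proof.
move=> hX hY.
have oN a b : osc X (a *: b) = a *: osc X b by apply: lin_Z; apply: osc_is_linear.
have oS (J : finType) (f : J -> T) : osc X (\sum_i f i) = \sum_i osc X (f i).
  by apply: lin_sum1; apply: osc_is_linear.
pose s (f : I -> I -> F) := \sum_a \sum_b f a b *: c a (c b u).
have E : osc X (osc Y u) = osc Y (osc X u) - 2^-1 *: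
    (\sum_m \sum_n form Y (ls_br (e m) (e n)) *:
      (c m (\sum_a form X (ls_br (e a) (e' n)) *: c a u)
       + \sum_a form X (ls_br (e a) (e' m)) *: c a (c n u))).
  rewrite {2}/osc oN {3}/osc -scalerBr; congr (_ *: _).
  rewrite oS -sumrB; apply: eq_bigr => m _; rewrite oS -sumrB; apply: eq_bigr => n _.
  rewrite oN -scalerBr; congr (_ *: _).
  by rewrite osc_comm osc_comm linearB /= opprD addrA.
rewrite E addrAC subrr add0r -scalerN /osc; congr (_ *: _).
have brE a : ls_br X (e a) = \sum_m form X (ls_br (e a) (e' m)) *: e m.
  have h : ls_br X (e a) \in ls_part g true by exact: (ls_br_part hX (odd_dual1 he a)).
  rewrite {1}(odd_dual_exp1 he h); apply: eq_bigr => m _.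
  by rewrite (form_inv form_ok).
(* The Jacobi identity distributes ad X over the two factors of [e_a, e_b], one for each generator
   hit by the derivation. *)
transitivity (- (s (fun a b => form Y (ls_br (e a) (ls_br X (e b))))
   + s (fun a b => form Y (ls_br (ls_br X (e a)) (e b))))).
  rewrite /s -big_split -sumrN; apply: eq_bigr => a _ /=.
  rewrite -big_split -sumrN; apply: eq_bigr => b _ /=.
  rewrite -scalerDl -scaleNr; congr (_ *: _).
  rewrite -form_addr // addrC -jacobi0 // -(form_inv form_ok Y) (br_skew0 hY hX).
  by rewrite formNl // opprK.
congr (- _).
under [RHS]eq_bigr do under eq_bigr do rewrite scalerDr.
under [RHS]eq_bigr do rewrite big_split.
rewrite big_split /=; congr (_ + _).
  rewrite /s; apply: eq_bigr => m _.
  under [RHS]eq_bigr do rewrite linear_sum scaler_sumr.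
  rewrite [RHS]exchange_big; apply: eq_bigr => a _ /=.
  rewrite brE br_sumr form_sumr // scaler_suml; apply: eq_bigr => n _.
  by rewrite brZr formZr // [c m (_ *: _)]linearZ /= scalerA mulrC.
rewrite [LHS]exchange_big [RHS]exchange_big; apply: eq_bigr => n _ /=.
under [RHS]eq_bigr do rewrite scaler_sumr.
rewrite [RHS]exchange_big; apply: eq_bigr => a _ /=.
rewrite brE br_suml form_sumr // scaler_suml; apply: eq_bigr => m _.

by rewrite brZl formZr // scalerA mulrC.
Qed.

End Dirac.

(** * The square of the Dirac operator *)

Section DiracSquare.
Variables (F : numFieldType) (g : lieSuper F) (form : g -> g -> F).
Hypothesis form_ok : invariant_form form.
Variables (K : seq (g * g)) (I : finType) (e e' : I -> g).
Hypotheses (hK : even_dual form K) (he : odd_dual form e e').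
Variables (T : lmodType F) (c : I -> {linear T -> T}).
Hypothesis cC : forall a b u, c a (c b u) = c b (c a u) + form (e a) (e b) *: u.
Local Notation al := (osc form e c).

Let br11 a b : ls_br (e a) (e b) \in ls_part g false.
Proof. exact: (ls_br_part (odd_dual1 he a) (odd_dual1 he b)). Qed.

Definition quartic_tensor i j k l := form (ls_br (e i) (e j)) (ls_br (e k) (e l)).

(** The factor 4^-1 collects the halves of two copies of [osc], and 2^-1 is the one of
    [weyl_quartic]. The value is found in [osc_constE] without evaluating this sum. *)
Definition osc_const : F := 4^-1 * (2^-1 * \sum_i \sum_j \sum_k \sum_l
  quartic_tensor i j k l * form (e j) (e k) * form (e i) (e l)).

(** Summation over the dual pairs fuses the coefficients of two copies of [osc] into
    [quartic_tensor], whose cyclic identity is [bianchi]. *)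
Lemma osc_casimir u : \sum_(p <- K) al p.1 (al p.2 u) = osc_const *: u.
Proof.
rewrite /osc_const -scalerA -(weyl_quartic cC); first last.
- by move=> i j k l; apply: bianchi => //; apply: odd_dual1 he _.
- by move=> i j k l; apply: form_sym0.
- by move=> i j k l; rewrite /quartic_tensor (br_sym1 (odd_dual1 he j) (odd_dual1 he i)).
pose f X Y i j k l := form X (ls_br (e i) (e j)) * form Y (ls_br (e k) (e l)).
transitivity (4^-1 *: \sum_(p <- K) \sum_i \sum_j \sum_k \sum_l
    f p.1 p.2 i j k l *: c i (c j (c k (c l u)))).
  rewrite scaler_sumr; apply: eq_bigr => p _; rewrite /osc.
  have -> : (4^-1 : F) = 2^-1 * 2^-1 by rewrite -invfM -natrM.
  rewrite -scalerA; congr (_ *: _); rewrite [RHS]scaler_sumr; apply: eq_bigr => i _.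
  rewrite [RHS]scaler_sumr; apply: eq_bigr => j _.
  rewrite [c j _]linearZ [c i _]linearZ /= scalerA mulrC -scalerA; congr (_ *: _).
  rewrite !linear_sum; apply: eq_bigr => k _ /=.
  rewrite !linear_sum; apply: eq_bigr => l _ /=.
  by rewrite [c j _]linearZ [c i _]linearZ /= scalerA.
congr (_ *: _).
rewrite exchange_big; apply: eq_bigr => i _ /=.
rewrite exchange_big; apply: eq_bigr => j _ /=.
rewrite exchange_big; apply: eq_bigr => k _ /=.
rewrite exchange_big; apply: eq_bigr => l _ /=.
rewrite -scaler_suml; congr (_ *: _).
rewrite /quartic_tensor (even_dual_exp2 hK (br11 i j)) form_suml //.
apply: eq_big_seq => p pK; rewrite formZl // /f; congr (_ * _).
by rewrite (form_sym0 form_ok _ (br11 i j)) // (even_dual1 hK).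
Qed.

Variable A : g -> {linear T -> T}.
Hypothesis A_lin : forall u, linear (fun X => A X u).
Hypothesis A_br1 : forall X Y u, X \in ls_part g true -> Y \in ls_part g true ->
  A X (A Y u) = A (ls_br X Y) u - A Y (A X u).
Hypothesis A_c : forall X a u, A X (c a u) = c a (A X u).

Definition dirac u := \sum_a A (e a) (c a u).

Lemma A_osc X Y u : A X (al Y u) = al Y (A X u).
Proof.
rewrite /osc linearZ linear_sum; congr (_ *: _); apply: eq_bigr => i _ /=.
rewrite linear_sum; apply: eq_bigr => j _ /=.
by rewrite linearZ /= !A_c.
Qed.

(** Adding the terms of index (a, b) and (b, a) leaves two things: [e_a, e_b] times c_a c_b, which
    is the cross term of the diagonal Casimir element, and a contraction of c_a with c_b, which is
    the odd half of the Casimir element of g. *)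
Lemma dirac_square u :
  2 *: dirac (dirac u) =
    \sum_(p <- K) (A p.1 (A p.2 u + al p.2 u) + al p.1 (A p.2 u + al p.2 u))
    - (\sum_(p <- K) A p.1 (A p.2 u) - \sum_a A (e a) (A (e' a) u))
    - osc_const *: u.
Proof.
have cross : 2 *: \sum_(p <- K) A p.1 (al p.2 u) =
    \sum_a \sum_b A (ls_br (e a) (e b)) (c a (c b u)).
  rewrite scaler_sumr; transitivity (\sum_(p <- K) \sum_a \sum_b
      form (ls_br (e a) (e b)) p.2 *: A p.1 (c a (c b u))).
    apply: eq_big_seq => p pK; rewrite /osc linearZ /= scalerA divff ?pnatr_eq0 //.
    rewrite scale1r linear_sum; apply: eq_bigr => a _ /=.
    rewrite linear_sum; apply: eq_bigr => b _ /=; rewrite linearZ /=.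
    by rewrite (form_sym0 form_ok _ (br11 a b)) // (even_dual2 hK).
  rewrite exchange_big; apply: eq_bigr => a _ /=.
  rewrite exchange_big; apply: eq_bigr => b _ /=.
  by rewrite {2}(even_dual_exp1 hK (br11 a b)) (lin_sum (A_lin _)).
have Across : \sum_(p <- K) A p.1 (al p.2 u) = \sum_(p <- K) al p.1 (A p.2 u).
  under [RHS]eq_bigr do rewrite -A_osc.
  apply: (even_dualC form_ok hK (f := fun X Y => A X (al Y u))).
    by move=> Y; apply: A_lin.
  by move=> X a Y Z; rewrite (osc_is_linear_l form_ok) linearP.
have -> : \sum_(p <- K) (A p.1 (A p.2 u + al p.2 u) + al p.1 (A p.2 u + al p.2 u)) =
   \sum_(p <- K) A p.1 (A p.2 u) + 2 *: (\sum_(p <- K) A p.1 (al p.2 u)) + osc_const *: u.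
  rewrite -osc_casimir -[2%:R]/(1 + 1 : F) scalerDl scale1r {2}Across.
  rewrite addrA -!big_split; apply: eq_bigr => p _ /=.
  have oD X v w : al X (v + w) = al X v + al X w.
    by have := osc_is_linear form e c X 1 v w; rewrite !scale1r.
  by rewrite linearD oD !addrA.
rewrite addrAC addrK opprB [_ - \sum_(p <- K) _]addrC addrACA subrr add0r cross.
pose t a b := A (e a) (A (e b) (c a (c b u))).
have -> : dirac (dirac u) = \sum_a \sum_b t a b.
  by apply: eq_bigr => a _; rewrite !linear_sum; apply: eq_bigr => b _ /=; rewrite -A_c.
rewrite -[2%:R]/(1 + 1 : F) scalerDl scale1r {2}exchange_big -big_split /=.
have -> : \sum_a A (e a) (A (e' a) u) =
    \sum_a \sum_b - (form (e a) (e b) *: A (e b) (A (e a) u)).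
  rewrite exchange_big; apply: eq_bigr => a _ /=.
  have -> : e' a = \sum_b (- form (e b) (e a)) *: e b.
    by rewrite (odd_dualE he) -sumrN; apply: eq_bigr => b _; rewrite scaleNr.
  rewrite (lin_sum (A_lin u)) linear_sum; apply: eq_bigr => b _ /=.
  by rewrite linearZ /= scaleNr.
rewrite -big_split; apply: eq_bigr => a _ /=.
rewrite -!big_split; apply: eq_bigr => b _ /=.
rewrite /t (A_br1 _ (odd_dual1 he a) (odd_dual1 he b)) -addrA; congr (_ + _).
have -> : c b (c a u) = c a (c b u) - form (e a) (e b) *: u by rewrite (cC a b) addrK.
by rewrite !linearB !linearZ /= addrA addNr add0r.
Qed.
End DiracSquare.

(** * Polynomials with coefficients in a module *)

Section TensorPolynomials.
Variables (F : fieldType) (M : lmodType F) (N : nat).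
Local Notation T := (tpoly M N).
Local Notation P := (mpoly.mpoly N F).
Implicit Types (u v : T) (m : M) (p : P) (k l : 'X_{1..N}) (q : P -> P).

Lemma tp_coef_is_linear k : linear (fun u : T => tp_coef u k).
Proof. by move=> a u v; rewrite tp_coefD tp_scaleE. Qed.

Lemma tp_coef_pure m p l : tp_coef (tp_pure m p) l = mcoeff l p *: m.
Proof.
rewrite tp_coef_sum; have [lp|lp] := boolP (l \in msupp p).
  rewrite (bigD1_seq l) ?msupp_uniq //= tp_coef_mono eqxx mulr1n big1 ?addr0 // => k.
  by rewrite tp_coef_mono => /negbTE->.
rewrite big_seq big1 => [|k kp]; first by rewrite memN_msupp_eq0 // scale0r.
by rewrite tp_coef_mono; case: eqP kp lp => [->->|].
Qed.

Lemma tp_notin_supp u k : k \notin monalg.msupp u -> tp_coef u k = 0.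
Proof. by rewrite unlock; apply: monalg.mcoeff_outdom. Qed.

Lemma tp_map_coef (f : M -> M) q u l : tp_coef (tp_map f q u) l =
  \sum_(k <- monalg.msupp u) mcoeff l (q 'X_[k]) *: f (tp_coef u k).
Proof. by rewrite tp_coef_sum; under eq_bigr do rewrite tp_coef_pure. Qed.

(** Sums over the supports of different elements become comparable on a common finite set. *)
Lemma supp_sum_widen (V : lmodType F) (G : 'X_{1..N} -> M -> V) u (S : {fset 'X_{1..N}}) :
  (forall k, G k 0 = 0) -> (monalg.msupp u `<=` S)%fset ->
  \sum_(k <- monalg.msupp u) G k (tp_coef u k) = \sum_(k <- S) G k (tp_coef u k).
Proof.
move=> G0 uS; apply: big_fset_incl => // k _ /tp_notin_supp ->; exact: G0.
Qed.

Lemma supp_sum_linear (V : lmodType F) (G : 'X_{1..N} -> M -> V) :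
  (forall k, linear (G k)) ->
  linear (fun u : T => \sum_(k <- monalg.msupp u) G k (tp_coef u k)).
Proof.
move=> Gl a u v.
have G0 k : G k 0 = 0 by have := lin_sum (Gl k) [::] (fun=> 0) (fun i : nat => 0); rewrite !big_nil.
set S := (monalg.msupp u `|` monalg.msupp v `|` monalg.msupp (a *: u + v))%fset.
have [uS vS aS] : [/\ monalg.msupp u `<=` S, monalg.msupp v `<=` S
    & monalg.msupp (a *: u + v) `<=` S]%fset.
  by split; apply/fsubsetP => k kk; rewrite !in_fsetU kk ?orbT.
rewrite !(@supp_sum_widen _ _ _ S) //.
rewrite scaler_sumr -big_split; apply: eq_bigr => k _ /=.
by rewrite (tp_coef_is_linear k) Gl.
Qed.

Lemma tp_map_is_linear (f : M -> M) q : linear f -> linear (tp_map f q : T -> T).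
Proof.
move=> fl a u v; apply: tp_ext => l; rewrite tp_coefD tp_scaleE !tp_map_coef.
apply: (supp_sum_linear (G := fun k m => mcoeff l (q 'X_[k]) *: f m)) => k b x y.
by rewrite fl scalerDr !scalerA mulrC.
Qed.

Lemma tp_map_id (f : M -> M) u l : f 0 = 0 -> tp_coef (tp_map f id u) l = f (tp_coef u l).
Proof.
move=> f0; rewrite tp_map_coef; have [lu|lu] := boolP (l \in monalg.msupp u).
  rewrite (bigD1_seq l) ?fset_uniq //= mcoeffX eqxx scale1r big1 ?addr0 // => k.
  by rewrite mcoeffX => /negbTE ->; rewrite scale0r.
rewrite tp_notin_supp // f0 big_seq big1 // => k ku.
by rewrite mcoeffX; case: eqP ku lu => [->->|]; rewrite // scale0r.
Qed.

Lemma tp_map_mono (f : M -> M) q m k : f 0 = 0 ->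
  tp_map f q (tp_mono m k : T) = tp_pure (f m) (q 'X_[k]).
Proof.
move=> f0; apply: tp_ext => l; rewrite tp_map_coef tp_coef_pure.
rewrite (@supp_sum_widen _ (fun k m => mcoeff l (q 'X_[k]) *: f m) _
  (k |` monalg.msupp (tp_mono m k))%fset); last by apply: fsubsetU1.
  rewrite (bigD1_seq k) ?fset_uniq ?fset1U1 //= tp_coef_mono eqxx mulr1n.
  rewrite big1 ?addr0 // => k' nk; rewrite tp_coef_mono eq_sym (negbTE nk) mulr0n f0.
  by rewrite scaler0.
by move=> k'; rewrite f0 scaler0.
Qed.

Lemma tp_monoP (T' : lmodType F) (f1 f2 : T -> T') : linear f1 -> linear f2 ->
  (forall m k, f1 (tp_mono m k) = f2 (tp_mono m k)) -> forall u, f1 u = f2 u.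
Proof.
move=> l1 l2 h u; rewrite (tp_expand u).
by rewrite (lin_sum1 l1) (lin_sum1 l2); apply: eq_bigr => k _.
Qed.

Lemma tp_pure_is_linear m : linear (fun p => tp_pure m p : T).
Proof.
move=> a p1 p2; apply: tp_ext => k; rewrite tp_coefD tp_scaleE !tp_coef_pure.
by rewrite mcoeffD mcoeffZ scalerDl scalerA.
Qed.

Lemma tp_pureX m k : tp_pure m 'X_[k] = tp_mono m k :> T.
Proof.
by apply: tp_ext => l; rewrite tp_coef_pure tp_coef_mono mcoeffX scaler_nat.
Qed.

(** Only the values of q on monomials enter, so this map is linear for every function q. Linearity
    of q is what [tp_lift_pure] needs to let q act on all polynomials. *)
Definition tp_lift q : T -> T := tp_map id q.

Lemma tp_lift_is_linear q : linear (tp_lift q).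
Proof. exact: tp_map_is_linear. Qed.

HB.instance Definition _ q := GRing.isLinear.Build F T T _ (tp_lift q)
  (tp_lift_is_linear q).

Lemma tp_lift_pure (q : {linear P -> P}) m p : tp_lift q (tp_pure m p) = tp_pure m (q p).
Proof.
have hl := tp_pure_is_linear m.
have qE : q p = \sum_(k <- msupp p) mcoeff k p *: q 'X_[k].
  by rewrite {1}[p]mpolyE linear_sum; apply: eq_bigr => k _; rewrite linearZ.
rewrite qE {1}[p]mpolyE (lin_sum hl) (lin_sum hl) linear_sum.
by apply: eq_bigr => k _; rewrite linearZ /= tp_pureX /tp_lift tp_map_mono.
Qed.

Lemma tp_lift_comp (q1 q2 : {linear P -> P}) u :
  tp_lift q1 (tp_lift q2 u) = tp_lift (q1 \o q2) u.
Proof.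
pose f := [the {linear T -> T} of tp_lift q1 \o tp_lift q2].
apply: (tp_monoP (linearP f) (linearP (tp_lift (q1 \o q2)))) => m k.
by rewrite /f /= {2}/tp_lift tp_map_mono // tp_lift_pure /tp_lift tp_map_mono.
Qed.

Lemma tp_lift_lin a q1 q2 u :
  tp_lift (fun p => a *: q1 p + q2 p) u = a *: tp_lift q1 u + tp_lift q2 u.
Proof.
apply: tp_ext => l; rewrite tp_coefD tp_scaleE !tp_map_coef scaler_sumr -big_split.
by apply: eq_bigr => k _ /=; rewrite mcoeffD mcoeffZ scalerDl scalerA.
Qed.

Lemma tp_lift_eq q1 q2 u : (forall p, q1 p = q2 p) -> tp_lift q1 u = tp_lift q2 u.
Proof. by move=> h; apply: eq_bigr => k _; rewrite h. Qed.

Lemma tp_lift0 u : tp_lift (fun=> 0) u = 0.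
Proof. by apply: tp_ext => l; rewrite tp_map_coef tp_coef0 big1 // => k _; rewrite mcoeff0 scale0r. Qed.

Lemma tp_lift_id u : tp_lift id u = u.
Proof. by apply: tp_ext => l; rewrite tp_map_id. Qed.

Lemma tp_liftD q1 q2 u : tp_lift (fun p => q1 p + q2 p) u = tp_lift q1 u + tp_lift q2 u.
Proof.
by rewrite -[tp_lift q1 u]scale1r -tp_lift_lin; apply: tp_lift_eq => p; rewrite scale1r.
Qed.

Lemma tp_liftZ a q u : tp_lift (fun p => a *: q p) u = a *: tp_lift q u.
Proof.
rewrite -[RHS]addr0 -(tp_lift0 u) -tp_lift_lin; apply: tp_lift_eq => p.
by rewrite addr0.
Qed.

Lemma tp_lift_sum (I : finType) (q : I -> P -> P) u :
  tp_lift (fun p => \sum_i q i p) u = \sum_i tp_lift (q i) u.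
Proof.
elim: (index_enum I) => [|i r IH].
  by rewrite big_nil -[RHS](tp_lift0 u); apply: tp_lift_eq => p; rewrite big_nil.
by rewrite big_cons -IH -tp_liftD; apply: tp_lift_eq => p; rewrite big_cons.
Qed.

Definition tp_mul i : T -> T := tp_lift (fun p => 'X_i * p).
Definition tp_der i : T -> T := tp_lift (mderiv i).

HB.instance Definition _ i := GRing.Linear.copy (tp_mul i) (tp_lift (fun p => 'X_i * p)).
HB.instance Definition _ i := GRing.Linear.copy (tp_der i) (tp_lift (mderiv i)).

End TensorPolynomials.

Section WeylOperators.
Variables (F : numFieldType) (M : lmodType F) (N : nat).
Local Notation T := (tpoly M N).
Local Notation I := (bool * 'I_N)%type.
Implicit Types (u v : T) (i j : 'I_N).

Lemma big_boolI (V : nmodType) (f : I -> V) :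
  \sum_a f a = \sum_i f (false, i) + \sum_i f (true, i).
Proof.
rewrite (eq_bigr (fun a => f (a.1, a.2))) => [|[] //].
by rewrite -(pair_bigA _ (fun b i => f (b, i))) big_bool addrC.
Qed.

Lemma tp_mulA i j u : tp_mul i (tp_mul j u) = tp_lift (fun p => 'X_i * 'X_j * p) u.
Proof.
rewrite /tp_mul (tp_lift_comp ('X_i \*o idfun) ('X_j \*o idfun)).
by apply: tp_lift_eq => p /=; rewrite mulrA.
Qed.

Lemma tp_mul_der i j u : tp_mul i (tp_der j u) = tp_lift (fun p => 'X_i * mderiv j p) u.
Proof. exact: (tp_lift_comp ('X_i \*o idfun) (mderiv j)). Qed.

Lemma tp_der_mul i j u :
  tp_der i (tp_mul j u) = tp_mul j (tp_der i u) + (i == j)%:R *: u.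
Proof.
rewrite tp_mul_der /tp_der /tp_mul (tp_lift_comp (mderiv i) ('X_j \*o idfun)).
rewrite -{3}[u]tp_lift_id -tp_liftZ -tp_liftD; apply: tp_lift_eq => p /=.
rewrite mderivM mderivX addrC mnm1E eq_sym; congr (_ + _).
case: eqP => [->|_]; last by rewrite !scale0r mul0r.
by rewrite -{1}[U_(j)%MM]add0m addmK mpolyX0 -scalerAl mul1r.
Qed.

Lemma tp_derA i j u : tp_der i (tp_der j u) = tp_lift (fun p => mderiv i (mderiv j p)) u.
Proof. exact: (tp_lift_comp (mderiv i) (mderiv j)). Qed.

Lemma tp_mulC i j u : tp_mul i (tp_mul j u) = tp_mul j (tp_mul i u).
Proof. by rewrite !tp_mulA; apply: tp_lift_eq => p; rewrite ['X_i * _]mulrC. Qed.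

Lemma tp_derC i j u : tp_der i (tp_der j u) = tp_der j (tp_der i u).
Proof. by rewrite !tp_derA; apply: tp_lift_eq => p; rewrite mderiv_comm. Qed.

(** The operator of the dual vector [odd_cobasis a], when d_i stands for d/dx_i and x_i for
    multiplication; hence the sign in the first case. *)
Definition weyl_op (a : I) (u : T) : T :=
  if a.1 then - tp_der a.2 u else tp_mul a.2 u.

Lemma weyl_op_is_linear a : linear (weyl_op a).
Proof.
move=> k u v; rewrite /weyl_op; case: a.1; last by rewrite linearP.
by rewrite linearP opprD scalerN.
Qed.

HB.instance Definition _ a := GRing.isLinear.Build F T T _ (weyl_op a)
  (weyl_op_is_linear a).

End WeylOperators.

(** * The action [alpha] in symmetric form *)

Section OscillatorAction.
Variables (F : numFieldType) (g : lieSuper F) (form : g -> g -> F).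
Hypothesis form_ok : invariant_form form.
Variables (N : nat) (d x : N.-tuple g).
Local Notation I := (bool * 'I_N)%type.
Hypothesis d_odd : forall i, tnth d i \in ls_part g true.
Hypothesis x_odd : forall i, tnth x i \in ls_part g true.
Hypothesis dd0 : forall i j, form (tnth d i) (tnth d j) = 0.
Hypothesis xx0 : forall i j, form (tnth x i) (tnth x j) = 0.
Hypothesis dx1 : forall i j, form (tnth d i) (tnth x j) = (i == j)%:R.

Definition odd_basis (a : I) : g := if a.1 then tnth x a.2 else tnth d a.2.
Definition odd_cobasis (a : I) : g := if a.1 then - tnth d a.2 else tnth x a.2.

Let xd1 i j : form (tnth x i) (tnth d j) = - (i == j)%:R.
Proof. by rewrite (form_skew1 form_ok) // dx1 eq_sym. Qed.

Lemma weyl_op_comm (M : lmodType F) a b (u : tpoly M N) :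
  weyl_op a (weyl_op b u) =
  weyl_op b (weyl_op a u) + form (odd_basis a) (odd_basis b) *: u.
Proof.
case: a b => -[] i [[] j]; rewrite /weyl_op /odd_basis /=.
- by rewrite xx0 scale0r addr0 !linearN /= tp_derC.
- by rewrite xd1 !linearN /= tp_der_mul opprD scaleNr.
- by rewrite dx1 !linearN /= tp_der_mul opprD eq_sym subrK.
- by rewrite dd0 scale0r addr0 tp_mulC.
Qed.

(** Normal ordering. Of the two mixed sums in [osc] one already consists of terms x_j d/dx_i; in the
    other, d/dx_i x_j = x_j d/dx_i + delta_ij yields the same sum once more and the constant term.
    The factor 1/2 of [osc] is the one between B and the form. *)
Lemma osc_actE (M : srep g) X (u : tpoly M N) :
  osc_act form d x X u =
  tp_map (sr_act X) id u + osc form odd_basis (@weyl_op F M N) X u.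
Proof.
rewrite /osc_act -/(tp_lift _ u); congr (_ + _).
pose Bf Y := form X Y / 2.
transitivity (\sum_i \sum_j (Bf (ls_br (tnth d i) (tnth d j)) *: tp_mul i (tp_mul j u)
     + Bf (ls_br (tnth x i) (tnth x j)) *: tp_der i (tp_der j u))
   - 2 *: (\sum_i \sum_j Bf (ls_br (tnth x i) (tnth d j)) *: tp_mul j (tp_der i u))
   - \sum_i Bf (ls_br (tnth d i) (tnth x i)) *: u).
  pose q1 i j (p : mpoly.mpoly N F) := Bf (ls_br (tnth d i) (tnth d j)) *: ('X_i * 'X_j * p)
      + Bf (ls_br (tnth x i) (tnth x j)) *: mderiv i (mderiv j p).
  pose q2 i j (p : mpoly.mpoly N F) := Bf (ls_br (tnth x i) (tnth d j)) *: ('X_j * mderiv i p).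
  pose q3 i (p : mpoly.mpoly N F) := Bf (ls_br (tnth d i) (tnth x i)) *: p.
  transitivity (tp_lift (fun p => (-1) *: (\sum_i q3 i p) +
      ((-2) *: (\sum_i \sum_j q2 i j p) + \sum_i \sum_j q1 i j p)) u).
    by apply: tp_lift_eq => p; rewrite scaleN1r scaleNr [RHS]addrC; congr (_ - _); rewrite addrC.
  rewrite !tp_lift_lin !tp_lift_sum scaleN1r scaleNr addrC; congr (_ - _).
    rewrite addrC; congr (_ - _ *: _); apply: eq_bigr => i _;
      rewrite tp_lift_sum; apply: eq_bigr => j _.
    - by rewrite tp_mulA tp_derA -!tp_liftZ -tp_liftD.
    - by rewrite tp_mul_der -tp_liftZ.
  by apply: eq_bigr => i _; rewrite tp_liftZ tp_lift_id.
pose f Y := form X Y.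
pose PQ := \sum_i \sum_j f (ls_br (tnth x i) (tnth d j)) *: tp_mul j (tp_der i u).
pose L := \sum_i f (ls_br (tnth d i) (tnth x i)) *: u.
pose DD := \sum_i \sum_j (f (ls_br (tnth d i) (tnth d j)) *: tp_mul i (tp_mul j u)
     + f (ls_br (tnth x i) (tnth x j)) *: tp_der i (tp_der j u)).
have BfE Y : Bf Y = 2^-1 * f Y by rewrite mulrC.
transitivity (2^-1 *: (DD - (PQ + PQ) - L)).
  rewrite !scalerBr /DD /PQ /L; congr (_ - _ - _).
  - rewrite scaler_sumr; apply: eq_bigr => i _; rewrite scaler_sumr.
    by apply: eq_bigr => j _; rewrite !BfE -!scalerA -scalerDr.
  - have -> : 2^-1 *: (PQ + PQ) = 2 *: (2^-1 *: PQ).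
      by rewrite -mulr2n -scaler_nat !scalerA mulrC.
    congr (_ *: _); rewrite [RHS]scaler_sumr; apply: eq_bigr => i _.
    rewrite [RHS]scaler_sumr.
    by apply: eq_bigr => j _; rewrite BfE -scalerA.
  - by rewrite scaler_sumr; apply: eq_bigr => i _; rewrite BfE -scalerA.
rewrite /osc; congr (_ *: _).
rewrite !big_boolI; under [X in _ = X + _]eq_bigr do rewrite big_boolI.
under [X in _ = _ + X]eq_bigr do rewrite big_boolI.
rewrite !big_split /= /odd_basis /weyl_op /=.
rewrite [X in _ = _ + X + _]exchange_big /=.
have -> : \sum_i \sum_j form X (ls_br (tnth d j) (tnth x i)) *: tp_mul j (- tp_der i u) = - PQ.
  rewrite /PQ -[RHS]sumrN; apply: eq_bigr => i _; rewrite -[RHS]sumrN.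
  by apply: eq_bigr => j _; rewrite linearN scalerN (br_sym1 (d_odd j) (x_odd i)).
have -> : \sum_i \sum_j form X (ls_br (tnth x i) (tnth d j)) *: - tp_der i (tp_mul j u)
    = - PQ - L.
  rewrite /PQ /L -[- \sum_i \sum_j _]sumrN -sumrB; apply: eq_bigr => i _ /=.
  rewrite -(br_sym1 (x_odd i) (d_odd i)) [in RHS](bigD1 i) //= (bigD1 i) //=.
  rewrite tp_der_mul eqxx scale1r scalerN scalerDr !opprD [RHS]addrAC; congr (_ - _ + _).
  rewrite -[RHS]sumrN; apply: eq_bigr => j ji.
  by rewrite tp_der_mul eq_sym (negbTE ji) scale0r addr0 scalerN.
have -> : \sum_i \sum_j form X (ls_br (tnth x i) (tnth x j)) *: - tp_der i (- tp_der j u)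
  = \sum_i \sum_j f (ls_br (tnth x i) (tnth x j)) *: tp_der i (tp_der j u).
  by apply: eq_bigr => i _; apply: eq_bigr => j _; rewrite [tp_der i (- _)]linearN opprK.
rewrite /DD; under [in LHS]eq_bigr do rewrite big_split; rewrite big_split /=.
set a := \sum_i \sum_j _ *: tp_mul _ _; set b := \sum_i \sum_j _ *: tp_der _ _.
by rewrite opprD !addrA !(addrAC _ _ b).
Qed.
End OscillatorAction.

(** * The Fischer product *)

Section FischerProduct.
Variables (C : numClosedFieldType) (M : lmodType C) (N : nat) (ip : M -> M -> C).
Hypothesis ip_linear : forall w, linear (fun v => ip v w : C^o).
Hypothesis ip_herm : forall v w, ip w v = (ip v w)^*.
Hypothesis ip_pos : forall v, v != 0 -> 0 < ip v v.
Local Notation T := (tpoly M N).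
Implicit Types (u v w : T) (k l : 'X_{1..N}) (i : 'I_N).

(** The squared norm of the monomial x^k, the weight for which multiplication by x_i is adjoint to
    d/dx_i. *)
Definition mnm_fact k : C := \prod_(i < N) ((k i)`!)%:R.

Definition fischer u w : C :=
  \sum_(k <- monalg.msupp u) mnm_fact k * ip (tp_coef u k) (tp_coef w k).

Lemma ip0l (w : M) : ip 0 w = 0.
Proof. by have := lin_Z (ip_linear w) 0 0; rewrite !scale0r. Qed.

Lemma ip_antilinear (v : M) a (w w' : M) : ip v (a *: w + w') = a^* * ip v w + ip v w'.
Proof. by rewrite ip_herm (ip_linear v a w w') rmorphD rmorphM /= -(ip_herm w v) -(ip_herm w' v). Qed.

Lemma ip0r (v : M) : ip v 0 = 0. Proof. by rewrite ip_herm ip0l conjC0. Qed.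

Lemma mnm_fact_gt0 k : 0 < mnm_fact k.
Proof. by apply: prodr_gt0 => i _; rewrite ltr0n fact_gt0. Qed.

Lemma fischer_linear w : linear (fun u => fischer u w : C^o).
Proof.
apply: (@supp_sum_linear C M N C^o (fun k m => mnm_fact k * ip m (tp_coef w k))) => k a x y.
by rewrite ip_linear mulrDr /= -[(a *: _ : C^o)]/(a * _) mulrCA.
Qed.

Lemma fischer_antilinear u a w w' : fischer u (a *: w + w') = a^* * fischer u w + fischer u w'.
Proof.
rewrite /fischer mulr_sumr -big_split; apply: eq_bigr => k _ /=.
by rewrite tp_coefD tp_scaleE ip_antilinear mulrDr mulrCA.
Qed.

Lemma fischer_gt0 u : u != 0 -> 0 < fischer u u.
Proof.
move=> u0.
have pos k : 0 <= mnm_fact k * ip (tp_coef u k) (tp_coef u k).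
  have [->|nz] := eqVneq (tp_coef u k) 0; first by rewrite ip0l mulr0.
  by rewrite mulr_ge0 ?ltW ?ip_pos ?mnm_fact_gt0.
rewrite lt_def; apply/andP; split; last by apply: sumr_ge0.
apply: contra u0 => /eqP h; apply/eqP/tp_ext => k; rewrite tp_coef0.
apply/eqP; apply: contraTT isT => nz; move: h.
have ku : k \in monalg.msupp u by apply: contraNT nz => /tp_notin_supp ->.
rewrite /fischer (bigD1_seq k) ?fset_uniq //= => /eqP.
rewrite paddr_eq0 ?sumr_ge0 // => /andP[/eqP h _].
have : 0 < mnm_fact k * ip (tp_coef u k) (tp_coef u k).
  by rewrite mulr_gt0 ?mnm_fact_gt0 ?ip_pos.
by rewrite h ltxx.
Qed.

Lemma fischer_mono (m m' : M) k l :
  fischer (tp_mono m k) (tp_mono m' l) = if k == l then mnm_fact k * ip m m' else 0.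
Proof.
have E (S : {fset 'X_{1..N}}) : (monalg.msupp (tp_mono m k) `<=` S)%fset ->
    fischer (tp_mono m k) (tp_mono m' l) =
    \sum_(j <- S) mnm_fact j * ip (tp_coef (tp_mono m k : T) j) (tp_coef (tp_mono m' l : T) j).
  apply: (@supp_sum_widen C M N C^o (fun j a => mnm_fact j * ip a (tp_coef _ j))) => j.
  by rewrite ip0l mulr0.
rewrite (E (k |` monalg.msupp (tp_mono m k))%fset) ?fsubsetU1 //.
rewrite (bigD1_seq k) ?fset_uniq ?fset1U1 //= !tp_coef_mono eqxx mulr1n.
rewrite big1 => [|j jk]; last first.
  by rewrite tp_coef_mono eq_sym (negbTE jk) mulr0n ip0l mulr0.
by rewrite addr0 eq_sym; case: eqP; rewrite ?mulr1n // mulr0n ip0r mulr0.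
Qed.

Lemma fischer_eq_mono (f h : T -> T) : linear f -> linear h ->
  (forall m m' k l, fischer (f (tp_mono m k)) (tp_mono m' l) =
                    fischer (tp_mono m k) (h (tp_mono m' l))) ->
  forall u w, fischer (f u) w = fischer u (h w).
Proof.
move=> fl hl E u w.
have suml (I : Type) (r : seq I) (F : I -> T) v :
    fischer (\sum_(i <- r) F i) v = \sum_(i <- r) fischer (F i) v.
  exact: (lin_sum1 (fischer_linear v)).
have sumr (I : Type) (r : seq I) (F : I -> T) v :
    fischer v (\sum_(i <- r) F i) = \sum_(i <- r) fischer v (F i).
  apply: (big_morph (fischer v)) => [y z|].
    by have := fischer_antilinear v 1 y z; rewrite scale1r conjC1 mul1r.
  have := fischer_antilinear v 0 0 0; rewrite scale0r addr0 conjC0 mul0r add0r.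
  by rewrite /fischer big1 // => k _; rewrite tp_coef0 ip0r mulr0.
rewrite (tp_expand u) (tp_expand w) (lin_sum1 fl) (lin_sum1 hl) !suml.
apply: eq_bigr => k _; rewrite !sumr; apply: eq_bigr => l _; exact: E.
Qed.

Lemma tp_mul_mono i (m : M) k : tp_mul i (tp_mono m k : T) = tp_mono m (U_(i) + k)%MM.
Proof. by rewrite /tp_mul /tp_lift tp_map_mono // -mpolyXD tp_pureX. Qed.

Lemma tp_der_mono i (m : M) k :
  tp_der i (tp_mono m k : T) = (k i)%:R *: tp_mono m (k - U_(i))%MM.
Proof.
rewrite /tp_der /tp_lift tp_map_mono // mderivX (lin_Z (@tp_pure_is_linear _ _ _ m)).
by rewrite tp_pureX.
Qed.

Lemma mnm_fact_mulU i k : mnm_fact (U_(i) + k)%MM = (k i).+1%:R * mnm_fact k.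
Proof.
rewrite /mnm_fact (bigD1 i) // [in RHS](bigD1 i) //= mulrA; congr (_ * _).
  by rewrite mnmDE mnm1E eqxx add1n factS natrM.
by apply: eq_bigr => j ji; rewrite mnmDE mnm1E eq_sym (negbTE ji) add0n.
Qed.

(** On monomials this is the recursion (k + e_i)! = (k_i + 1) k!. *)
Lemma fischer_mul_der i u w : fischer (tp_mul i u) w = fischer u (tp_der i w).
Proof.
apply: fischer_eq_mono; [exact: linearP|exact: linearP|] => m m' k l.
have Zr v a z : fischer v (a *: z) = a^* * fischer v z.
  have := fischer_antilinear v a z 0; rewrite addr0 => ->.
  by rewrite [fischer v 0]big1 ?addr0 // => j _; rewrite tp_coef0 ip0r mulr0.
rewrite tp_mul_mono tp_der_mono Zr conjC_nat !fischer_mono.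
(* If x_i does not occur in the second monomial, the truncated difference of exponents is
   meaningless, but its coefficient [l i] is zero. *)
case: (eqVneq (l i) 0%N) => [li0|li].
  rewrite li0 mul0r; case: eqP => // kl; move: li0.
  by rewrite -kl mnmDE mnm1E eqxx.
have -> : ((U_(i) + k)%MM == l) = (k == (l - U_(i))%MM).
  apply/eqP/eqP => [<-|->]; first by rewrite addmC addmK.
  by rewrite addmC submK //; apply/mnm_lepP => j; rewrite mnm1E; case: eqP => // <-;
     rewrite lt0n.
case: eqP => [kE|_]; last by rewrite mulr0.
rewrite mnm_fact_mulU mulrA; congr (_ * _ * _).
by rewrite kE mnmBE mnm1E eqxx subn1 prednK // lt0n.
Qed.

Lemma fischerC u w : fischer w u = (fischer u w)^*.
Proof.
set S := (monalg.msupp u `|` monalg.msupp w)%fset.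
have E v z : (monalg.msupp v `<=` S)%fset -> fischer v z =
    \sum_(j <- S) mnm_fact j * ip (tp_coef v j) (tp_coef z j).
  apply: (@supp_sum_widen C M N C^o (fun j a => mnm_fact j * ip a (tp_coef _ j))) => j.
  by rewrite ip0l mulr0.
rewrite !E ?fsubsetUl ?fsubsetUr // rmorph_sum; apply: eq_bigr => j _ /=.
rewrite rmorphM /= -ip_herm; congr (_ * _); apply/esym/CrealP.
by rewrite gtr0_real ?mnm_fact_gt0.
Qed.

Lemma fischer_map (f h : {linear M -> M}) :
  (forall v w : M, ip (f v) w = ip v (h w)) ->
  forall u w, fischer (tp_map f id u) w = fischer u (tp_map h id w).
Proof.
move=> fh; apply: fischer_eq_mono; try exact: tp_map_is_linear (linearP _).
by move=> m m' k l; rewrite !tp_map_mono ?linear0 // !tp_pureX !fischer_mono fh.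
Qed.

End FischerProduct.

(** * Weights and roots *)

(** In a basis of W the operators become commuting matrices, for which a common eigenvector exists;
    the operators need to commute on W only. *)
Lemma common_eigenvector_vs (C : numClosedFieldType) (V : vectType C) (W : {vspace V})
    (fs : seq 'End(V)) : W != 0%VS ->
  (forall f, f \in fs -> (f @: W <= W)%VS) ->
  (forall f1 f2 v, f1 \in fs -> f2 \in fs -> v \in W -> f1 (f2 v) = f2 (f1 v)) ->
  exists v, [/\ v \in W, v != 0 & forall f, f \in fs -> exists a, f v = a *: v].
Proof.
move=> W0 fW fC; set b := vbasis W; set n := \dim W.
have n_gt0 : (0 < n)%N by rewrite lt0n dimv_eq0.
pose mx (f : 'End(V)) : 'M[C]_n := \matrix_(i, j) coord b j (f b`_i).
pose vec (r : 'rV[C]_n) : V := \sum_i r 0 i *: b`_i.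
have bW i : (i < n)%N -> b`_i \in W.
  by move=> hi; apply: vbasis_mem; apply: mem_nth; rewrite size_tuple.
have fb f (i : 'I_n) : f \in fs -> f b`_i = \sum_j mx f i j *: b`_j.
  move=> hf; rewrite {1}(coord_vbasis (v := f b`_i) (U := W)).
    by apply: eq_bigr => j _; rewrite mxE.
  by apply: (subvP (fW f hf)); apply: memv_img; apply: bW.
have vecf f r : f \in fs -> f (vec r) = vec (r *m mx f).
  move=> hf; rewrite /vec linear_sum; under eq_bigr do rewrite linearZ /= fb // scaler_sumr.
  rewrite exchange_big; apply: eq_bigr => j _ /=; rewrite mxE scaler_suml.
  by apply: eq_bigr => i _; rewrite scalerA.
have vec_inj r : vec r = 0 -> r = 0.
  move=> h; apply/rowP => i; rewrite mxE.
  by have /freeP := basis_free (vbasisP W); apply.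
have vecD r1 r2 : vec (r1 - r2) = vec r1 - vec r2.
  by rewrite /vec -sumrB; apply: eq_bigr => i _; rewrite !mxE scalerBl.
have vecZ a r : vec (a *: r) = a *: vec r.
  by rewrite /vec scaler_sumr; apply: eq_bigr => i _; rewrite !mxE scalerA.
have mxC : {in [seq mx f | f <- fs] &, forall A B, comm_mx A B}.
  move=> _ _ /mapP[f1 h1 ->] /mapP[f2 h2 ->].
  apply/row_matrixP => i; rewrite !rowE; apply/eqP; rewrite -subr_eq0; apply/eqP.
  apply: vec_inj; rewrite vecD !mulmxA -!vecf // fC ?subrr //.
  by apply: memv_suml => j _; apply: memvZ; apply: bW.
have [r r0 /allP rP] := common_eigenvector n_gt0 mxC.
exists (vec r); split.
- by apply: memv_suml => j _; apply: memvZ; apply: bW.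
- by apply: contra r0 => /eqP /vec_inj ->.
- move=> f hf; have /sub_rVP[a ha] := rP _ (map_f mx hf).
  by exists a; rewrite vecf // ha vecZ.
Qed.

Section Weights.
Variables (C : numClosedFieldType) (g : lieSuper C) (h : {vspace g}).
Implicit Types (X Y Z : g) (H : subvs_of h) (al be : weight h).

Let inner al : g -> 'Hom(subvs_of h, g) :=
  fun X => linfun (fun H : subvs_of h => ls_br (vsval H) X - (al H : C) *: X).

Let inner_fun_linear al X :
  linear (fun H : subvs_of h => ls_br (vsval H) X - (al H : C) *: X).
Proof.
move=> a H H'; have -> : al (a *: H + H') = a * al H + al H' :> C by rewrite linearP.
by rewrite linearP /= brDl brZl scalerDl scalerBr scalerA opprD addrACA.
Qed.

(** [linfun] agrees with a raw function only if the latter is linear. The subspaces and weights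
    defined through it are unfolded by this lemma. *)
Lemma linfun_apply (F : fieldType) (U V : vectType F) (f : U -> V) : linear f ->
  forall u, linfun f u = f u.
Proof.
move=> hf u.
pose f' : {linear U -> V} := HB.pack f (GRing.isLinear.Build F U V _ f hf).
by rewrite -[f]/(f' : U -> V) lfunE.
Qed.

Let inner_linear al : linear (inner al).
Proof.
move=> a X Y; apply/lfunP => H.
rewrite add_lfunE scale_lfunE !(linfun_apply (inner_fun_linear al _)).
by rewrite linearP /= scalerDr scalerBr !scalerA mulrC opprD addrACA.
Qed.

Lemma rootspP z al X :
  reflect (X \in ls_part g z /\ forall H, ls_br (vsval H) X = (al H : C) *: X)
          (X \in rootsp z al).
Proof.
rewrite /rootsp memv_cap memv_ker (linfun_apply (inner_linear al)).
apply: (iffP andP) => -[Xz h0]; split => //.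
  move=> H; apply/eqP; rewrite -subr_eq0; move/eqP/lfunP: h0 => /(_ H).
  by rewrite (linfun_apply (inner_fun_linear al X)) lfunE /= => ->.
apply/eqP/lfunP => H; rewrite (linfun_apply (inner_fun_linear al X)) lfunE /=.
by rewrite h0 subrr.
Qed.

Lemma rootsp_part z al X : X \in rootsp z al -> X \in ls_part g z.
Proof. by case/rootspP. Qed.

Lemma rootspE z al X H : X \in rootsp z al -> ls_br (vsval H) X = (al H : C) *: X.
Proof. by case/rootspP. Qed.

Hypothesis h_even : (h <= ls_part g false)%VS.

Let vsval_even H : vsval H \in ls_part g false.
Proof. exact: (subvP h_even _ (subvsP H)). Qed.

Lemma rootsp_br z z' al be X Y : X \in rootsp z al -> Y \in rootsp z' be ->
  ls_br X Y \in rootsp (z (+) z') (al + be).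
Proof.
move=> hX hY; apply/rootspP; split.
  exact: ls_br_part (rootsp_part hX) (rootsp_part hY).
move=> H; rewrite jacobi0 ?vsval_even // (rootspE _ hX) (rootspE _ hY).
by rewrite brZl brZr -scalerDl add_lfunE.
Qed.

Variable form : g -> g -> C.
Hypothesis form_ok : invariant_form form.

(** Invariance gives (al + be)(H) (X, Y) = 0 for every H. *)
Lemma rootsp_orth z z' al be X Y : X \in rootsp z al -> Y \in rootsp z' be ->
  al + be != 0 -> form X Y = 0.
Proof.
move=> hX hY nz; apply/eqP; apply: contraTT isT => fnz.
apply: contra nz => _; apply/eqP/lfunP => H; rewrite add_lfunE zero_lfunE.
apply: (mulIf fnz); rewrite mul0r mulrDl.
rewrite -[al H * _]formZl // -[be H * _]formZr //.
rewrite -(rootspE H hX) -(rootspE H hY).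
by rewrite (form_br0 form_ok _ (vsval_even H) (rootsp_part hX)) addNr.
Qed.

(** The operators ad H commute on W, hence have a common eigenvector there. This is how a nonzero
    h-stable subspace is made to contain a root vector. *)
Lemma weight_vector_exists z (W : {vspace g}) : W != 0%VS -> (W <= ls_part g z)%VS ->
  (forall H X, X \in W -> ls_br (vsval H) X \in W) ->
  (forall H H', ls_br (vsval H) (vsval H') = 0) ->
  exists al, (W :&: rootsp z al != 0)%VS.
Proof.
move=> W0 Wz hW hab.
pose ad X : 'End(g) := linfun (ls_br X).
have adE X Y : ad X Y = ls_br X Y by rewrite lfunE.
pose fs := [seq ad (vsval H) | H : subvs_of h <- vbasis {:subvs_of h}].
have [||X [XW X0 hX]] := @common_eigenvector_vs _ _ W fs W0.
- by move=> _ /mapP[H _ ->]; apply/subvP => _ /memv_imgP[Y YW ->]; rewrite adE hW.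
- move=> _ _ v /mapP[H _ ->] /mapP[H' _ ->] _; rewrite !adE.
  by rewrite jacobi0 ?vsval_even // hab br0l add0r.
have hX' H : exists a, ls_br (vsval H) X = a *: X.
  have := coord_vbasis (memvf H); move=> ->.
  pose b := vbasis {:subvs_of h}.
  have hb (i : 'I_(\dim {:subvs_of h})) : exists a, ls_br (vsval b`_i) X = a *: X.
    have bi : b`_i \in b by apply: mem_nth; rewrite size_tuple.
    by have [a] := hX _ (map_f (fun H => ad (vsval H)) bi); rewrite adE; exists a.
  rewrite linear_sum br_suml.
  elim/big_rec: _ => [|i Y _ [a ->]]; first by exists 0; rewrite scale0r.
  have [a' ha'] := hb i; exists (coord b i H * a' + a).
  by rewrite linearZ /= brZl ha' scalerDl scalerA.
(* The coordinate along X expresses the eigenvalue as a linear function of H. *)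
pose al : weight h := linfun (fun H : subvs_of h => coord [tuple X] 0 (ls_br (vsval H) X) : C^o).
have al_lin : linear (fun H : subvs_of h => coord [tuple X] 0 (ls_br (vsval H) X) : C^o).
  by move=> a H H'; rewrite linearP /= brDl brZl linearP.
have alE H : ls_br (vsval H) X = (al H : C) *: X.
  rewrite /al (linfun_apply al_lin); have [a ->] := hX' H.
  have fX : free [tuple X] by rewrite seq1_free.
  by rewrite linearZ /= (coord_free 0 0 fX) eqxx mulr1.
exists al; apply: contra X0 => /eqP h0; rewrite -memv0 -h0 memv_cap XW.
by apply/rootspP; split => //; apply: (subvP Wz).
Qed.

End Weights.

(** [rs_span] says that the root spaces span the even part without naming a finite set of roots. For
    the odd part only the absence of weight 0 is required, since the adapted bases give the rest. *)
Record weight_structure (C : numClosedFieldType) (g : lieSuper C) (form : g -> g -> C)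
    (h : {vspace g}) : Prop := WeightStructure {
  rs_form : invariant_form form;
  rs_nondeg : forall X, X \in ls_part g false ->
    (forall Y, Y \in ls_part g false -> form X Y = 0) -> X = 0;
  rs_cartan : rootsp false (0 : weight h) = h;
  rs_span : forall U : {vspace g}, (forall al : weight h, rootsp false al <= U)%VS ->
    (ls_part g false <= U)%VS;
  rs_odd0 : rootsp true (0 : weight h) = 0%VS
}.

Record root_structure (C : numClosedFieldType) (g : lieSuper C) (form : g -> g -> C)
    (h : {vspace g}) : Prop := RootStructure {
  rs_weight :> weight_structure form h;
  rs_mult1 : forall z (al : weight h), al != 0 -> (\dim (rootsp z al) <= 1)%N
}.

Section WeightTheory.
Variables (C : numClosedFieldType) (g : lieSuper C) (form : g -> g -> C).
Variable h : {vspace g}.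
Hypothesis rs : weight_structure form h.
Let form_ok := rs_form rs.
Implicit Types (X Y Z : g) (H : subvs_of h) (al be : weight h).

Lemma cartan_even : (h <= ls_part g false)%VS.
Proof. by rewrite -(rs_cartan rs) capvSl. Qed.

Lemma cartan_rootsp X : (X \in h) = (X \in rootsp false (0 : weight h)).
Proof. by rewrite (rs_cartan rs). Qed.

Lemma vsval_rootsp H : vsval H \in rootsp false (0 : weight h).
Proof. by rewrite -cartan_rootsp subvsP. Qed.

Lemma cartan_abelian H H' : ls_br (vsval H) (vsval H') = 0.
Proof. by rewrite (rootspE H (vsval_rootsp H')) zero_lfunE scale0r. Qed.

Definition orth (X : g) : {vspace g} := lker (linfun (form X : g -> C^o)).

Lemma orthP X Y : (Y \in orth X) = (form X Y == 0).
Proof. by rewrite memv_ker (linfun_apply (formDr form_ok X)). Qed.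

(** An element of h is orthogonal to all root spaces of nonzero weight, so orthogonality to h makes
    it orthogonal to the whole even part. *)
Lemma form_cartan_nondeg H : (forall H', form (vsval H) (vsval H') = 0) -> H = 0.
Proof.
move=> h0; suff e : vsval H = 0 by apply: val_inj; rewrite /= e.
apply: (rs_nondeg rs) => [|Y Yg]; first exact: (subvP cartan_even _ (subvsP H)).
apply/eqP; rewrite -orthP; move: Y Yg; apply/subvP; apply: (rs_span rs) => al.
apply/subvP => Y hY; rewrite orthP; apply/eqP.
have [al0|al0] := eqVneq al 0.
  by rewrite al0 -cartan_rootsp in hY; rewrite -(vsprojK hY) h0.
by apply: (rootsp_orth cartan_even form_ok (vsval_rootsp H) hY); rewrite add0r.
Qed.

Let flat_fun_linear H : linear (fun H' : subvs_of h => form (vsval H) (vsval H') : C^o).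
Proof. by move=> a U V; rewrite linearP (formDr form_ok). Qed.

Let flat_linear : linear (fun H => linfun (fun H' : subvs_of h =>
    form (vsval H) (vsval H') : C^o) : weight h).
Proof.
move=> a U V; apply/lfunP => H.
rewrite add_lfunE scale_lfunE !(linfun_apply (flat_fun_linear _)).
by rewrite linearP (formDl form_ok).
Qed.

Lemma flatE H H' : flat h form H H' = form (vsval H) (vsval H').
Proof. by rewrite /flat (linfun_apply flat_linear) (linfun_apply (flat_fun_linear _)). Qed.

(** [wform] is defined through the pseudo-inverse of [flat], which this turns into a genuine
    inverse: nondegeneracy on h gives injectivity, and the dimensions agree. *)
Lemma flat_bij : limg (flat h form) = fullv.
Proof.
have k0 : lker (flat h form) = 0%VS.
  apply/eqP; rewrite -subv0; apply/subvP => H; rewrite memv_ker memv0 => /eqP hf.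
  by apply/eqP/form_cartan_nondeg => H'; rewrite -flatE hf lfunE.
apply/eqP; rewrite eqEdim subvf limg_dim_eq ?k0 ?capv0 //.
by rewrite !dimvf /dim /= muln1.
Qed.

Definition wdual al : subvs_of h := ((flat h form)^-1)%VF al.

Lemma wdualP al H : form (vsval (wdual al)) (vsval H) = al H.
Proof. by rewrite -flatE limg_lfunVK // flat_bij memvf. Qed.

Lemma wdual_linear a al be : wdual (a *: al + be) = a *: wdual al + wdual be.
Proof. by rewrite /wdual linearP. Qed.

Lemma wformE al be : wform form al be = al (wdual be).
Proof. by rewrite -wdualP. Qed.

Lemma form_cartanC H H' : form (vsval H) (vsval H') = form (vsval H') (vsval H).
Proof.
by apply: form_sym0 => //; apply: (subvP cartan_even); apply: subvsP.
Qed.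

Lemma wformC al be : wform form al be = wform form be al.
Proof. by rewrite /wform form_cartanC. Qed.

Lemma wformP a al be ga : wform form (a *: al + be) ga =
  a * wform form al ga + wform form be ga.
Proof. by rewrite !wformE add_lfunE scale_lfunE. Qed.

(** Both sides lie in h, and by invariance their pairing with H is al(H) (X, Y). *)
Lemma br_rootsp_opp z al X Y : X \in rootsp z al -> Y \in rootsp z (- al) ->
  ls_br X Y = form X Y *: vsval (wdual al).
Proof.
move=> hX hY.
have hXY : ls_br X Y \in h.
  by rewrite cartan_rootsp -(subrr al) -(addbb z); apply: rootsp_br cartan_even _ _ _ _ _ _ hX hY.
rewrite -(vsprojK hXY) -linearZ; congr vsval; apply/eqP; rewrite -subr_eq0; apply/eqP.
apply: form_cartan_nondeg => H; rewrite form_cartanC linearB linearZ /= vsprojK //.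
rewrite (form_addr form_ok) (formZr form_ok) (formNr form_ok) (form_cartanC H) wdualP.
by rewrite -(form_inv form_ok) (rootspE H hX) (formZl form_ok) mulrN mulrC subrr.
Qed.

Definition spans (z : bool) := forall U : {vspace g},
  (forall al : weight h, rootsp z al <= U)%VS -> (ls_part g z <= U)%VS.
Definition nondegenerate (z : bool) := forall X, X \in ls_part g z ->
    (forall Y, Y \in ls_part g z -> form X Y = 0) -> X = 0.

Definition rootv z al : g := vpick (rootsp z al).
(** Normalized to pair to 1 with [rootv z al]; it is a root vector of weight - al, not the coroot in
    h. *)
Definition corootv z al : g :=
  (form (rootv z al) (rootv z (- al)))^-1 *: rootv z (- al).

Lemma rootv_in z al : rootv z al \in rootsp z al.
Proof. exact: memv_pick. Qed.

Lemma corootv_in z al : corootv z al \in rootsp z (- al).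
Proof. by apply: memvZ; apply: rootv_in. Qed.

End WeightTheory.

Section RootVectors.
Variables (C : numClosedFieldType) (g : lieSuper C) (form : g -> g -> C).
Variable h : {vspace g}.
Hypothesis rs : root_structure form h.
Let form_ok := rs_form rs.
Implicit Types (X Y Z : g) (al be : weight h).

Lemma rootvP z al X : al != 0 -> X \in rootsp z al -> exists a, X = a *: rootv z al.
Proof.
move=> al0 hX; have [r0|r0] := eqVneq (rootsp z al) 0%VS.
  by move: hX; rewrite r0 memv0 => /eqP->; exists 0; rewrite scale0r.
suff /eqP E : (<[rootv z al]> == rootsp z al)%VS by apply/vlineP; rewrite E.
rewrite eqEdim -memvE rootv_in dim_vline vpick0 r0 /=; exact: (rs_mult1 rs).
Qed.

(** Otherwise [rootv z al] would be orthogonal to the line of weight - al, and by weights to all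
    other root spaces, against nondegeneracy. *)
Lemma root_pairing z al : spans h z -> nondegenerate form z -> al != 0 ->
  rootsp z al != 0%VS -> form (rootv z al) (corootv form z al) = 1.
Proof.
move=> sp nd al0 r0; rewrite (formZr form_ok) mulVf //.
apply: contra r0 => /eqP f0; rewrite -vpick0; apply/eqP.
apply: nd => [|Y]; first exact: rootsp_part (rootv_in z al).
move=> Yz; apply/eqP; rewrite -(orthP rs); move: Y Yz; apply/subvP; apply: sp => be.
apply/subvP => Y hY; rewrite (orthP rs); apply/eqP.
have [e|ne] := eqVneq (al + be) 0; last first.
  exact: (rootsp_orth (cartan_even rs) form_ok (rootv_in z al) hY ne).
have be_E : be = - al by apply/eqP; rewrite -addr_eq0 addrC e.
rewrite be_E in hY; have nal0 : - al != 0 by rewrite oppr_eq0.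
have [a ->] := rootvP nal0 hY.
by rewrite (formZr form_ok) f0 mulr0.
Qed.

Lemma corootvP z al X : spans h z -> nondegenerate form z -> al != 0 ->
  rootsp z al != 0%VS -> X \in rootsp z (- al) ->
  X = form (rootv z al) X *: corootv form z al.
Proof.
move=> sp nd al0 r0 hX; have nal0 : - al != 0 by rewrite oppr_eq0.
have [a ->] := rootvP nal0 hX; rewrite (formZr form_ok).
have := root_pairing sp nd al0 r0; rewrite /corootv (formZr form_ok) => e.
by rewrite scalerA -mulrA [X in a * X]mulrC e mulr1.
Qed.

End RootVectors.

Lemma sumv_seq_sub (F : fieldType) (V : vectType F) (I : eqType) (r : seq I)
    (f : I -> {vspace V}) (U : {vspace V}) :
  (forall i, i \in r -> (f i <= U)%VS) -> (\sum_(i <- r) f i <= U)%VS.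
Proof.
move=> hf; rewrite big_seq; elim/big_ind: _ => [|A B hA hB|i]; first exact: sub0v.
  by rewrite subv_add hA.
exact: hf.
Qed.

Lemma sumv_seq_sup (F : fieldType) (V : vectType F) (I : eqType) (r : seq I)
    (f : I -> {vspace V}) i : i \in r -> (f i <= \sum_(j <- r) f j)%VS.
Proof.
elim: r => // j r IH; rewrite inE big_cons => /orP[/eqP->|/IH]; first exact: addvSl.
by move=> h; apply: subv_trans h _; apply: addvSr.
Qed.

(** * The even Casimir element in root vectors *)

Section PositiveSystem.
Variables (C : numClosedFieldType) (g : lieSuper C) (form : g -> g -> C).
Variable h : {vspace g}.
Hypothesis rs : root_structure form h.
Let form_ok := rs_form rs.
Variables D0 D1 : {fset weight h}.
Hypothesis hD : positive_system D0 D1.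
Implicit Types (X Y Z : g) (H : subvs_of h) (al be : weight h).

Definition pos z := if z then D1 else D0.

Lemma pos_root z al : al \in pos z -> is_root z al.
Proof. by case: hD z => r0 r1 _ _ [] h0; rewrite ?r0 ?r1 h0. Qed.

Lemma pos_neq0 z al : al \in pos z -> al != 0.
Proof. by move/pos_root => /andP[]. Qed.

Lemma pos_rootsp z al : al \in pos z -> rootsp z al != 0%VS.
Proof. by move/pos_root => /andP[]. Qed.

Lemma pos_add_neq0 z z' al be : al \in pos z -> be \in pos z' -> al + be != 0.
Proof.
move=> ha hb; apply/negP; rewrite addr_eq0 => /eqP e.
have inD y ga : ga \in pos y -> ga \in (D0 `|` D1)%fset.
  by rewrite in_fsetU; case: y => ->; rewrite ?orbT.
by case: hD => _ _ /(_ _ (inD _ _ hb)); rewrite -e (inD _ _ ha).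
Qed.

Lemma root_cases z al : al != 0 -> rootsp z al != 0%VS ->
  (al \in pos z) \/ (- al \in pos z).
Proof.
move=> a0 r0; have : is_root z al by rewrite /is_root a0.
by case: hD z {r0} => r0 r1 _ _ []; rewrite ?r0 ?r1 => /orP.
Qed.

(** A root be + ga would be positive by closure, while its negative al is positive as well. *)
Lemma pos_add_odd al be ga : al \in D0 -> be \in D1 -> ga \in D1 ->
  al + (be + ga) = 0 -> rootsp false (be + ga) = 0%VS.
Proof.
move=> ha hb hc e; apply/eqP; apply: contraTT isT => r0.
have s0 : be + ga != 0 := pos_add_neq0 (z := true) (z' := true) hb hc.
have hr : is_root false (be + ga) by rewrite /is_root s0.
have inD : be + ga \in (D0 `|` D1)%fset.
  by case: hD => _ _ _; apply; rewrite ?in_fsetU ?hb ?hc ?orbT ?hr.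
case: hD => _ _ /(_ _ inD) /negP []; rewrite in_fsetU.
suff -> : - (be + ga) = al by rewrite ha.
by apply/eqP; rewrite eq_sym -addr_eq0 e.
Qed.

Section Pairing.
Variable z : bool.
Hypotheses (sp : spans h z) (nd : nondegenerate form z).
Local Notation rv := (rootv z).
Local Notation cv := (corootv form z).

Lemma form_rv_cv al be : al \in pos z -> be \in pos z ->
  form (rv al) (cv be) = (al == be)%:R.
Proof.
move=> ha hb; case: eqP => [<-|/eqP ne].
  exact: root_pairing rs _ _ sp nd (pos_neq0 ha) (pos_rootsp ha).
apply: (rootsp_orth (cartan_even rs) form_ok (rootv_in z al) (corootv_in form z be)).
by rewrite subr_eq0.
Qed.

Lemma br_rv_cv al : al \in pos z -> ls_br (rv al) (cv al) = vsval (wdual form al).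
Proof.
move=> ha; rewrite (br_rootsp_opp rs (rootv_in z al) (corootv_in form z al)).
by rewrite form_rv_cv // eqxx scale1r.
Qed.
End Pairing.

Let sp0 : spans h false := rs_span rs.
Let nd0 : nondegenerate form false := rs_nondeg rs.

Definition cartan_dual : seq (g * g) :=
  [seq (vsval (wdual form (linfun (coord (vbasis {:subvs_of h}) i : subvs_of h -> C^o))),
        vsval ((vbasis {:subvs_of h})`_i)) | i : 'I_(\dim {:subvs_of h})].

(** Each positive root contributes its pair in both orders. On a highest weight vector the second
    order acts by zero and the first by the bracket [wdual form al]. *)
Definition even_casimir : seq (g * g) := cartan_dual ++
  ([seq (rootv false al, corootv form false al) | al <- D0] ++
   [seq (corootv form false al, rootv false al) | al <- D0]).

Lemma cartan_dual_in p : p \in cartan_dual -> (p.1 \in h) && (p.2 \in h).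
Proof. by move=> /imageP[i _ ->]; rewrite !subvsP. Qed.

Lemma cartan_dual_exp H :
  vsval H = \sum_(p <- cartan_dual) form (vsval H) p.1 *: p.2.
Proof.
rewrite big_map big_enum /= {1}(coord_vbasis (memvf H)) linear_sum.
apply: eq_bigr => i _; rewrite linearZ /= (form_cartanC rs) (wdualP rs).
by rewrite lfunE.
Qed.

Lemma even_casimir_in p : p \in even_casimir ->
  (p.1 \in ls_part g false) && (p.2 \in ls_part g false).
Proof.
rewrite !mem_cat => /or3P[/cartan_dual_in/andP[h1 h2]|/mapP[al _ ->]|/mapP[al _ ->]] /=.
- by rewrite !(subvP (cartan_even rs)).
- by rewrite (rootsp_part (rootv_in _ _)) (rootsp_part (corootv_in _ _ _)).
- by rewrite (rootsp_part (rootv_in _ _)) (rootsp_part (corootv_in _ _ _)).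
Qed.

(** The vectors with this expansion form a subspace, so root vectors suffice. For these, weights
    leave either the Cartan part or the single term of the root al or - al. *)
Lemma even_casimir_exp Y : Y \in ls_part g false ->
  Y = \sum_(p <- even_casimir) form Y p.1 *: p.2.
Proof.
pose phi Y := \sum_(p <- even_casimir) form Y p.1 *: p.2.
have phi_lin : linear (fun Y => Y - phi Y).
  move=> a U V; rewrite /phi scalerBr scaler_sumr addrACA -opprD -big_split /=.
  congr (_ - _); apply: eq_bigr => p _.
  by rewrite (formDl form_ok) scalerDl scalerA.
pose U : {vspace g} := lker (linfun (fun Y => Y - phi Y)).
have inU X : (X \in U) = (X == phi X) by rewrite memv_ker (linfun_apply phi_lin) subr_eq0.
move=> hY; apply/eqP; rewrite -[_ == _]inU; move: Y hY; apply/subvP; apply: sp0 => al.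
apply/subvP => Y hY; rewrite inU /phi.
have ce := cartan_even rs.
rewrite !big_cat /= [X in _ + (X + _)]big_map [X in _ + (_ + X)]big_map /=.
have cart0 : al != 0 -> \sum_(p <- cartan_dual) form Y p.1 *: p.2 = 0.
  move=> al0; rewrite big_seq big1 // => p /cartan_dual_in/andP[hp _].
  rewrite (rootsp_orth ce form_ok hY (be := 0) (z' := false)) ?scale0r ?addr0 //.
  by rewrite -(cartan_rootsp rs).
have root0 (f : weight h -> weight h) (v w : weight h -> g) :
    (forall be, v be \in rootsp false (f be)) ->
    (forall be, be \in D0 -> al + f be != 0) ->
    \sum_(be <- D0) form Y (v be) *: w be = 0.
  move=> hv hf; rewrite big_seq big1 // => be hb.
  by rewrite (rootsp_orth ce form_ok hY (hv be)) ?scale0r ?hf.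
have rvi be : rootv false be \in rootsp false be := rootv_in _ _.
have cvi be : corootv form false be \in rootsp false (- be) := corootv_in _ _ _.
have single ga (v w : weight h -> g) (Z := w ga) : ga \in D0 ->
    (forall be, be \in D0 -> be != ga -> form Y (v be) = 0) ->
    \sum_(be <- D0) form Y (v be) *: w be = form Y (v ga) *: Z.
  move=> hga h0; rewrite (bigD1_seq ga) ?fset_uniq //= big_seq_cond.
  by rewrite big1 ?addr0 // => be /andP[hb nb]; rewrite h0 ?scale0r.
have [al0|al0] := eqVneq al 0.
  have hE := cartan_dual_exp (vsproj h Y).
  rewrite vsprojK in hE; last by rewrite (cartan_rootsp rs) -al0.
  rewrite -hE (root0 id) // => [|be /(pos_neq0 (z:=false))]; last first.
    by rewrite al0 add0r.
  rewrite (root0 -%R) ?addr0 // => be /(pos_neq0 (z:=false)).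
  by rewrite al0 add0r oppr_eq0.
have [r0|r0] := eqVneq (rootsp false al) 0%VS.
  move: hY; rewrite r0 memv0 => /eqP->.
  by rewrite !big1 ?addr0 // => i _; rewrite (form0l form_ok) scale0r.
rewrite cart0 // add0r; have [hal|hal] := root_cases al0 r0.
- rewrite (root0 id) ?add0r //; last first.
    by move=> be hb; apply: (pos_add_neq0 (z:=false) (z':=false)).
  rewrite (single al) // => [|be hb nb]; last first.
    by apply: (rootsp_orth ce form_ok hY (cvi be)); rewrite subr_eq0 eq_sym.
  have [a ->] := rootvP rs al0 hY.
  by rewrite (formZl form_ok) (form_rv_cv sp0 nd0) // eqxx mulr1.
- rewrite [X in _ + X](root0 -%R) ?addr0 //; last first.
    move=> be hb; rewrite -oppr_eq0 opprD opprK.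
    exact: (pos_add_neq0 (z:=false) (z':=false)).
  rewrite (single (- al)) // => [|be hb nb]; last first.
    by apply: (rootsp_orth ce form_ok hY (rvi be)); rewrite addrC addr_eq0.
  have nal0 : - al != 0 by rewrite oppr_eq0.
  rewrite (form_sym0 form_ok (rootsp_part hY) (rootsp_part (rvi _))).
  rewrite -(corootvP rs sp0 nd0 nal0 (pos_rootsp (z:=false) hal)) ?opprK //.
Qed.

Lemma even_casimir_dual : even_dual form even_casimir.
Proof.
split=> [p|p|Y hY|Y hY]; try by case/even_casimir_in/andP.
  exact: even_casimir_exp.
have in1 p : p \in even_casimir -> p.1 \in ls_part g false by case/even_casimir_in/andP.
have in2 p : p \in even_casimir -> p.2 \in ls_part g false by case/even_casimir_in/andP.
(* The second expansion is dual to the first: by the latter, both sides pair equally with every even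
   W. *)
apply/eqP; rewrite -subr_eq0; apply/eqP; apply: nd0 => [|W hW].
  rewrite rpredB // big_seq rpred_sum // => p hp; exact: memvZ (in1 _ hp).
rewrite (form_addl form_ok) (formNl form_ok) (form_suml form_ok).
rewrite {1}(even_casimir_exp hW) (form_sumr form_ok) -sumrB big_seq big1 // => p hp.
rewrite (formZr form_ok) (formZl form_ok) mulrC.
by rewrite (form_sym0 form_ok hW (in1 _ hp)) subrr.
Qed.

End PositiveSystem.

(** * The odd part and the adapted bases *)

Section OddPart.
Variables (C : numClosedFieldType) (g : lieSuper C) (form : g -> g -> C).
Variable h : {vspace g}.
Hypothesis rs : weight_structure form h.
Let form_ok := rs_form rs.
Variables D0 D1 : {fset weight h}.
Hypothesis hD : positive_system D0 D1.
Variables (N : nat) (d x : N.-tuple g).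
Hypothesis d_basis : basis_of (n1_plus D1) d.
Hypothesis x_basis : basis_of (n1_minus D1) x.
Hypothesis dx1 : forall i j, form (tnth d i) (tnth x j) = (i == j)%:R.
Implicit Types (X Y Z : g) (H : subvs_of h) (al be : weight h).

Lemma n1_plus_sub (U : {vspace g}) : (forall al, al \in D1 -> (rootsp true al <= U)%VS) ->
  (n1_plus D1 <= U)%VS.
Proof. exact: sumv_seq_sub. Qed.

Lemma n1_minus_sub (U : {vspace g}) :
  (forall al, al \in D1 -> (rootsp true (- al) <= U)%VS) -> (n1_minus D1 <= U)%VS.
Proof. exact: (@sumv_seq_sub _ _ _ _ (fun al => rootsp true (- al))). Qed.

Lemma n1_plus_sup al : al \in D1 -> (rootsp true al <= n1_plus D1)%VS.
Proof. exact: sumv_seq_sup. Qed.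

Lemma n1_minus_sup al : al \in D1 -> (rootsp true (- al) <= n1_minus D1)%VS.
Proof. exact: (@sumv_seq_sup _ _ _ _ (fun al => rootsp true (- al))). Qed.

Lemma d_in i : tnth d i \in n1_plus D1.
Proof. by apply: (basis_mem d_basis); apply: mem_tnth. Qed.

Lemma x_in i : tnth x i \in n1_minus D1.
Proof. by apply: (basis_mem x_basis); apply: mem_tnth. Qed.

Lemma n1_plus_odd : (n1_plus D1 <= ls_part g true)%VS.
Proof. by apply: n1_plus_sub => al _; apply: capvSl. Qed.

Lemma n1_minus_odd : (n1_minus D1 <= ls_part g true)%VS.
Proof. by apply: n1_minus_sub => al _; apply: capvSl. Qed.

Lemma d_odd i : tnth d i \in ls_part g true.
Proof. exact: (subvP n1_plus_odd _ (d_in i)). Qed.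

Lemma x_odd i : tnth x i \in ls_part g true.
Proof. exact: (subvP n1_minus_odd _ (x_in i)). Qed.

Lemma n1_plus_stable H X : X \in n1_plus D1 -> ls_br (vsval H) X \in n1_plus D1.
Proof.
move=> hX; suff : (n1_plus D1 <= linfun (ls_br (vsval H)) @^-1: n1_plus D1)%VS.
  by move/subvP/(_ _ hX); rewrite -memv_preim lfunE.
apply: n1_plus_sub => al hal; apply/subvP => Y hY; rewrite -memv_preim lfunE /=.
by rewrite (rootspE H hY) memvZ // (subvP (n1_plus_sup hal)).
Qed.

Lemma n1_minus_stable H X : X \in n1_minus D1 -> ls_br (vsval H) X \in n1_minus D1.
Proof.
move=> hX; suff : (n1_minus D1 <= linfun (ls_br (vsval H)) @^-1: n1_minus D1)%VS.
  by move/subvP/(_ _ hX); rewrite -memv_preim lfunE.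
apply: n1_minus_sub => al hal; apply/subvP => Y hY; rewrite -memv_preim lfunE /=.
by rewrite (rootspE H hY) memvZ // (subvP (n1_minus_sup hal)).
Qed.

Lemma n1_plus_isotropic X Y : X \in n1_plus D1 -> Y \in n1_plus D1 -> form X Y = 0.
Proof.
move=> hX hY; apply/eqP; rewrite -(orthP rs); move: Y hY; apply/subvP.
apply: n1_plus_sub => be hb; apply/subvP => Y hY; rewrite (orthP rs).
rewrite (form_skew1 form_ok) ?(rootsp_part hY) ?(subvP n1_plus_odd) // oppr_eq0.
rewrite -(orthP rs); move: X hX; apply/subvP.
apply: n1_plus_sub => al ha; apply/subvP => X hX; rewrite (orthP rs).
rewrite (rootsp_orth (cartan_even rs) form_ok hY hX) //.
exact: (pos_add_neq0 hD (z := true) (z' := true)).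
Qed.

Lemma n1_minus_isotropic X Y : X \in n1_minus D1 -> Y \in n1_minus D1 -> form X Y = 0.
Proof.
move=> hX hY; apply/eqP; rewrite -(orthP rs); move: Y hY; apply/subvP.
apply: n1_minus_sub => be hb; apply/subvP => Y hY; rewrite (orthP rs).
rewrite (form_skew1 form_ok) ?(rootsp_part hY) ?(subvP n1_minus_odd) // oppr_eq0.
rewrite -(orthP rs); move: X hX; apply/subvP.
apply: n1_minus_sub => al ha; apply/subvP => X hX; rewrite (orthP rs).
rewrite (rootsp_orth (cartan_even rs) form_ok hY hX) //.
rewrite -opprD oppr_eq0; exact: (pos_add_neq0 hD (z := true) (z' := true)).
Qed.

Lemma n1_plus_exp X : X \in n1_plus D1 -> X = \sum_i form X (tnth x i) *: tnth d i.
Proof.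
move=> hX; rewrite {1}(coord_basis d_basis hX); apply: eq_bigr => i _.
rewrite -tnth_nth; congr (_ *: _); rewrite {2}(coord_basis d_basis hX) (form_suml form_ok).
rewrite (bigD1 i) //= big1 => [|j ji]; rewrite -tnth_nth (formZl form_ok) dx1.
  by rewrite eqxx mulr1 addr0.
by rewrite (negbTE ji) mulr0.
Qed.

Lemma n1_minus_exp X : X \in n1_minus D1 -> X = \sum_i form (tnth d i) X *: tnth x i.
Proof.
move=> hX; rewrite {1}(coord_basis x_basis hX); apply: eq_bigr => i _.
rewrite -tnth_nth; congr (_ *: _); rewrite {2}(coord_basis x_basis hX) (form_sumr form_ok).
rewrite (bigD1 i) //= big1 => [|j ji]; rewrite -tnth_nth (formZr form_ok) dx1.
  by rewrite eqxx mulr1 addr0.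
by rewrite eq_sym (negbTE ji) mulr0.
Qed.

Let xd1 i j : form (tnth x i) (tnth d j) = - (i == j)%:R.
Proof. by rewrite (form_skew1 form_ok) ?x_odd ?d_odd // dx1 eq_sym. Qed.

(** The orthogonal projection onto n_1^+ + n_1^-. *)
Let proj Y : g := \sum_i (form Y (tnth x i) *: tnth d i + form (tnth d i) Y *: tnth x i).

Let proj_linear : linear proj.
Proof.
move=> a U V; rewrite /proj scaler_sumr -big_split; apply: eq_bigr => i _ /=.
rewrite (formDl form_ok) (formDr form_ok) !scalerDl scalerDr !scalerA addrACA.
by [].
Qed.

Let form_proj_x Y j : form (proj Y) (tnth x j) = form Y (tnth x j).
Proof.
rewrite /proj (form_suml form_ok) (bigD1 j) //= big1 => [|i ij];
  rewrite (form_addl form_ok) !(formZl form_ok) dx1 (n1_minus_isotropic (x_in _) (x_in _)).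
  by rewrite eqxx mulr1 mulr0 !addr0.
by rewrite (negbTE ij) !mulr0 addr0.
Qed.

Let form_proj_d Y j : form (tnth d j) (proj Y) = form (tnth d j) Y.
Proof.
rewrite /proj (form_sumr form_ok) (bigD1 j) //= big1 => [|i ij];
  rewrite (form_addr form_ok) !(formZr form_ok) dx1 (n1_plus_isotropic (d_in _) (d_in _)).
  by rewrite eqxx mulr1 mulr0 add0r addr0.
by rewrite eq_sym (negbTE ij) !mulr0 addr0.
Qed.

Let proj_odd Y : proj Y \in ls_part g true.
Proof. by apply: memv_suml => i _; rewrite rpredD ?memvZ ?d_odd ?x_odd. Qed.

(* The orthogonal complement of n1+ + n1- in the odd part is stable under h,
   so a nonzero one would contain a root vector. *)
Lemma proj_id Y : Y \in ls_part g true -> proj Y = Y.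
Proof.
pose W : {vspace g} := (ls_part g true :&: lker (linfun proj))%VS.
have inW Z : (Z \in W) = (Z \in ls_part g true) && (proj Z == 0).
  by rewrite memv_cap memv_ker (linfun_apply proj_linear).
have Wx Z j : Z \in W -> form Z (tnth x j) = 0.
  by rewrite inW => /andP[_ /eqP pZ]; rewrite -form_proj_x pZ (form0l form_ok).
have Wd Z j : Z \in W -> form (tnth d j) Z = 0.
  by rewrite inW => /andP[_ /eqP pZ]; rewrite -form_proj_d pZ (form0r form_ok).
have ce := cartan_even rs.
have hev H : vsval H \in ls_part g false := subvP ce _ (subvsP H).
have W_stable H Z : Z \in W -> ls_br (vsval H) Z \in W.
  move=> hZ; have Zodd : Z \in ls_part g true by move: hZ; rewrite inW => /andP[].
  rewrite inW (ls_br_part (hev H) Zodd) /=; apply/eqP/big1 => i _.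
  rewrite (form_br0 form_ok _ (hev H) Zodd).
  rewrite (n1_minus_exp (n1_minus_stable H (x_in i))) (form_sumr form_ok) big1 => [|j _].
    rewrite oppr0 scale0r add0r.
    rewrite -[form (tnth d i) _]opprK -(form_br0 form_ok _ (hev H) (d_odd i)).
    rewrite (n1_plus_exp (n1_plus_stable H (d_in i))) (form_suml form_ok) big1 ?oppr0 ?scale0r //.
    by move=> j _; rewrite (formZl form_ok) Wd // mulr0.
  by rewrite (formZr form_ok) Wx // mulr0.
have W0 : W = 0%VS.
  apply/eqP; apply: contraT => nW.
  have [al] := weight_vector_exists ce nW (capvSl _ _) W_stable (cartan_abelian rs).
  have : (W :&: rootsp true al <= 0)%VS; last by rewrite subv0 => ->.
  apply/subvP => Z; rewrite memv_cap memv0 => /andP[ZW Zal].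
  have [al0|al0] := eqVneq al 0; first by rewrite al0 (rs_odd0 rs) memv0 in Zal.
  have [r0|r0] := eqVneq (rootsp true al) 0%VS; first by rewrite r0 memv0 in Zal.
  have [hal|hal] := root_cases hD al0 r0.
    rewrite (n1_plus_exp (subvP (n1_plus_sup hal) _ Zal)) big1 // => i _.
    by rewrite Wx // scale0r.
  have hZ : Z \in n1_minus D1 by apply: (subvP (n1_minus_sup hal)); rewrite opprK.
  by rewrite (n1_minus_exp hZ) big1 // => i _; rewrite Wd // scale0r.
move=> hY; apply/eqP; rewrite eq_sym -subr_eq0 -memv0 -W0 inW rpredB ?proj_odd //=.
apply/eqP/big1 => i _; rewrite (form_addl form_ok) (formNl form_ok).
rewrite (form_addr form_ok) (formNr form_ok) form_proj_x form_proj_d.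
by rewrite !subrr !scale0r addr0.
Qed.

Local Notation e := (odd_basis d x).
Local Notation e' := (odd_cobasis d x).

Lemma odd_basis_dual : odd_dual form e e'.
Proof.
split=> [[[] i]|[[] i]|Y hY|Y hY|[[] i]]; rewrite /odd_basis /odd_cobasis /=.
- exact: x_odd.
- exact: d_odd.
- by rewrite rpredN d_odd.
- exact: x_odd.
- rewrite big_boolI -[LHS](proj_id hY) /proj big_split; congr (_ + _).
  apply: eq_bigr => i _; rewrite (formNr form_ok) -(form_skew1 form_ok) ?d_odd //.
- rewrite big_boolI -[LHS](proj_id hY) /proj big_split addrC; congr (_ + _).
  apply: eq_bigr => i _; rewrite scalerN -scaleNr -(form_skew1 form_ok) ?x_odd //.
- rewrite big_boolI /= [X in _ + X]big1 => [|j _].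
    rewrite addr0 (bigD1 i) //= dx1 eqxx scale1r big1 ?addr0 // => j ji.
    by rewrite dx1 (negbTE ji) scale0r.
  by rewrite (n1_minus_isotropic (x_in _) (x_in _)) scale0r.
- rewrite big_boolI /= big1 => [|j _].
    rewrite add0r (bigD1 i) //= xd1 eqxx scaleN1r big1 ?addr0 ?opprK // => j ji.
    by rewrite xd1 (negbTE ji) oppr0 scale0r.
  by rewrite (n1_plus_isotropic (d_in _) (d_in _)) scale0r.
Qed.

(** With [nondeg_odd], the odd counterpart of [rs_span] and [rs_nondeg], obtained here from the
    adapted bases. *)
Lemma spans_odd : spans h true.
Proof.
move=> U hU; apply/subvP => Y hY; rewrite -(proj_id hY); apply: memv_suml => i _.
rewrite rpredD ?memvZ //.
  by apply: (subvP _ _ (d_in i)); apply: n1_plus_sub => al _.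
by apply: (subvP _ _ (x_in i)); apply: n1_minus_sub => al _.
Qed.

Lemma nondeg_odd : nondegenerate form true.
Proof.
move=> X hX h0; rewrite -(proj_id hX) /proj big1 // => i _.
by rewrite (form_skew1 form_ok (d_odd i) hX) !h0 ?d_odd ?x_odd // oppr0 !scale0r addr0.
Qed.

End OddPart.

Section OddRootVectors.
Variables (C : numClosedFieldType) (g : lieSuper C) (form : g -> g -> C).
Variable h : {vspace g}.
Hypothesis rs : root_structure form h.
Let form_ok := rs_form rs.
Variables D0 D1 : {fset weight h}.
Hypothesis hD : positive_system D0 D1.
Variables (N : nat) (d x : N.-tuple g).
Hypothesis d_basis : basis_of (n1_plus D1) d.
Hypothesis x_basis : basis_of (n1_minus D1) x.
Hypothesis dx1 : forall i j, form (tnth d i) (tnth x j) = (i == j)%:R.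
Implicit Types (X Y Z : g) (al be : weight h).
Let sp1 := spans_odd rs hD d_basis x_basis dx1.
Let nd1 := nondeg_odd rs hD d_basis x_basis dx1.

Lemma n1_plus_root_exp X : X \in n1_plus D1 ->
  X = \sum_(al <- D1) form X (corootv form true al) *: rootv true al.
Proof.
have lin : linear (fun Y => Y -
    \sum_(al <- D1) form Y (corootv form true al) *: rootv true al).
  move=> a U V; rewrite scalerBr scaler_sumr addrACA -opprD -big_split /=.
  congr (_ - _); apply: eq_bigr => al _.
  by rewrite (formDl form_ok) scalerDl scalerA.
move=> hX; apply/eqP; rewrite -subr_eq0 -(linfun_apply lin) -memv_ker.
move: X hX; apply/subvP; apply: n1_plus_sub => be hb; apply/subvP => Y hY.
rewrite memv_ker (linfun_apply lin) subr_eq0.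
have [a ->] := rootvP rs (pos_neq0 hD (z := true) hb) hY.
rewrite (bigD1_seq be) ?fset_uniq //= big_seq_cond big1 => [|al /andP[ha nab]];
  rewrite (formZl form_ok) (form_rv_cv rs hD (z := true) sp1 nd1) //.
  by rewrite eqxx mulr1 addr0.
by rewrite eq_sym (negbTE nab) mulr0 scale0r.
Qed.

(** The tensor sum_i d_i (x) x_i does not depend on the choice of dual bases. Root vectors of n_1^+
    with their duals turn the sum into the elements dual to the positive odd roots, so the total is
    dual to 2 rho_1. *)
Lemma sum_br_dx :
  \sum_i ls_br (tnth d i) (tnth x i) = vsval (wdual form (\sum_(al <- D1) al)).
Proof.
have -> : vsval (wdual form (\sum_(al <- D1) al)) =
    \sum_(al <- D1) ls_br (rootv true al) (corootv form true al).
  rewrite (lin_sum1 (f := @wdual C g form h) (@wdual_linear C g form h)) linear_sum.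
  apply: eq_big_seq => al hal /=.
  exact: (esym (br_rv_cv rs hD (z := true) sp1 nd1 hal)).
have cv_in al : al \in D1 -> corootv form true al \in n1_minus D1.
  by move=> hal; apply: (subvP (n1_minus_sup hal)); apply: corootv_in.
transitivity (\sum_i \sum_(al <- D1) form (tnth d i) (corootv form true al) *:
     ls_br (rootv true al) (tnth x i)).
  apply: eq_bigr => i _; under eq_bigr do rewrite -brZl; rewrite -br_suml.
  by rewrite -n1_plus_root_exp ?(d_in d_basis).
rewrite exchange_big; apply: eq_big_seq => al hal /=.
under eq_bigr do rewrite -brZr; rewrite -br_sumr.
by rewrite -(n1_minus_exp rs x_basis dx1) // cv_in.
Qed.

(** A nonzero value would need positive odd roots be and ga with al + be + ga = 0 and [Y, Z] of
    weight be + ga nonzero, which positivity excludes. *)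
Lemma form_br_n1_plus al X Y Z : (al == 0) || (al \in D0) -> X \in rootsp false al ->
  Y \in n1_plus D1 -> Z \in n1_plus D1 -> form X (ls_br Y Z) = 0.
Proof.
move=> hal hX hY hZ.
rewrite (n1_plus_root_exp hY) br_suml (form_sumr form_ok) big_seq big1 // => be hb.
rewrite (n1_plus_root_exp hZ) brZl br_sumr (formZr form_ok) (form_sumr form_ok).
rewrite big_seq big1 ?mulr0 // => ga hc; rewrite brZr (formZr form_ok).
have hYZ := rootsp_br (cartan_even rs) (rootv_in true be) (rootv_in true ga).
have [e0|ne] := eqVneq (al + (be + ga)) 0; last first.
  by rewrite (rootsp_orth (cartan_even rs) form_ok hX hYZ ne) mulr0.
have := pos_add_neq0 hD (z := true) (z' := true) hb hc.
case/orP: hal e0 => [/eqP-> | ha e0 _]; first by rewrite add0r => ->; rewrite eqxx.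
by move: hYZ; rewrite (pos_add_odd hD ha hb hc e0) memv0 => /eqP->; rewrite (form0r form_ok) mulr0.
Qed.

End OddRootVectors.

(** * The inequality *)

Section HighestWeightCasimir.
Variables (C : numClosedFieldType) (g : lieSuper C) (form : g -> g -> C).
Variable h : {vspace g}.
Hypothesis rs : root_structure form h.
Let form_ok := rs_form rs.
Variables D0 D1 : {fset weight h}.
Hypothesis hD : positive_system D0 D1.

Variables (V : lmodType C) (act : g -> V -> V).
Hypothesis act_r : forall X, linear (act X).
Hypothesis act_br : forall X Y v, X \in ls_part g false -> Y \in ls_part g false ->
  act (ls_br X Y) v = act X (act Y v) - act Y (act X v).

(** The classical value (la, la + 2 rho_0), for an abstract action of the even part. It serves three
    times: on M, on the constant polynomials under [osc], and on the tensor product under the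
    diagonal action. *)
Lemma hw_casimir (la : weight h) v :
  (forall al X, al \in D0 -> X \in rootsp false al -> act X v = 0) ->
  (forall H : subvs_of h, act (vsval H) v = (la H : C) *: v) ->
  \sum_(p <- even_casimir form D0) act p.1 (act p.2 v) =
  wform form la (la + \sum_(al <- D0) al) *: v.
Proof.
move=> n0 hla; rewrite /even_casimir /cartan_dual !big_cat /= [X in X + _]big_map big_enum [X in _ + (X + _)]big_map [X in _ + (_ + X)]big_map /=.
have sp0 : spans h false := rs_span rs.
have nd0 : nondegenerate form false := rs_nondeg rs.
have act0 X : act X 0 = 0 by have := lin_Z (act_r X) 0 0; rewrite !scale0r.
rewrite [X in _ + (_ + X)]big_seq [X in _ + (_ + X)]big1 ?addr0 => [|al hal]; last first.
  by rewrite (n0 al) ?rootv_in.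
rewrite (wformC rs) (wformE rs).
rewrite add_lfunE scalerDl; congr (_ + _).
  rewrite [in RHS](coord_vbasis (memvf (wdual form la))) linear_sum scaler_suml.
  apply: eq_bigr => i _; rewrite hla (lin_Z (act_r _)) hla scalerA; congr (_ *: _).
  rewrite mulrC -(wformE rs) (wformC rs) (wformE rs) lfunE /= linearZ /=.
  by [].
rewrite sum_lfunE scaler_suml; apply: eq_big_seq => al hal.
have rvi := rootv_in false al; have cvi := corootv_in form false al.
have := act_br v (rootsp_part rvi) (rootsp_part cvi).
rewrite (n0 al (rootv false al)) // act0 subr0 => <-.
rewrite (br_rv_cv rs hD (z := false)) // hla; congr (_ *: _).
by rewrite -(wformE rs) (wformC rs) (wformE rs).
Qed.
End HighestWeightCasimir.

Section TensorAction.
Variables (F : numFieldType) (g : lieSuper F) (M : srep g) (N : nat).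
Local Notation T := (tpoly M N).

Definition tp_act (X : g) : T -> T := tp_map (@sr_act F g M X) id.

Lemma tp_act_coef X u k : tp_coef (tp_act X u) k = sr_act X (tp_coef u k).
Proof. by rewrite tp_map_id // linear0. Qed.

Lemma tp_act_is_linear X : linear (tp_act X).
Proof. exact: tp_map_is_linear (linearP _). Qed.

HB.instance Definition _ X := GRing.isLinear.Build F T T _ (tp_act X) (tp_act_is_linear X).

Lemma tp_act_is_linear_l u : linear (fun X => tp_act X u).
Proof.
move=> a X Y; apply: tp_ext => k.
by rewrite tp_coefD tp_scaleE !tp_act_coef sr_actDl.
Qed.

Lemma tp_coefN (u : T) k : tp_coef (- u) k = - tp_coef u k.
Proof. by apply: (addrI (tp_coef u k)); rewrite -tp_coefD !subrr tp_coef0. Qed.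

Lemma tp_act_br0 X Y u : X \in ls_part g false ->
  tp_act X (tp_act Y u) = tp_act (ls_br X Y) u + tp_act Y (tp_act X u).
Proof.
move=> hX; apply: tp_ext => k; rewrite tp_coefD !tp_act_coef.
exact: act_br0.
Qed.

Lemma tp_act_br1 X Y u : X \in ls_part g true -> Y \in ls_part g true ->
  tp_act X (tp_act Y u) = tp_act (ls_br X Y) u - tp_act Y (tp_act X u).
Proof.
move=> hX hY; apply: tp_ext => k; rewrite tp_coefD tp_coefN !tp_act_coef.
exact: act_br1.
Qed.

Lemma tp_act_lift X (q : {linear mpoly.mpoly N F -> mpoly.mpoly N F}) u :
  tp_act X (tp_lift q u) = tp_lift q (tp_act X u).
Proof.
pose f := [the {linear T -> T} of tp_act X \o tp_lift q].
pose f' := [the {linear T -> T} of tp_lift q \o tp_act X].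
apply: (tp_monoP (linearP f) (linearP f')) => m k; rewrite /f /f' /=.
have a0 : sr_act X (0 : M) = 0 by rewrite linear0.
rewrite {1}/tp_lift tp_map_mono // {2}/tp_act tp_map_mono // tp_pureX.
rewrite {1}/tp_lift tp_map_mono //.
apply: tp_ext => l; rewrite tp_act_coef !tp_coef_pure.
by rewrite linearZ.
Qed.

Lemma tp_act_weyl X a u : tp_act X (weyl_op a u) = weyl_op a (tp_act X u).
Proof.
rewrite /weyl_op; case: a.1; last exact: (tp_act_lift X ('X_a.2 \*o idfun)).
by rewrite linearN; congr (- _); apply: (tp_act_lift X (mderiv a.2)).
Qed.

End TensorAction.

(** * The constant polynomial as a highest weight vector *)

Section Vacuum.
Variables (C : numClosedFieldType) (g : lieSuper C) (form : g -> g -> C).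
Variable h : {vspace g}.
Hypothesis rs : root_structure form h.
Let form_ok := rs_form rs.
Variables D0 D1 : {fset weight h}.
Hypothesis hD : positive_system D0 D1.
Variables (N : nat) (d x : N.-tuple g).
Hypothesis d_basis : basis_of (n1_plus D1) d.
Hypothesis x_basis : basis_of (n1_minus D1) x.
Hypothesis dx1 : forall i j, form (tnth d i) (tnth x j) = (i == j)%:R.
Variable M : srep g.
Local Notation T := (tpoly M N).
Local Notation al := (osc form (odd_basis d x) (@weyl_op C M N)).
Variable m : M.
Let u0 : T := tp_mono m 0%MM.

Let der0 i : tp_der i u0 = 0.
Proof. by rewrite tp_der_mono mnm0E scale0r. Qed.

Let weyl0 i : weyl_op (true, i) u0 = 0.
Proof. by rewrite /weyl_op /= der0 oppr0. Qed.

(** A derivative kills a constant, so only the terms x_i x_j and the contractions of d/dx_i with x_i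
    survive. *)
Lemma osc_vacuum X : al X u0 = 2^-1 *:
  (\sum_i \sum_j form X (ls_br (tnth d i) (tnth d j)) *: tp_mul i (tp_mul j u0)
   - form X (\sum_i ls_br (tnth d i) (tnth x i)) *: u0).
Proof.
rewrite /osc big_boolI; congr (_ *: _).
have -> : \sum_i \sum_b form X (ls_br (odd_basis d x (false, i)) (odd_basis d x b)) *:
     weyl_op (false, i) (weyl_op b u0) =
   \sum_i \sum_j form X (ls_br (tnth d i) (tnth d j)) *: tp_mul i (tp_mul j u0).
  apply: eq_bigr => i _; rewrite big_boolI [X in _ + X]big1 ?addr0 // => j _.
  by rewrite (congr1 (weyl_op (false, i)) (weyl0 j)) linear0 scaler0.
congr (_ + _); rewrite (form_sumr form_ok) scaler_suml -sumrN; apply: eq_bigr => i _.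
rewrite big_boolI [X in _ + X]big1 ?addr0 => [|j _]; last first.
  by rewrite /= (congr1 (weyl_op (true, i)) (weyl0 j)) linear0 scaler0.
rewrite (bigD1 i) //= big1 => [|j ji]; rewrite /weyl_op /odd_basis /= tp_der_mul der0.
  rewrite linear0 add0r eqxx scale1r addr0 scalerN.
  by rewrite (br_sym1 (x_odd x_basis i) (d_odd d_basis i)).
by rewrite linear0 add0r eq_sym (negbTE ji) scale0r oppr0 scaler0.
Qed.

Lemma vacuum_nilp be X : be \in D0 -> X \in rootsp false be -> al X u0 = 0.
Proof.
move=> hbe hX; rewrite osc_vacuum (sum_br_dx rs hD d_basis x_basis dx1).
rewrite (rootsp_orth (cartan_even rs) form_ok hX (vsval_rootsp rs _)) ?addr0; last first.
  exact: (pos_neq0 hD (z := false)).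
rewrite scale0r subr0 big1 ?scaler0 // => i _; apply: big1 => j _.
rewrite (form_br_n1_plus rs hD d_basis x_basis dx1 _ hX (d_in d_basis i) (d_in d_basis j)).
  by rewrite scale0r.
by rewrite hbe orbT.
Qed.

(** The quadratic terms vanish by weights, and the contractions give minus one half of the element
    dual to 2 rho_1. *)
Lemma vacuum_weight (H : subvs_of h) :
  al (vsval H) u0 = ((- half_sum D1) H : C) *: u0.
Proof.
rewrite osc_vacuum (sum_br_dx rs hD d_basis x_basis dx1).
rewrite big1 => [|i _]; last first.
  apply: big1 => j _.
  rewrite (form_br_n1_plus rs hD d_basis x_basis dx1 _ (vsval_rootsp rs H)
    (d_in d_basis i) (d_in d_basis j)) ?eqxx //.
  by rewrite scale0r.
rewrite sub0r scalerN scalerA -scaleNr; congr (_ *: _).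
by rewrite (form_cartanC rs) (wdualP rs) /half_sum opp_lfunE scale_lfunE.
Qed.

End Vacuum.

(** * The Casimir eigenvalue on M *)

Section AbstractInequality.
Variables (C : numClosedFieldType) (g : lieSuper C) (form : g -> g -> C).
Variable h : {vspace g}.
Hypothesis rs : root_structure form h.
Let form_ok := rs_form rs.
Local Notation W := (wform form).
Implicit Types (al be ga : weight h).

Lemma wformDl al be ga : W (al + be) ga = W al ga + W be ga.
Proof. by have := wformP rs 1 al be ga; rewrite scale1r mul1r. Qed.

Lemma wformNl al be : W (- al) be = - W al be.
Proof. by apply: (addrI (W al be)); rewrite -wformDl !subrr !(wformE rs) lfunE. Qed.

Lemma wformDr al be ga : W al (be + ga) = W al be + W al ga.
Proof. by rewrite !(wformC rs al) wformDl. Qed.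

Lemma wformNr al be : W al (- be) = - W al be.
Proof. by rewrite !(wformC rs al) wformNl. Qed.

Variables D0 D1 : {fset weight h}.
Hypothesis hD : positive_system D0 D1.
Variable eps : C.
Hypothesis eps_sign : eps = 1 \/ eps = -1.
Variables (N : nat) (d x : N.-tuple g) (omega : g -> g).
Hypothesis adapted : omega_adapted form d x omega D1 eps.
Variable M : srep g.
Hypothesis unitaryM : unitary omega M.

Let d_basis : basis_of (n1_plus D1) d. Proof. by case: adapted. Qed.
Let x_basis : basis_of (n1_minus D1) x. Proof. by case: adapted. Qed.
Let dx1 i j : form (tnth d i) (tnth x j) = (i == j)%:R. Proof. by case: adapted. Qed.
Let omega_x i : omega (tnth x i) = eps *: tnth d i. Proof. by case: adapted. Qed.

Local Notation e := (odd_basis d x).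
Local Notation e' := (odd_cobasis d x).
Local Notation K := (even_casimir form D0).
Let hK := even_casimir_dual rs hD.
Let he := odd_basis_dual rs hD d_basis x_basis dx1.

Lemma sum_pos_half (D : {fset weight h}) : \sum_(al <- D) al = half_sum D + half_sum D.
Proof.
by rewrite /half_sum -mulr2n -scaler_nat scalerA divff ?pnatr_eq0 // scale1r.
Qed.

Lemma casimir_hw_rep La (w : M) : highest_weight_rep M D0 D1 La ->
  casimir K e e' w = W La (La + \sum_(al <- D0) al - \sum_(al <- D1) al) *: w.
Proof.
(* The vectors on which the Casimir element acts by this scalar form a submodule, so the generating
   vector suffices. *)
move=> [v [[v0 n0 n1 hv] gen]]; move: w; apply: gen.
  have cl := @casimir_is_linear C g K _ e e' M.
  split=> [|a u w hu hw|X w _ hw].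
  - by have := lin_Z cl 0 0; rewrite !scale0r scaler0.
  - by rewrite cl hu hw scalerDr !scalerA mulrC.
  - by rewrite -(casimir_comm form_ok hK he) hw linearZ.
have dv i : sr_act (tnth d i) v = 0.
  rewrite (n1_plus_root_exp rs hD d_basis x_basis dx1 (d_in d_basis i)).
  rewrite (lin_sum (sr_actDl v)) big_seq big1 // => al hal.
  by rewrite (n1 al) ?rootv_in ?scaler0.
rewrite /casimir (hw_casimir rs hD (@sr_actDr _ _ M) _ n0 hv); last first.
  by move=> X Y w hX hY; rewrite (sr_act_br w hX hY) /= expr0 scale1r.
rewrite /casimir_odd big_boolI [X in - (_ + X)]big1 => [|i _]; last first.
  by rewrite /odd_cobasis /= actNl dv oppr0 linear0.
rewrite addr0 [W La (_ - _)]wformDr wformNr scalerDl scaleNr; congr (_ - _).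
(* As d_i kills v, d_i x_i v = [d_i, x_i] v; by [sum_br_dx] this sum is the term (La, 2 rho_1). *)
transitivity (sr_act (\sum_i ls_br (tnth d i) (tnth x i)) v).
  rewrite (lin_sum1 (sr_actDl v)); apply: eq_bigr => i _ /=.
  rewrite /odd_basis /odd_cobasis /=.
  by rewrite (act_br1 _ (d_odd d_basis i) (x_odd x_basis i)) dv linear0 subr0.
by rewrite (sum_br_dx rs hD d_basis x_basis dx1) hv -(wformE rs).
Qed.

End AbstractInequality.

(** * Positivity of the square *)

Section DiracInequality.
Variables (C : numClosedFieldType) (g : lieSuper C) (form : g -> g -> C).
Variable h : {vspace g}.
Hypothesis rs : root_structure form h.
Let form_ok := rs_form rs.
Variables D0 D1 : {fset weight h}.
Hypothesis hD : positive_system D0 D1.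
Variable eps : C.
Hypothesis eps_sign : eps = 1 \/ eps = -1.
Variables (N : nat) (d x : N.-tuple g) (omega : g -> g).
Hypothesis adapted : omega_adapted form d x omega D1 eps.
Variable M : srep g.
Hypothesis unitaryM : unitary omega M.
Local Notation W := (wform form).
Local Notation e := (odd_basis d x).
Local Notation e' := (odd_cobasis d x).
Local Notation K := (even_casimir form D0).
Local Notation T := (tpoly M N).
Local Notation c := (@weyl_op C M N).
Local Notation A := (@tp_act C g M N).
Local Notation al := (osc form e c).

Let d_basis : basis_of (n1_plus D1) d. Proof. by case: adapted. Qed.
Let x_basis : basis_of (n1_minus D1) x. Proof. by case: adapted. Qed.
Let dx1 i j : form (tnth d i) (tnth x j) = (i == j)%:R. Proof. by case: adapted. Qed.
Let omega_x i : omega (tnth x i) = eps *: tnth d i. Proof. by case: adapted. Qed.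
Let hK := even_casimir_dual rs hD.
Let he := odd_basis_dual rs hD d_basis x_basis dx1.
Let d_in1 := d_odd d_basis.
Let x_in1 := x_odd x_basis.

Let dd0 i j : form (tnth d i) (tnth d j) = 0.
Proof. exact (n1_plus_isotropic rs hD (d_in d_basis i) (d_in d_basis j)). Qed.
Let xx0 i j : form (tnth x i) (tnth x j) = 0.
Proof. exact (n1_minus_isotropic rs hD (x_in x_basis i) (x_in x_basis j)). Qed.

Let cC a b (u : T) : c a (c b u) = c b (c a u) + form (e a) (e b) *: u.
Proof. exact: weyl_op_comm. Qed.

Let osc_br' X Y (u : T) : X \in ls_part g false -> Y \in ls_part g false ->
  al (ls_br X Y) u = al X (al Y u) - al Y (al X u).
Proof. exact: (osc_br form_ok he cC). Qed.

Let diag X (u : T) := A X u + al X u.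

Let A_osc X Y u : A X (al Y u) = al Y (A X u).
Proof. by apply: A_osc; apply: tp_act_weyl. Qed.

Let diag_linear X : linear (diag X).
Proof.
by move=> a u v; rewrite /diag linearP (osc_is_linear form e c) scalerDr addrACA.
Qed.

Let diag_br X Y (u : T) : X \in ls_part g false -> Y \in ls_part g false ->
  diag (ls_br X Y) u = diag X (diag Y u) - diag Y (diag X u).
Proof.
move=> hX hY; rewrite /diag osc_br' //.
have oD Z v w : al Z (v + w) = al Z v + al Z w.
  by have := osc_is_linear form e c Z 1 v w; rewrite !scale1r.
have -> : A (ls_br X Y) u = A X (A Y u) - A Y (A X u) by rewrite tp_act_br0 // addrK.
rewrite [A X (_ + _)]linearD [A Y (_ + _)]linearD /= !oD !A_osc.
set a := A X (A Y u); set b := A Y (A X u); set p := al X (al Y u); set q := al Y (al X u).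
set r := al Y (A X u); set s := al X (A Y u).
rewrite [s + p]addrC [a + r + _]addrACA [r + q]addrC [b + s + _]addrACA [s + r]addrC.
by rewrite opprD [RHS]addrACA subrr addr0 opprD addrACA.
Qed.

Lemma osc_constE (m : M) : m != 0 ->
  osc_const form e = W (- half_sum D1) (- half_sum D1 + \sum_(al <- D0) al).
Proof.
move=> m0; set u0 : T := tp_mono m 0%MM.
have u00 : u0 != 0.
  apply: contra m0 => /eqP h0; have := congr1 (fun u : T => tp_coef u 0%MM) h0.
  by rewrite tp_coef0 tp_coef_mono eqxx => <-.
have := osc_casimir form_ok hK he cC u0.
rewrite (hw_casimir rs hD (@osc_is_linear C g form _ e T c) osc_br'
  (vacuum_nilp rs hD d_basis x_basis dx1 m) (vacuum_weight rs hD d_basis x_basis dx1 m)).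
move/eqP; rewrite -subr_eq0 -scalerBl scaler_eq0 (negbTE u00) orbF subr_eq0.
by move/eqP.
Qed.

Let D (u : T) := dirac e c A u.

Lemma dirac_square_hw La mu (u : T) : highest_weight_rep M D0 D1 La ->
  hw_vector (@osc_act C g form N d x M) D0 fset0 mu u ->
  2 *: D (D u) = (W mu (mu + \sum_(al <- D0) al)
    - W La (La + \sum_(al <- D0) al - \sum_(al <- D1) al)
    - W (- half_sum D1) (- half_sum D1 + \sum_(al <- D0) al)) *: u.
Proof.
move=> hLa [u0 n0 _ hu].
have actE X v : osc_act form d x X v = diag X v by exact: osc_actE.
have A_br1 X Y v : X \in ls_part g true -> Y \in ls_part g true ->
  A X (A Y v) = A (ls_br X Y) v - A Y (A X v) by exact: tp_act_br1.
rewrite (dirac_square form_ok hK he cC (@tp_act_is_linear_l _ _ _ _) A_br1 (@tp_act_weyl _ _ _ _)).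
have [v [[v0 _ _ _] _]] := hLa; rewrite (osc_constE v0) !scalerBl; congr (_ - _ - _).
  have n0' be X : be \in D0 -> X \in rootsp false be -> diag X u = 0.
    by move=> hbe hX; rewrite -actE (n0 be).
  have hu' (H : subvs_of h) : diag (vsval H) u = (mu H : C) *: u by rewrite -actE hu.
  exact: (hw_casimir rs hD diag_linear diag_br n0' hu').
apply: tp_ext => k.
have cD (a b : T) : tp_coef (a - b) k = tp_coef a k - tp_coef b k.
  by rewrite tp_coefD tp_coefN.
rewrite cD !tp_coef_sum tp_scaleE -(casimir_hw_rep rs hD adapted _ hLa) /casimir /casimir_odd.
by congr (_ - _); apply: eq_bigr => i _; rewrite !tp_act_coef.
Qed.

Lemma dirac_adjoint (ip : M -> M -> C)
    (ip_linear : forall w, linear (fun v => ip v w : C^o))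
    (ip_herm : forall v w, ip w v = (ip v w)^*)
    (ip_adj : forall X v w, ip (sr_act X v) w = ip v (sr_act (omega X) w)) (u w : T) :
  fischer ip (D u) w = fischer ip u ((- eps) *: D w).
Proof.
have epsC : eps^* = eps by case: eps_sign => ->; rewrite ?rmorphN1 ?conjC1.
have eps2 : eps * eps = 1 by case: eps_sign => ->; rewrite ?mulrNN mulr1.
have actZ a X v : sr_act (a *: X) v = a *: sr_act X v :> M := lin_Z (sr_actDl v) a X.
have ipZr (a : C) (v y : M) : ip v (a *: y) = a^* * ip v y.
  by have := ip_antilinear ip_linear ip_herm v a y 0; rewrite (ip0r ip_linear ip_herm) !addr0.
have adj_x i (v y : M) : ip (sr_act (tnth x i) v) y = ip v (sr_act (eps *: tnth d i) y).
  by rewrite ip_adj omega_x.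
(* Adaptedness gives [omega] on the x_i. The adjoint of d_i follows from Hermitian symmetry, as eps
   is real with square 1. *)
have adj_d i (v y : M) : ip (sr_act (tnth d i) v) y = ip v (sr_act (eps *: tnth x i) y).
  rewrite actZ ipZr epsC ip_herm [ip v _ in RHS]ip_herm adj_x actZ ipZr epsC rmorphM /=.
  by rewrite epsC mulrA eps2 mul1r.
have AZ a X (v : T) : A (a *: X) v = a *: A X v by exact (lin_Z (tp_act_is_linear_l v) a X).
have A_d i v y : fischer ip (A (tnth d i) v) y = fischer ip v (eps *: A (tnth x i) y).
  rewrite -AZ; exact: (fischer_map ip_linear ip_herm (f := sr_act (tnth d i))
    (h := sr_act (eps *: tnth x i)) (adj_d i)).
have A_x i v y : fischer ip (A (tnth x i) v) y = fischer ip v (eps *: A (tnth d i) y).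
  rewrite -AZ; exact: (fischer_map ip_linear ip_herm (f := sr_act (tnth x i))
    (h := sr_act (eps *: tnth d i)) (adj_x i)).
have fD v y z : fischer ip (v + y) z = fischer ip v z + fischer ip y z.
  by have := fischer_linear ip_linear z 1 v y; rewrite scale1r /= -[1 *: _]/(1 * _) mul1r.
have fA v y z : fischer ip v (y + z) = fischer ip v y + fischer ip v z.
  by have := fischer_antilinear ip_linear ip_herm v 1 y z; rewrite scale1r conjC1 mul1r.
have md i (v y : T) : fischer ip (tp_mul i v) y = fischer ip v (tp_der i y).
  exact: fischer_mul_der.
have dm i (v y : T) : fischer ip (tp_der i v) y = fischer ip v (tp_mul i y).
  by rewrite (fischerC ip_linear ip_herm) -md -(fischerC ip_linear ip_herm).
have f_sum (I : Type) (r : seq I) (F : I -> T) v :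
    fischer ip (\sum_(i <- r) F i) v = \sum_(i <- r) fischer ip (F i) v.
  exact: (lin_sum1 (fischer_linear ip_linear v)).
have sumr (I : Type) (r : seq I) (F : I -> T) v :
    fischer ip v (\sum_(i <- r) F i) = \sum_(i <- r) fischer ip v (F i).
  apply: (big_morph (fischer ip v)) => [y z|]; first exact: fA.
  by apply: (addrI (fischer ip v 0)); rewrite -fA !addr0.
have fZ (a : C) (v y : T) : fischer ip (a *: v) y = a * fischer ip v y.
  exact (lin_Z (fischer_linear ip_linear y) a v).
have fZr (a : C) (v y : T) : fischer ip v (a *: y) = a^* * fischer ip v y.
  by rewrite (fischerC ip_linear ip_herm) fZ rmorphM /= -(fischerC ip_linear ip_herm).
(* Taking adjoints exchanges the half of D with d_i and the half with x_i, hence the commuted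
   sum. *)
rewrite /D /dirac f_sum scaler_sumr sumr !big_boolI addrC; congr (_ + _);
  apply: eq_bigr => i _ /=; rewrite /odd_basis /=.
- rewrite A_x (_ : weyl_op (true, i) u = - tp_der i u) //.
  rewrite -scaleN1r fZ dm.
  by rewrite scaleNr -scaleN1r fZr rmorphN1 !linearZ /= tp_act_weyl.
- have dA X (y : T) : A X (tp_der i y) = tp_der i (A X y) := tp_act_lift X (mderiv i) y.
  rewrite A_d (_ : weyl_op (true, i) w = - tp_der i w) // md.
  by rewrite [tp_der i (_ *: _)]linearZ [A _ (- _)]linearN /= dA scalerN scaleNr opprK.
Qed.

Theorem dirac_inequality La mu : highest_weight_rep M D0 D1 La ->
  has_constituent_L0 (@osc_act C g form N d x M) D0 mu ->
  0 <= - eps * (W (mu + half_sum D1 + 2 *: (half_sum D0 - half_sum D1))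
                  (mu + half_sum D1)
                - W (La + 2 *: (half_sum D0 - half_sum D1)) La).
Proof.
move=> hLa [S [S' [[_ [u _ hu]] _ _ _]]].
set rho1 := half_sum D1; set rho := half_sum D0 - rho1.
have D2 := dirac_square_hw hLa hu; have [u0 _ _ _] := hu.
rewrite !(sum_pos_half D0) !(sum_pos_half D1) -/rho1 in D2.
set kappa := (X in _ = X *: _) in D2.
(* Since 2 rho = 2 rho_0 - 2 rho_1, the shifted square (mu + rho_1 + 2 rho, mu + rho_1) is (mu, mu +
   2 rho_0) minus the value of the oscillator Casimir at - rho_1. *)
have -> : W (mu + rho1 + 2 *: rho) (mu + rho1) - W (La + 2 *: rho) La = kappa.
  rewrite -[2%:R]/(1 + 1 : C) !scalerDl !scale1r /kappa /rho -/rho1.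
  rewrite !(wformDl rs, wformDr rs, wformNl rs, wformNr rs).
  rewrite (wformC rs mu rho1) (wformC rs mu (half_sum D0)) (wformC rs La rho1).
  rewrite (wformC rs La (half_sum D0)) (wformC rs rho1 (half_sum D0)).
  by ring.
have [ip [ip_linear ip_herm ip_pos _ ip_adj]] := unitaryM.
have adj := dirac_adjoint ip_linear ip_herm ip_adj.
have epsC : eps^* = eps by case: eps_sign => ->; rewrite ?rmorphN1 ?conjC1.
have eps2 : eps * eps = 1 by case: eps_sign => ->; rewrite ?mulrNN mulr1.
have fZ (a : C) (v y : T) : fischer ip (a *: v) y = a * fischer ip v y.
  exact (lin_Z (fischer_linear ip_linear y) a v).
have fZr (a : C) (v y : T) : fischer ip v (a *: y) = a^* * fischer ip v y.
  by rewrite (fischerC ip_linear ip_herm) fZ rmorphM /= -(fischerC ip_linear ip_herm).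
have upos : 0 < fischer ip u u by apply: fischer_gt0.
(* Multiplied by <u, u> > 0, the claim becomes - 2 eps <D (D u), u> = 2 eps^2 <D u, D u> >= 0. *)
rewrite -(pmulr_lge0 _ upos) -mulrA -fZ -D2 fZ adj fZr rmorphN /= epsC.
set X := fischer _ _ _.
have -> : - eps * (2 * (- eps * X)) = (eps * eps) * (2 * X) by ring.
rewrite eps2 mul1r mulr_ge0 //.
rewrite /X; have [->|nz] := eqVneq (D u) 0; last by apply: ltW; apply: fischer_gt0.
by rewrite -(scale0r (0 : T)) fZ mul0r.
Qed.

End DiracInequality.

(** * Matrix superalgebras *)

Lemma dim_le1_functional (F : fieldType) (V : vectType F) (U : {vspace V}) (f : V -> F^o) :
  linear f -> (forall v, v \in U -> f v = 0 -> v = 0) -> (\dim U <= 1)%N.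
Proof.
move=> hf inj; have := @limg_dim_eq _ _ _ (linfun f) U.
move=> <-; first by rewrite (leq_trans (dimvS (subvf _))) // dimvf.
apply/eqP; rewrite -subv0; apply/subvP => v; rewrite memv_cap memv_ker memv0.
by rewrite (linfun_apply hf) => /andP[vU /eqP f0]; apply/eqP/inj.
Qed.

(** * Root spaces read off from matrix entries of known weight *)

Section WeightModel.
Variables (C : numClosedFieldType) (g : lieSuper C) (h : {vspace g}).
Hypothesis h_even : (h <= ls_part g false)%VS.
Variables (m n : nat) (Phi : g -> 'M[C]_(m, n)) (theta : 'I_m -> 'I_n -> weight h).
Hypothesis Phi_linear : linear Phi.
Hypothesis Phi_inj : forall X, Phi X = 0 -> X = 0.
Hypothesis Phi_weight : forall (H : subvs_of h) X i j,
  Phi (ls_br (vsval H) X) i j = theta i j H * Phi X i j.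

Let PhiE a X Y i j : Phi (a *: X + Y) i j = a * Phi X i j + Phi Y i j.
Proof. by rewrite Phi_linear !mxE. Qed.

Let Phi_ext X Y : (forall i j, Phi X i j = Phi Y i j) -> X = Y.
Proof.
move=> e; apply/eqP; rewrite eq_sym -subr_eq0; apply/eqP/Phi_inj/matrixP => i j.
by rewrite addrC -scaleN1r PhiE e mulN1r addNr mxE.
Qed.

Lemma weight_support z al X i j : X \in rootsp z al -> Phi X i j != 0 -> theta i j = al.
Proof.
move=> hX nz; apply/lfunP => H; apply: (mulIf nz).
have Phi0 : Phi 0 i j = 0 by have := PhiE (-1) 0 0 i j; rewrite scaler0 addr0 mulN1r addNr.
by rewrite -Phi_weight (rootspE H hX) -[_ *: X]addr0 PhiE Phi0 addr0.
Qed.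

(** Lagrange interpolation inside g: if w(H) differs from w'(H), then (ad H - w'(H)) / (w(H) -
    w'(H)) keeps the entries of weight w and kills those of weight w'. *)
Let truncate z (w : weight h) X (ws : seq (weight h)) : X \in ls_part g z ->
  exists2 Y, Y \in ls_part g z & forall i j,
    [/\ theta i j = w -> Phi Y i j = Phi X i j
      & theta i j \in ws -> theta i j != w -> Phi Y i j = 0].
Proof.
move=> hX; elim: ws => [|w' ws [Y hY IH]]; first by exists X.
have [->|ww'] := eqVneq w' w.
  exists Y => // i j; have [h1 h2] := IH i j; split => //.
  by rewrite inE => /orP[/eqP->|]; rewrite ?eqxx.
have /lfunPn[H hH] : w != w' by rewrite eq_sym.
have d0 : w H - w' H != 0 :> C by rewrite subr_eq0.
exists ((w H - w' H)^-1 *: (ls_br (vsval H) Y - (w' H : C) *: Y)).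
  apply: memvZ; rewrite rpredB ?memvZ //.
  exact: (ls_br_part (subvP h_even _ (subvsP H)) hY).
move=> i j; have [h1 h2] := IH i j.
have -> : Phi ((w H - w' H)^-1 *: (ls_br (vsval H) Y - (w' H : C) *: Y)) i j
    = (w H - w' H)^-1 * ((theta i j H - w' H) * Phi Y i j).
  rewrite (lin_Z Phi_linear) mxE; congr (_ * _).
  by rewrite addrC -scaleNr PhiE Phi_weight addrC mulrBl mulNr.
split=> [e|]; first by rewrite h1 // e mulrA mulVf // mul1r.
rewrite inE => /orP[/eqP -> _|hw nw]; first by rewrite subrr mul0r mulr0.
by rewrite h2 // !mulr0.
Qed.

(** Every X is the sum of its truncations to the finitely many weights of the entries, and each
    truncation is a weight vector. *)
Lemma weight_model_spans z (U : {vspace g}) : (forall al : weight h, rootsp z al <= U)%VS ->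
  (ls_part g z <= U)%VS.
Proof.
move=> hU; apply/subvP => X hX.
pose ws := undup [seq theta ij.1 ij.2 | ij : 'I_m * 'I_n].
have in_ws i j : theta i j \in ws.
  by rewrite mem_undup; apply/mapP; exists (i, j); rewrite ?mem_enum.
have [Y hY] : exists Y : weight h -> g, forall w, Y w \in ls_part g z /\
    forall i j, Phi (Y w) i j = if theta i j == w then Phi X i j else 0.
  have pick w : exists Y, (Y \in ls_part g z) &&
      [forall i, forall j, Phi Y i j == if theta i j == w then Phi X i j else 0].
    have [Y hY hw] := truncate w ws hX; exists Y; rewrite hY /=.
    apply/forallP => i; apply/forallP => j; have [h1 h2] := hw i j.
    by case: ifPn => [/eqP/h1->|/h2->].
  exists (fun w => xchoose (pick w)) => w; have /andP[h1 /forallP h2] := xchooseP (pick w).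
  by split=> // i j; have /forallP/(_ j)/eqP := h2 i.
have -> : X = \sum_(w <- ws) Y w.
  apply: Phi_ext => i j; rewrite (lin_sum1 Phi_linear) summxE.
  rewrite (bigD1_seq (theta i j)) ?undup_uniq //= big1 ?addr0.
    by case: (hY (theta i j)) => _ ->; rewrite eqxx.
  by move=> w nw; case: (hY w) => _ ->; rewrite eq_sym (negbTE nw).
apply: rpred_sum => w _; apply: (subvP (hU w)); apply/rootspP.
have [Yz hw] := hY w; split=> // H; apply: Phi_ext => i j.
rewrite Phi_weight (lin_Z Phi_linear) mxE !hw.
by case: eqP => [->|]; rewrite ?mulr0.
Qed.

(** Stated through entries rather than positions: for osp the positions (i, j) and (j, i) have the
    same weight, and the entries there agree up to sign. *)
Hypothesis theta_inj : forall X i j k l, theta i j = theta k l -> theta i j != 0 ->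
  Phi X k l = 0 -> Phi X i j = 0.

(** Evaluation at a nonzero entry of one root vector is injective on its root space. *)
Lemma weight_model_mult1 z (al : weight h) : al != 0 -> (\dim (rootsp z al) <= 1)%N.
Proof.
move=> al0; have [->|r0] := eqVneq (rootsp z al) 0%VS; first by rewrite dimv0.
set X := vpick (rootsp z al).
have hX : X \in rootsp z al := memv_pick _.
have [ij nz] : exists ij : 'I_m * 'I_n, Phi X ij.1 ij.2 != 0.
  apply/existsP; apply: contraNT r0 => /existsPn h0; rewrite -vpick0; apply/eqP/Phi_inj.
  by apply/matrixP => i j; rewrite mxE; apply/eqP; have := h0 (i, j); rewrite negbK.
have e := weight_support hX nz.
apply: (@dim_le1_functional _ _ _ (fun Y => Phi Y ij.1 ij.2 : C^o)).
  by move=> a Y Z; rewrite PhiE.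
move=> Y hY Y0; apply: Phi_inj; apply/matrixP => i j; rewrite mxE; apply/eqP.
apply: contraTT isT => nz'; have e' := weight_support hY nz'.
by move: nz'; rewrite (theta_inj _ _ Y0) ?eqxx ?e' ?e.
Qed.

Variable form : g -> g -> C.
Hypothesis form_ok : invariant_form form.
Hypothesis nondeg : forall X, X \in ls_part g false ->
  (forall Y, Y \in ls_part g false -> form X Y = 0) -> X = 0.
Hypothesis h_abelian : forall H H' : subvs_of h, ls_br (vsval H) (vsval H') = 0.
Hypothesis zero_even : forall X, X \in ls_part g false ->
  (forall i j, Phi X i j != 0 -> theta i j = 0) -> X \in h.
Hypothesis zero_odd : forall X, X \in ls_part g true ->
  (forall i j, Phi X i j != 0 -> theta i j = 0) -> X = 0.

Lemma weight_model_root_structure : root_structure form h.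
Proof.
split; [split=> //|exact: weight_model_mult1].
- apply/eqP; rewrite eqEsubv; apply/andP; split; apply/subvP => X hX.
    by apply: zero_even (rootsp_part hX) _ => i j; apply: weight_support hX.
  apply/rootspP; split=> [|H]; first exact: (subvP h_even).
  by rewrite zero_lfunE scale0r -(vsprojK hX) h_abelian.
- exact: weight_model_spans.
- apply/eqP; rewrite -subv0; apply/subvP => X hX; rewrite memv0; apply/eqP.
  by apply: zero_odd (rootsp_part hX) _ => i j; apply: weight_support hX.
Qed.

End WeightModel.

(** * The supertrace form *)

Section SupertraceForm.
Variables (C : numClosedFieldType) (p q : nat) (U : {vspace 'M[C]_(p + q)}).
Hypothesis U_part : forall z X, X \in U -> mxpart z X \in U.
Hypothesis U_br : forall X Y, X \in U -> Y \in U -> sbr X Y \in U.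
Variable k : C.
Local Notation g := (sub_lieSuper U_part U_br).
Local Notation form := (@mx_form C p q U k : g -> g -> C).

Lemma strD (X Y : 'M[C]_(p + q)) : str (X + Y) = str X + str Y.
Proof. by have := str_is_linear 1 X Y; rewrite !scale1r. Qed.

Lemma strZ a (X : 'M[C]_(p + q)) : str (a *: X) = a * str X.
Proof. by have := lin_Z (@str_is_linear C p q) a X. Qed.

Lemma sbr_even (H X : 'M[C]_(p + q)) : mxpart false H = H -> sbr H X = H *m X - X *m H.
Proof.
move=> hH; have sD Y Z : sbr H (Y + Z) = sbr H Y + sbr H Z.
  by have := sbr_is_linear_r H 1 Y Z; rewrite !scale1r.
rewrite -[X]mxpartD sD (@sbrE _ _ _ false false) ?mxpartK //.
rewrite (@sbrE _ _ _ false true) ?mxpartK //= expr0 !scale1r.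
by rewrite mulmxDr mulmxDl opprD addrACA.
Qed.

Lemma sub_partE z (X : g) : (X \in ls_part g z) = (mxpart z (vsval X) == vsval X).
Proof. exact: subs_partP. Qed.

Lemma sub_brE (X Y : g) : vsval (ls_br X Y : subvs_of U) = sbr (vsval X) (vsval Y).
Proof. exact: subs_brE. Qed.

Lemma supertrace_form_invariant : invariant_form form.
Proof.
have vsvalP a (X Y : subvs_of U) : vsval (a *: X + Y) = a *: vsval X + vsval Y.
  exact: linearP.
have fl Y : linear (fun X : g => form X Y : C^o).
  move=> a X Z; rewrite /mx_form vsvalP mulmxDl -scalemxAl strD strZ mulrDr.
  by rewrite mulrCA.
have fr X : linear (form X : g -> C^o).
  move=> a Y Z; rewrite /mx_form vsvalP mulmxDr -scalemxAr strD strZ mulrDr.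
  by rewrite mulrCA.
have fDl X Y Z : form (X + Y) Z = form X Z + form Y Z.
  by have := fl Z 1 X Y; rewrite !scale1r.
have fDr X Y Z : form X (Y + Z) = form X Y + form X Z.
  by have := fr X 1 Y Z; rewrite !scale1r.
split=> // [z X Y|z X Y|].
- rewrite !sub_partE => /eqP hX /eqP hY; rewrite /mx_form.
  have <- : mxpart true (vsval X *m vsval Y) = vsval X *m vsval Y.
    by have := mxpart_mul hX hY; case: z {hX hY}.
  by rewrite /str /mxpart block_mxKul block_mxKdr !mxtrace0 subrr mulr0.
- rewrite !sub_partE => /eqP hX /eqP hY; rewrite /mx_form (str_homog hX hY) andbb.
  by rewrite mulrCA.
elim/(@lie_cases _ g) => [X X' hX hX'|a X hX] Y Z; first by rewrite brDl !fDl hX hX'.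
elim/(@lie_cases _ g): Y => [Y Y' hY hY'|b Y hY]; first by rewrite brDr brDl fDl hY hY' -fDr.
elim/(@lie_cases _ g): Z => [Z Z' hZ hZ'|c Z hZ]; first by rewrite brDr !fDr hZ hZ'.
move: hX hY hZ; rewrite !sub_partE => /eqP hX /eqP hY /eqP hZ.
rewrite /mx_form !sub_brE (sbrE hX hY) (sbrE hY hZ); congr (_ * _).
rewrite mulmxBl mulmxBr -scalemxAl -scalemxAr -[in LHS]scaleNr -[in RHS]scaleNr.
rewrite !strD !strZ !mulmxA; congr (_ + _).
(* The terms str(XYZ) agree. The others are compared by moving Y cyclically past XZ, at the cost of
   the sign (-1)^(b(a+c)). *)
have hXZ := mxpart_mul hX hZ.
rewrite -(mulmxA (vsval Y)) (str_homog hY hXZ) mulrA; congr (_ * _).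
by case: a b c {hX hY hZ hXZ} => -[] []; rewrite /= ?expr0 ?expr1 ?mulrN ?mulr1 ?mulNr ?opprK.
Qed.

End SupertraceForm.

Section SupermatrixEntries.
Variables (C : numClosedFieldType) (p q : nat).
Implicit Types (X : 'M[C]_(p + q)) (i j : 'I_(p + q)).

Lemma mxpartEij z X i j :
  mxpart z X i j = if ((i < p)%N == (j < p)%N) (+) z then X i j else 0.
Proof.
rewrite -{2}[X]submxK /mxpart.
case: (split_ordP i) => i' ->; case: (split_ordP j) => j' ->; case: z;
rewrite ?(block_mxEul, block_mxEur, block_mxEdl, block_mxEdr) /= ?ltn_ord
  ?[(p + _ < p)%N]ltnNge ?leq_addr /= ?mxE //.
Qed.

Definition ssign i : C := if (i < p)%N then 1 else -1.

Lemma ssign_neq0 i : ssign i != 0.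
Proof. by rewrite /ssign; case: ifP; rewrite ?oppr_eq0 oner_eq0. Qed.

Lemma strE X : str X = \sum_i ssign i * X i i.
Proof.
rewrite big_split_ord /= /str /mxtrace -sumrN; congr (_ + _); apply: eq_bigr => i _.
  by rewrite /ssign /= ltn_ord mul1r !mxE.
by rewrite /ssign /= ltnNge leq_addr /= mulN1r !mxE.
Qed.

Lemma str_mul_delta X i j : str (X *m delta_mx j i) = ssign i * X i j.
Proof.
rewrite strE (bigD1 i) //= mxE (bigD1 j) //= mxE !eqxx mulr1 big1 => [|k kj].
  rewrite addr0 big1 ?addr0 // => k ki; rewrite mxE big1 ?mulr0 // => l _.
  by rewrite mxE (negbTE ki) andbF mulr0.
by rewrite mxE (negbTE kj) mulr0.
Qed.

End SupermatrixEntries.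

(** * Diagonal Cartan subalgebras *)

Section DiagonalCartan.
Variables (C : numClosedFieldType) (p q : nat) (U : {vspace 'M[C]_(p + q)}).
Hypothesis U_part : forall z X, X \in U -> mxpart z X \in U.
Hypothesis U_br : forall X Y, X \in U -> Y \in U -> sbr X Y \in U.
Hypothesis U_delta : forall i j, i != j -> delta_mx i j \in U.
(* Scalar corrections make the diagonal matrix units available up to the
   identity, which is central; for sl(m|n) this uses m <> n. *)
Hypothesis U_diag : forall i, exists c : C,
  delta_mx i i - c%:M \in U /\ forall X, X \in U -> c * str X = 0.
Local Notation g := (sub_lieSuper U_part U_br).
Local Notation h := (diag_cartan U_part U_br).
Local Notation form := (@mx_form C p q U 1 : g -> g -> C).

Let vs (X : g) : 'M[C]_(p + q) := vsval (X : subvs_of U).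

Let vs_linear : linear vs.
Proof. by move=> a X Y; rewrite /vs; exact: linearP. Qed.

Lemma diag_cartanP (X : g) : (X \in h) = (vs X == diag_mx (\row_i vs X i i)).
Proof.
rewrite memv_ker linfun_apply ?subr_eq0 // => a Y Z.
rewrite linearP /= scalerBr addrACA -opprD; congr (_ - _).
by apply/matrixP => i j; rewrite !mxE; case: eqP; rewrite ?mulr1n ?mulr0n ?mulr0 ?addr0.
Qed.

Lemma diag_coordE i (H : subvs_of h) : diag_coord U_part U_br i H = vs (vsval H) i i.
Proof.
rewrite linfun_apply // => a H1 H2.
have e : vs (vsval (a *: H1 + H2)) = a *: vs (vsval H1) + vs (vsval H2).
  by rewrite -vs_linear; congr vs; exact: linearP.
by rewrite -[LHS]/(vs (vsval (a *: H1 + H2)) i i) e !mxE.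
Qed.

Let theta i j : weight h := diag_coord U_part U_br i - diag_coord U_part U_br j.

Let hdiag (H : subvs_of h) : vs (vsval H) = diag_mx (\row_i vs (vsval H) i i).
Proof. by apply/eqP; rewrite -diag_cartanP subvsP. Qed.

Let heven (H : subvs_of h) : mxpart false (vs (vsval H)) = vs (vsval H).
Proof.
apply/matrixP => i j; rewrite mxpartEij addbF; case: ifP => // ij.
by rewrite hdiag !mxE; case: (eqVneq i j) ij => [->|]; rewrite ?eqxx.
Qed.

Let h_even : (h <= ls_part g false)%VS.
Proof.
by apply/subvP => X hX; rewrite sub_partE -(vsprojK hX) heven.
Qed.

Let theta_br (H : subvs_of h) (X : g) i j :
  vs (ls_br (vsval H) X) i j = theta i j H * vs X i j.
Proof.
rewrite /theta add_lfunE opp_lfunE !diag_coordE /vs sub_brE sbr_even; last exact: heven.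
rewrite -!/(vs _) {1 2}hdiag mul_diag_mx mul_mx_diag !mxE.
by rewrite mulrBl [X in _ - X]mulrC.
Qed.

(** The scalar correction cancels in a difference of diagonal entries, so the corrected unit
    measures weights like the diagonal unit itself. *)
Let diagH i : exists H : subvs_of h, forall k l,
  theta k l H = (k == i)%:R - (l == i)%:R :> C.
Proof.
have [c [hc _]] := U_diag i.
pose X : g := vsproj U (delta_mx i i - c%:M).
have vX : vs X = delta_mx i i - c%:M by rewrite /vs vsprojK.
have hX : X \in h.
  rewrite diag_cartanP vX; apply/eqP/matrixP => k l; rewrite !mxE.
  case: (eqVneq k l) => [->|kl]; first by rewrite eqxx.
  rewrite ?mulr0n subr0.
  by move: kl; case: (k =P i) => [->|_]; case: (l =P i) => [->|_]; rewrite ?eqxx.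
exists (vsproj h X) => k l; rewrite /theta add_lfunE opp_lfunE !diag_coordE vsprojK // vX !mxE.
by rewrite !eqxx !andbb opprB addrA subrK.
Qed.

(** Evaluation at the i-th diagonal unit gives 1 on the left. In characteristic zero a difference of
    two indicators equals 1 only if k = i; likewise the j-th unit recovers l. *)
Let theta_eq i j k l : theta i j = theta k l -> theta i j != 0 -> (i, j) = (k, l).
Proof.
move=> e nz; have ij : i != j by apply: contra nz => /eqP->; rewrite /theta subrr.
have kl : k != l by apply: contra nz => /eqP kl; rewrite e /theta kl subrr.
have [H1 h1] := diagH i; have [H2 h2] := diagH j.
have e1 := congr1 (fun t : weight h => t H1 : C) e.
have e2 := congr1 (fun t : weight h => t H2 : C) e.
rewrite /= !h1 eqxx eq_sym (negbTE ij) subr0 in e1.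
rewrite /= !h2 eqxx (negbTE ij) sub0r in e2.
have ki : k = i.
  apply/eqP; move: e1; case: eqP => // _ /eqP; case: (l == i) => /=.
    rewrite sub0r -addr_eq0 (_ : 1 + 1 = 2%:R) ?pnatr_eq0 //.
  by rewrite subrr oner_eq0.
have lj : l = j.
  apply/eqP; move: e2; case: (l =P j) => // _ /eqP; case: (k == j) => /=.
    by rewrite subr0 eq_sym -addr_eq0 (_ : 1 + 1 = 2%:R) ?pnatr_eq0.
  by rewrite subrr oppr_eq0 oner_eq0.
by rewrite ki lj.
Qed.

Let theta0 i j : theta i j = 0 -> i = j.
Proof.
have [H hH] := diagH i; move/(congr1 (fun t : weight h => t H : C)).
rewrite /= hH eqxx zero_lfunE; case: (j =P i) => // _ /eqP.
by rewrite subr0 oner_eq0.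
Qed.

Lemma diag_root_structure : root_structure form h.
Proof.
have form_ok : invariant_form form := supertrace_form_invariant U_part U_br 1.
apply: (weight_model_root_structure h_even vs_linear _ theta_br) => //.
- by move=> X X0; apply: val_inj; rewrite /= -/(vs X) X0.
- by move=> X i j k l e nz; have [-> ->] := theta_eq e nz.
- move=> X hX h0; apply: val_inj; rewrite /= -/(vs X).
  have X0 := hX; rewrite sub_partE -/(vs X) in X0.
  have vs_form (Y : 'M[C]_(p + q)) : mxpart false Y = Y -> Y \in U -> str (vs X *m Y) = 0.
    move=> Ye YU; have := h0 (vsproj U Y); rewrite sub_partE vsprojK // Ye eqxx.
    by rewrite /mx_form vsprojK // mul1r => ->.
  apply/matrixP => i j; rewrite [RHS]mxE.
  have [e|/negbTE ne] := boolP ((i < p)%N == (j < p)%N); last first.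
    by rewrite -(eqP X0) mxpartEij addbF ne.
  have [ij|ij] := eqVneq i j.
    (* A diagonal entry is tested against the corrected unit; the correction contributes c str X =
       0. *)
    rewrite -ij; have [c [hc c0]] := U_diag i.
    have : str (vs X *m (delta_mx i i - c%:M)) = 0.
      apply: vs_form hc; apply/matrixP => k l; rewrite mxpartEij addbF.
      case: ifPn => // kl; rewrite !mxE.
      case: (eqVneq k l) kl => [->|kl]; rewrite ?eqxx //= ?mulr0n subr0.
      by move: kl; case: (k =P i) => [->|_]; case: (l =P i) => [->|_]; rewrite ?eqxx.
    rewrite mulmxBr mul_mx_scalar -scaleNr strD strZ str_mul_delta mulNr c0 ?subvsP //.
    by rewrite oppr0 addr0 => /eqP; rewrite mulf_eq0 (negbTE (ssign_neq0 _ _)) => /eqP.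
  have : str (vs X *m delta_mx j i) = 0.
    apply: vs_form; last by apply: U_delta; rewrite eq_sym.
    apply/matrixP => k l; rewrite mxpartEij addbF; case: ifPn => // kl; rewrite !mxE.
    by move: kl; case: (k =P j) => [->|_]; case: (l =P i) => [->|_] //; rewrite eq_sym e.
  by rewrite str_mul_delta => /eqP; rewrite mulf_eq0 (negbTE (ssign_neq0 _ _)) => /eqP.
- move=> H H'; apply: val_inj.
  have -> : val (0 : g) = 0 :> 'M_(p + q) by [].
  rewrite [LHS](@sub_brE _ _ _ _ U_part U_br) sbr_even; last exact: heven.
  rewrite -!/(vs _) (hdiag H) (hdiag H') !mulmx_diag.
  by apply/eqP; rewrite subr_eq0; apply/eqP; congr diag_mx; apply/rowP => i; rewrite !mxE mulrC.
- move=> X hX h0; rewrite diag_cartanP; apply/eqP/matrixP => i j; rewrite !mxE.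
  case: (eqVneq i j) => [->|ij]; rewrite ?mulr1n // mulr0n.
  by apply/eqP; apply: contraNT ij => /h0/theta0->.
- move=> X hX h0; apply: val_inj; rewrite /= -/(vs X).
  move: hX; rewrite sub_partE -/(vs X) => /eqP hX; apply/matrixP => i j; rewrite [RHS]mxE.
  apply/eqP; apply: contraT => nz; have ij := theta0 (h0 _ _ nz).
  by move: nz; rewrite -hX mxpartEij ij eqxx /= eqxx.
Qed.

End DiagonalCartan.

Section GLSL.
Variable C : numClosedFieldType.

Lemma gl_root_structure n r s :
  root_structure (@dform _ (gl_datum C n r s)) (dh (gl_datum C n r s)).
Proof.
apply: diag_root_structure => [i j _|i]; first exact: memvf.
by exists 0; split=> [|X _]; rewrite ?memvf ?mul0r.
Qed.

Lemma sl_root_structure m n r s : m <> n ->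
  root_structure (@dform _ (sl_datum C m n r s)) (dh (sl_datum C m n r s)).
Proof.
move=> /eqP mn.
have str_delta i j : str (delta_mx i j : 'M[C]_(m + n)) = (i == j)%:R * ssign C i.
  rewrite -[delta_mx i j]mul1mx str_mul_delta !mxE mulrC [j == i]eq_sym.
  by case: (eqVneq i j) => [->|_]; rewrite ?mul0r.
have str1 : str (1%:M : 'M[C]_(m + n)) = m%:R - n%:R.
  by rewrite scalar_mx_block /str block_mxKul block_mxKdr !mxtrace1.
have mn0 : m%:R - n%:R != 0 :> C by rewrite subr_eq0 eqr_nat.
apply: diag_root_structure => [i j ij|i].
  by rewrite sl_spaceP str_delta (negbTE ij) mul0r.
(* The identity has supertrace m - n and the i-th unit has supertrace [ssign C i], so this multiple
   of the identity makes the difference supertraceless. *)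
exists (ssign C i / (m%:R - n%:R)); split=> [|X].
  rewrite sl_spaceP -scalemx1 -scaleNr strD strZ str1 str_delta eqxx mul1r.
  by rewrite mulNr divfK // subrr.
by rewrite sl_spaceP => /eqP->; rewrite mulr0.
Qed.

End GLSL.

(** * Orthosymplectic superalgebras *)

Section SignedPairs.
Variables (N : nat) (P : finType) (f s : P -> 'I_N).
Hypothesis f_inj : injective f.
Hypothesis s_inj : injective s.
Hypothesis fs_disj : forall x y, f x != s y.
Hypothesis outside_unique : forall i j, (forall x, i != f x) -> (forall x, i != s x) ->
  (forall x, j != f x) -> (forall x, j != s x) -> i = j.
Implicit Types (i j k l : 'I_N) (x y : P).

(** The coordinate along x of the weight of the i-th weight vector. Integer values leave finitely
    many cases to decide. *)
Definition pair_sign i x : int := (i == f x)%:Z - (i == s x)%:Z.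

Lemma pair_spec i : [\/ exists x, i = f x, exists x, i = s x |
  (forall x, i != f x) /\ (forall x, i != s x)].
Proof.
have [/existsP[x /eqP]|/existsPn hf] := boolP [exists x, i == f x].
  by move=> e; apply: Or31; exists x.
have [/existsP[x /eqP]|/existsPn hs] := boolP [exists x, i == s x].
  by move=> e; apply: Or32; exists x.
exact: Or33.
Qed.

Lemma pair_sign_f x y : pair_sign (f x) y = (x == y)%:Z.
Proof. by rewrite /pair_sign (inj_eq f_inj) (negbTE (fs_disj x y)) subr0. Qed.

Lemma pair_sign_s x y : pair_sign (s x) y = - (x == y)%:Z.
Proof. by rewrite /pair_sign (inj_eq s_inj) eq_sym (negbTE (fs_disj y x)) sub0r. Qed.

Lemma pair_sign_out i y : (forall x, i != f x) -> (forall x, i != s x) -> pair_sign i y = 0.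
Proof. by move=> hf hs; rewrite /pair_sign (negbTE (hf y)) (negbTE (hs y)) subr0. Qed.

Lemma pair_sign_cases i x : [\/ pair_sign i x = 0, pair_sign i x = 1 /\ i = f x
  | pair_sign i x = -1 /\ i = s x].
Proof.
rewrite /pair_sign; case: (i =P f x) => [->|_].
  by rewrite (negbTE (fs_disj x x)) subr0; apply: Or32.
case: (i =P s x) => [->|_]; first by rewrite sub0r; apply: Or33.
by rewrite subrr; apply: Or31.
Qed.

Lemma pair_sign_inj i j : (forall x, pair_sign i x = pair_sign j x) -> i = j.
Proof.
case: (pair_spec i) => [[x ->]|[x ->]|[hf hs]].
- by move/(_ x); rewrite pair_sign_f eqxx; case: (pair_sign_cases j x) => [->|[-> ->]|[-> _]].
- by move/(_ x); rewrite pair_sign_s eqxx; case: (pair_sign_cases j x) => [->|[-> _]|[-> ->]].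
case: (pair_spec j) => [[x ->]|[x ->]|[hf' hs']].
- by move/(_ x); rewrite pair_sign_f eqxx pair_sign_out.
- by move/(_ x); rewrite pair_sign_s eqxx pair_sign_out.
by move=> _; apply: outside_unique.
Qed.

(** Where the sum is nonzero, i or j has a nonzero sign, and comparing values in {-1, 0, 1} forces
    that index to be k or l. The other one follows by cancellation, since signs determine
    indices. *)
Lemma pair_sign_sum i j k l :
  (forall x, pair_sign i x + pair_sign j x = pair_sign k x + pair_sign l x) ->
  (exists x, pair_sign i x + pair_sign j x != 0) ->
  (i = k /\ j = l) \/ (i = l /\ j = k).
Proof.
have key i' j' k' l' x : (forall x, pair_sign i' x + pair_sign j' x = pair_sign k' x + pair_sign l' x) ->
    pair_sign i' x + pair_sign j' x != 0 -> pair_sign i' x != 0 ->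
    (i' = k' /\ j' = l') \/ (i' = l' /\ j' = k').
  move=> e nz hi.
  have [ik|il] : i' = k' \/ i' = l'.
    have ex := e x; move: nz hi ex.
    case: (pair_sign_cases i' x) => [->|[-> ->]|[-> ->]];
    case: (pair_sign_cases j' x) => [->|[-> _]|[-> _]];
    case: (pair_sign_cases k' x) => [->|[-> ->]|[-> ->]];
    case: (pair_sign_cases l' x) => [->|[-> ->]|[-> ->]]; by auto.
  - left; split=> //; apply: pair_sign_inj => y; apply: (addrI (pair_sign k' y)).
    by rewrite -e ik.
  - right; split=> //; apply: pair_sign_inj => y; apply: (addrI (pair_sign l' y)).
    by rewrite [RHS]addrC -e il.
move=> e [x nz]; have [hi|hi] := eqVneq (pair_sign i x) 0; last exact: (key _ _ _ _ x).
have [] := key j i k l x; try by [move=> y; rewrite addrC e|rewrite addrC|move: nz; rewrite hi add0r|auto].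
  by case; auto.
by case; auto.
Qed.

Lemma pair_sign_opp i x j : pair_sign i x + pair_sign j x = 0 ->
  (j = f x -> i = s x) /\ (j = s x -> i = f x).
Proof.
move=> e; split=> ej; move: e; rewrite ej ?pair_sign_f ?pair_sign_s eqxx.
  by case: (pair_sign_cases i x) => [->|[-> _]|[_ ->]].
by case: (pair_sign_cases i x) => [->|[_ ->]|[-> _]].
Qed.

End SignedPairs.

(** * Paired coordinates of osp(m|2n) *)

Section OrthosymplecticPairs.
Variables (C : numClosedFieldType) (m n : nat).
Local Notation N := (m + (n + n))%N.
Local Notation P := ('I_(m./2) + 'I_n)%type.
Implicit Types (x y : P) (i j k l : 'I_N).

Definition osp_fst x : 'I_N :=
  match x with inl k => lshift (n + n) (ev k) | inr a => rshift m (lshift n a) end.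
Definition osp_snd x : 'I_N :=
  match x with inl k => lshift (n + n) (od k) | inr a => rshift m (rshift n a) end.
Local Notation f := osp_fst.
Local Notation s := osp_snd.

Lemma osp_fst_inj : injective f.
Proof.
move=> [k|a] [l|b] /= e.
- by have /= /double_inj e' := congr1 val (lshift_inj e); congr inl; apply: val_inj.
- by move/eqP: e; rewrite eq_lrshift.
- by move/eqP: e; rewrite eq_rlshift.
- by rewrite (lshift_inj (rshift_inj e)).
Qed.

Lemma osp_snd_inj : injective s.
Proof.
move=> [k|a] [l|b] /= e.
- by have /= [/double_inj e'] := congr1 val (lshift_inj e); congr inl; apply: val_inj.
- by move/eqP: e; rewrite eq_lrshift.
- by move/eqP: e; rewrite eq_rlshift.
- by rewrite (rshift_inj (rshift_inj e)).
Qed.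

Lemma osp_fst_snd x y : f x != s y.
Proof.
case: x y => [k|a] [l|b] /=; apply/eqP => e.
- have /= := congr1 (odd \o val) (lshift_inj e).
  by rewrite /= !odd_double.
- by move/eqP: e; rewrite eq_lrshift.
- by move/eqP: e; rewrite eq_rlshift.
- by have /eqP := rshift_inj e; rewrite eq_lrshift.
Qed.

(** Only the last orthogonal coordinate, for odd m, belongs to no pair. *)
Lemma osp_outside i : (forall x, i != f x) -> (forall x, i != s x) ->
  (i < m)%N && (val i == m./2.*2).
Proof.
case: (split_ordP i) => [i' ->|j ->] hf hs; last first.
  case: (split_ordP j) hf hs => a -> hf hs.
    by have := hf (inr a); rewrite /= eqxx.
  by have := hs (inr a); rewrite /= eqxx.

rewrite /=.
have [hk|hk] := ltnP (i'./2) (m./2).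
  have hodd := odd_double_half i'.
  case: (boolP (odd i')) hodd => ho e.
    have := hs (inl (Ordinal hk)); rewrite /= (inj_eq (@lshift_inj _ _)).
    by rewrite -val_eqE /= -[X in X == _]e add1n eqxx.
  have := hf (inl (Ordinal hk)); rewrite /= (inj_eq (@lshift_inj _ _)).
  by rewrite -val_eqE /= -[X in X == _]e add0n eqxx.
rewrite eqn_leq; apply/andP; split.
  rewrite -ltnS; apply: leq_trans (ltn_ord i') _.
  by rewrite -[leqLHS]odd_double_half -add1n leq_add2r; case: (odd m).
by rewrite (leq_trans (n := (i'./2).*2)) ?leq_double // -[leqRHS]odd_double_half leq_addl.
Qed.

Lemma osp_outside_unique i j : (forall x, i != f x) -> (forall x, i != s x) ->
  (forall x, j != f x) -> (forall x, j != s x) -> i = j.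
Proof.
move=> h1 h2 h3 h4; have /andP[_ /eqP e1] := osp_outside h1 h2.
by have /andP[_ /eqP e2] := osp_outside h3 h4; apply: val_inj; rewrite e1 e2.
Qed.

(** The orthogonal blocks i Omega_1 and the symplectic part i Omega_n diag(D, D) have the same shape
    on a pair of coordinates, which allows a uniform treatment. *)
Definition osp_Hx x : 'M[C]_N := 'i *: (delta_mx (f x) (s x) - delta_mx (s x) (f x)).
Definition osp_comb (c : P -> C) : 'M[C]_N := \sum_x c x *: osp_Hx x.

Lemma osp_HxE x i j : osp_Hx x i j =
  'i * (((i == f x) && (j == s x))%:R - ((i == s x) && (j == f x))%:R).
Proof. by rewrite !mxE. Qed.

Lemma osp_HE t d : osp_H t d =
  osp_comb (fun x => match x with inl k => t 0 k | inr a => d 0 a end) :> 'M[C]_N.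
Proof.
rewrite /osp_comb big_sumType /= /osp_H /Omega mulmx_block.
rewrite !(mul0mx, mulmx0, mul1mx, mulNmx, addr0, add0r) scale_block_mx !scaler0.
apply/matrixP => i j; rewrite [RHS]mxE !summxE.
case: (split_ordP i) => i' ->; case: (split_ordP j) => j' ->;
rewrite ?(block_mxEul, block_mxEur, block_mxEdl, block_mxEdr).
- rewrite [X in _ = _ + X]big1 ?addr0 => [|a _]; last first.
    by rewrite !mxE /= !eq_lrshift /= subrr !mulr0.
  rewrite summxE; apply: eq_bigr => k _.
  by rewrite !mxE /= !(inj_eq (@lshift_inj _ _)).
- rewrite [LHS]mxE big1 ?add0r ?big1 // => k _; rewrite !mxE /= ?eq_lrshift ?eq_rlshift ?andbF /=.
    by rewrite subrr !mulr0.
  by rewrite subrr !mulr0.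
- rewrite [LHS]mxE big1 ?add0r ?big1 // => k _; rewrite !mxE /= ?eq_lrshift ?eq_rlshift ?andbF /=.
    by rewrite subrr !mulr0.
  by rewrite subrr !mulr0.
rewrite big1 ?add0r => [|k _]; last by rewrite !mxE /= !eq_rlshift /= subrr !mulr0.
case: (split_ordP i') => a ->; case: (split_ordP j') => b ->;
rewrite ?(block_mxEul, block_mxEur, block_mxEdl, block_mxEdr).
- rewrite [LHS]mxE big1 // => c _; rewrite !mxE /= !(inj_eq (@rshift_inj _ _)).
  by rewrite !eq_lrshift /= !andbF subrr !mulr0.
- rewrite !mxE (bigD1 a) //= big1 => [|c ca]; rewrite !mxE /= !(inj_eq (@rshift_inj _ _));
    rewrite ?(inj_eq (@lshift_inj _ _)) ?(inj_eq (@rshift_inj _ _)) !eq_lrshift /= subr0.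
    by rewrite eqxx addr0 eq_sym; case: eqP; rewrite ?mulr1 ?mulr1n ?mulr0 // mulrC.
  by rewrite [a == c]eq_sym (negbTE ca) !mulr0.
- rewrite !mxE (bigD1 a) //= big1 => [|c ca]; rewrite !mxE /= !(inj_eq (@rshift_inj _ _));
    rewrite ?(inj_eq (@lshift_inj _ _)) ?(inj_eq (@rshift_inj _ _)) !eq_rlshift /= sub0r.
    by rewrite eqxx addr0 eq_sym; case: eqP; rewrite ?mulr1 ?mulr1n ?mulr0n ?mulr0 ?oppr0 ?mulr0 // !mulrN mulr1 mulrC.
  by rewrite [a == c]eq_sym (negbTE ca) oppr0 !mulr0.
rewrite [LHS]mxE big1 // => c _; rewrite !mxE /= !(inj_eq (@rshift_inj _ _)).
by rewrite !eq_rlshift /= !andbF subrr !mulr0.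
Qed.

Lemma osp_comb_in c : osp_comb c \in osp_space C m n.
Proof.
pose t : 'rV[C]_(m./2) := \row_k c (inl k); pose d : 'rV[C]_n := \row_a c (inr a).
have -> : osp_comb c = osp_H t d.
  by rewrite osp_HE; apply: eq_bigr => -[k|a] _; rewrite mxE.
apply/osp_spaceP; rewrite /osp_H /Omega !(block_mxKul, block_mxKur, block_mxKdl, block_mxKdr).
split; rewrite ?trmx0 ?mulmx0 ?oppr0 //.
  rewrite linear_sum -sumrN; apply: eq_bigr => k _ /=.
  apply/matrixP => i j; rewrite !mxE -mulrN -mulrN opprB.
  by rewrite ![(j == _) && _]andbC.
rewrite mulmx_block !(mul0mx, mulmx0, mul1mx, mulNmx, addr0, add0r).
rewrite linearZ /= tr_block_mx !trmx0 linearN /= tr_diag_mx -scalemxAr -scalemxAl.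
rewrite !mulmx_block !(mul0mx, mulmx0, mul1mx, mulmx1, mulNmx, mulmxN, addr0, add0r, opprK, oppr0).
by [].
Qed.

Local Notation g := (osp_lieSuper C m n).
Local Notation h := (osp_cartan C m n).
Let vs (X : g) : 'M[C]_N := vsval (X : subvs_of (osp_space C m n)).

Let vs_linear : linear vs.
Proof. by move=> a X Y; rewrite /vs; exact: linearP. Qed.

Lemma osp_cartanP (X : g) : X \in h <-> exists c, vs X = osp_comb c.
Proof.
have lin : linear (fun td : 'rV[C]_(m./2) * 'rV[C]_n =>
    vsproj (osp_space C m n) (osp_H td.1 td.2)).
  move=> a [t1 d1] [t2 d2]; rewrite /= -linearP; congr (vsproj _ _).
  rewrite !osp_HE /osp_comb scaler_sumr -big_split; apply: eq_bigr => -[k|b] _ /=;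
  by rewrite !mxE scalerDl -scalerA.
split=> [/memv_imgP[[t d] _ ->]|[c hc]].
  exists (fun x => match x with inl k => t 0 k | inr a => d 0 a end).
  rewrite /vs (linfun_apply lin) /= osp_HE vsprojK // osp_comb_in //.
apply/memv_imgP; exists (\row_k c (inl k), \row_a c (inr a)); first exact: memvf.
rewrite (linfun_apply lin) /= osp_HE; apply: val_inj; rewrite /= vsprojK ?osp_comb_in //.
rewrite -/(vs X) hc; apply: eq_bigr => -[k|a] _; rewrite mxE //.
Qed.

End OrthosymplecticPairs.

(** * Simultaneous diagonalization of the Cartan subalgebra *)

Section OrthosymplecticDiagonalization.
Variables (C : numClosedFieldType) (m n : nat).
Local Notation N := (m + (n + n))%N.
Local Notation P := ('I_(m./2) + 'I_n)%type.
Local Notation f := (@osp_fst m n).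
Local Notation s := (@osp_snd m n).
Local Notation Hx := (@osp_Hx C m n).
Local Notation comb := (@osp_comb C m n).
Implicit Types (x y : P) (i j k l : 'I_N) (c : P -> C) (M : 'M[C]_N).

Let fs x y : (f x == s y) = false. Proof. exact/negbTE/osp_fst_snd. Qed.
Let sf x y : (s x == f y) = false. Proof. by rewrite eq_sym fs. Qed.
Let ff x y : (f x == f y) = (x == y). Proof. exact/inj_eq/osp_fst_inj. Qed.
Let ss x y : (s x == s y) = (x == y). Proof. exact/inj_eq/osp_snd_inj. Qed.

(** An involution on the paired coordinates and zero on the unpaired one. It anticommutes with the
    Cartan elements, hence the weight vectors in 1 - iS. *)
Definition pair_swap : 'M[C]_N := \sum_x (delta_mx (f x) (s x) + delta_mx (s x) (f x)).
Local Notation S := pair_swap.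

Let mul_delta i j k l : delta_mx i j *m delta_mx k l = delta_mx i l *+ (j == k) :> 'M[C]_N.
Proof. exact: mul_delta_mx_cond. Qed.

Lemma swap_f x j : S *m delta_mx (f x) j = delta_mx (s x) j.
Proof.
rewrite mulmx_suml (bigD1 x) //= big1 => [|y yx]; rewrite mulmxDl !mul_delta sf ff add0r.
  by rewrite eqxx addr0.
by rewrite (negbTE yx).
Qed.

Lemma swap_s x j : S *m delta_mx (s x) j = delta_mx (f x) j.
Proof.
rewrite mulmx_suml (bigD1 x) //= big1 => [|y yx]; rewrite mulmxDl !mul_delta fs ss addr0.
  by rewrite eqxx addr0.
by rewrite (negbTE yx).
Qed.

Lemma swap_tr : S^T = S.
Proof.
rewrite linear_sum; apply: eq_bigr => x _ /=.
by rewrite linearD /= !trmx_delta addrC.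
Qed.

Lemma f_swap x i : delta_mx i (f x) *m S = delta_mx i (s x).
Proof. by apply: trmx_inj; rewrite trmx_mul swap_tr !trmx_delta swap_f. Qed.

Lemma s_swap x i : delta_mx i (s x) *m S = delta_mx i (f x).
Proof. by apply: trmx_inj; rewrite trmx_mul swap_tr !trmx_delta swap_s. Qed.

Lemma swap_comb c : S *m comb c = \sum_x (c x * 'i) *: (delta_mx (s x) (s x) - delta_mx (f x) (f x)).
Proof.
rewrite mulmx_sumr; apply: eq_bigr => x _.
by rewrite -!scalemxAr mulmxBr swap_f swap_s scalerA.
Qed.

Lemma swap_swap_comb c : S *m (S *m comb c) = comb c.
Proof.
rewrite swap_comb mulmx_sumr; apply: eq_bigr => x _.
by rewrite -scalemxAr mulmxBr swap_f swap_s scalerA.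
Qed.

Lemma comb_swap c : comb c *m S = - (S *m comb c).
Proof.
rewrite swap_comb mulmx_suml -sumrN; apply: eq_bigr => x _.
by rewrite -!scalemxAl mulmxBl f_swap s_swap scalerA -scalerN opprB.
Qed.

Lemma swap3 : S *m (S *m S) = S.
Proof.
rewrite {3 4}/pair_swap !mulmx_sumr; apply: eq_bigr => x _.
by rewrite !mulmxDr !swap_f !swap_s !swap_f.
Qed.

Let ii : 'i * 'i = -1 :> C. Proof. by rewrite -expr2 sqrCi. Qed.

(* The columns are weight vectors. *)
Definition weight_basis : 'M[C]_N := 1%:M - 'i *: S.
Local Notation V := weight_basis.

Lemma weight_basis_tr : V^T = V.
Proof. by rewrite /weight_basis linearB linearZ /= trmx1 swap_tr. Qed.

(** (1 - iS)(1 + iS) = 1 + S^2, and S^2 is an idempotent Q, so 1 + Q has inverse 1 - Q/2. *)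
Lemma weight_basis_unit : V \in unitmx.
Proof.
set Q := S *m S; have QQ : Q *m Q = Q by rewrite /Q -!mulmxA swap3.
have VQ : V *m (1%:M + 'i *: S) = 1%:M + Q.
  rewrite /weight_basis mulmxBl mul1mx mulmxDr mulmx1 -scalemxAl -scalemxAr scalerA ii.
  by rewrite opprD addrA addrK scaleN1r opprK.
suff /mulmx1_unit[//] : V *m ((1%:M + 'i *: S) *m (1%:M - 2^-1 *: Q)) = 1%:M.
rewrite mulmxA VQ mulmxBr mulmx1 mulmxDl mul1mx -scalemxAr QQ.
have half : 2^-1 *: Q + 2^-1 *: Q = Q.
  by rewrite -scalerDl -mulr2n -[_ *+ 2]mulr_natl divff ?scale1r // pnatr_eq0.
by rewrite half addrK.
Qed.

Definition weight_diag c : 'M[C]_N := 'i *: (S *m comb c).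

Lemma weight_diagE c i j : weight_diag c i j =
  (\sum_x c x * (pair_sign f s i x)%:~R) *+ (i == j).
Proof.
rewrite /weight_diag swap_comb scaler_sumr summxE -sumrMnl.
apply: eq_bigr => x _; rewrite scalerA mulrCA ii mulrN1 scaleNr -scalerN opprB !mxE.
rewrite /pair_sign rmorphB /= -mulrnAr; congr (_ * _).
case: (eqVneq i j) => [<-|ij]; first by rewrite !andbb mulr1n.
rewrite mulr0n; move: ij.
case: (i =P f x) => [->|_].
  by rewrite fs /= eq_sym => /negbTE->; rewrite subrr.
case: (i =P s x) => [->|_] /=; last by rewrite subrr.
by rewrite eq_sym => /negbTE->; rewrite subrr.
Qed.

(** S anticommutes with [comb c] and S^2 fixes it, so both sides equal [comb c] + i S [comb c]. *)
Lemma comb_weight_basis c : comb c *m V = V *m weight_diag c.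
Proof.
rewrite /weight_basis /weight_diag mulmxBr mulmxBl mulmx1 mul1mx -!scalemxAr -!scalemxAl.
by rewrite swap_swap_comb comb_swap scalerA ii scaleN1r opprK scalerN opprK addrC.
Qed.

Lemma weight_basis_comb c : V *m comb c = - (weight_diag c *m V).
Proof.
apply: trmx_inj; rewrite trmx_mul linearN /= trmx_mul weight_basis_tr.
have -> : (comb c)^T = - comb c.
  rewrite linear_sum -sumrN; apply: eq_bigr => x _; apply/matrixP => i j.
  rewrite !mxE -mulrN -mulrN opprB; congr (_ * (_ * _)).
  by rewrite ![(j == _) && _]andbC.
have -> : (weight_diag c)^T = weight_diag c.
  apply/matrixP => i j; rewrite mxE !weight_diagE eq_sym.
  by case: (eqVneq i j) => [->|] //.
by rewrite mulNmx comb_weight_basis.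
Qed.

Lemma weight_basis_even : mxpart false V = V.
Proof.
apply/matrixP => i j; rewrite mxpartEij addbF; case: ifPn => // ij.
have ij0 : (i == j) = false by apply/negbTE; apply: contra ij => /eqP->.
rewrite !mxE ij0 summxE big1 ?mulr0 ?subr0 // => x _; rewrite !mxE.
have fsb : (f x < m)%N = (s x < m)%N.
  by case: x => [k|a] /=; [rewrite (ltn_ord (ev k)) (ltn_ord (od k))|rewrite !ltnNge !leq_addr].
case: (i =P f x) (i =P s x) => [ei|_] [ei'|_]; rewrite ?addr0 ?add0r //=.
- by move/eqP: ei'; rewrite ei fs.
- by case: (j =P s x) => // ej; move: ij; rewrite ei ej fsb eqxx.
- by case: (j =P f x) => // ej; move: ij; rewrite ei' ej fsb eqxx.
Qed.

End OrthosymplecticDiagonalization.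

(** * Roots of osp(m|2n) *)

Section OrthosymplecticRoots.
Variables (C : numClosedFieldType) (m n : nat).
Local Notation N := (m + (n + n))%N.
Local Notation P := ('I_(m./2) + 'I_n)%type.
Local Notation f := (@osp_fst m n).
Local Notation s := (@osp_snd m n).
Local Notation Hx := (@osp_Hx C m n).
Local Notation comb := (@osp_comb C m n).
Local Notation S := (@pair_swap C m n).
Local Notation V := (@weight_basis C m n).
Local Notation U := (osp_space C m n).
Local Notation g := (osp_lieSuper C m n).
Local Notation h := (osp_cartan C m n).
Local Notation form := (@mx_form C m (n + n) U 2^-1 : g -> g -> C).
Implicit Types (x y : P) (i j k l : 'I_N) (c : P -> C) (H : subvs_of h) (X : g).

Let vs (X : g) : 'M[C]_N := vsval (X : subvs_of U).
Let vs_linear : linear vs.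
Proof. by move=> a X Y; rewrite /vs; exact: linearP. Qed.
Let vsU X : vs X \in U. Proof. exact: subvsP. Qed.
Let vs_inj X : vs X = 0 -> X = 0.
Proof. by move=> e; apply: val_inj; rewrite /= -/(vs X) e. Qed.

(** The Gram matrix of the bilinear form preserved by osp, not the matrix of a real form. For X in
    osp, JX is skew on the orthogonal block and symmetric elsewhere. *)
Definition osp_J : 'M[C]_N := block_mx 1%:M 0 0 (Omega C n).
Local Notation J := osp_J.

Lemma osp_J_even : mxpart false J = J.
Proof. by rewrite /mxpart /J block_mxKul block_mxKdr. Qed.

Lemma osp_J_unit : J \in unitmx.
Proof.
suff /mulmx1_unit[//] : J *m block_mx 1%:M 0 0 (- Omega C n) = 1%:M.
rewrite mulmx_block !(mul0mx, mulmx0, mul1mx, addr0, add0r) mulmxN Omega_sqr opprK.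
by rewrite -scalar_mx_block.
Qed.

Lemma osp_J_sym (X : 'M[C]_N) i j : X \in U ->
  (J *m X) i j = (if (i < m)%N && (j < m)%N then -1 else 1) * (J *m X) j i.
Proof.
rewrite -{1}[X]submxK => /osp_block[hA hC _ hD].
suff [hAC hD'] : (J *m X) = block_mx (ulsubmx X) (ursubmx X) (ursubmx X)^T (Omega C n *m drsubmx X)
    /\ (Omega C n *m drsubmx X)^T = Omega C n *m drsubmx X.
  rewrite hAC; case: (split_ordP i) => i' ->; case: (split_ordP j) => j' ->;
  rewrite ?(block_mxEul, block_mxEur, block_mxEdl, block_mxEdr) /= ?ltn_ord
    ?[(m + _ < m)%N]ltnNge ?leq_addr /= ?mul1r.
  - by have := congr1 (fun M : 'M_m => M j' i') hA; rewrite !mxE => ->; rewrite mulN1r.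
  - by rewrite [RHS]mxE.
  - by rewrite [LHS]mxE.
  - by have := congr1 (fun M : 'M_(n + n) => M j' i') hD'; rewrite mxE.
split.
  rewrite -{1}[X]submxK /J mulmx_block !(mul0mx, mulmx0, mul1mx, addr0, add0r) hC.
  by rewrite mulmxN mulmxA Omega_sqr mulNmx mul1mx opprK.
rewrite trmx_mul tr_Omega hD mulmxN -!mulmxA Omega_sqr !mulmxN mulmx1 opprK.
by [].
Qed.

Let J_rows (Y : 'M[C]_N) : J *m Y = col_mx (usubmx Y) (Omega C n *m dsubmx Y).
Proof. by rewrite -{1}[Y]vsubmxK mul_block_col !(mul0mx, mul1mx, addr0, add0r). Qed.

Let Omega_rows (D : 'M[C]_(n + n, N)) : Omega C n *m D = col_mx (dsubmx D) (- usubmx D).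
Proof.
by rewrite -{1}[D]vsubmxK mul_block_col !(mul0mx, mul1mx, mulNmx, addr0, add0r).
Qed.

Lemma J_row_l (Y : 'M[C]_N) (i : 'I_m) j : (J *m Y) (lshift (n + n) i) j = Y (lshift (n + n) i) j.
Proof. by rewrite J_rows col_mxEu mxE. Qed.

Lemma J_row_f (Y : 'M[C]_N) (a : 'I_n) j : (J *m Y) (f (inr a)) j = Y (s (inr a)) j.
Proof. by rewrite J_rows col_mxEd Omega_rows col_mxEu !mxE. Qed.

Lemma J_row_s (Y : 'M[C]_N) (a : 'I_n) j : (J *m Y) (s (inr a)) j = - Y (f (inr a)) j.
Proof. by rewrite J_rows col_mxEd Omega_rows col_mxEd !mxE. Qed.

Let cart (H : subvs_of h) : exists c, vs (vsval H) = comb c.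
Proof. exact/osp_cartanP/subvsP. Qed.

Let comb_even c : mxpart false (comb c) = comb c.
Proof.
rewrite /osp_comb linear_sum; apply: eq_bigr => x _.
rewrite linearZ; congr (_ *: _).
apply/matrixP => i j; rewrite mxpartEij addbF; case: ifPn => // ij; rewrite osp_HxE.
have fsb : (f x < m)%N = (s x < m)%N.
  by case: x => [k|a] /=; [rewrite (ltn_ord (ev k)) (ltn_ord (od k))|rewrite !ltnNge !leq_addr].
have [[ei ej]|n1] := altP (andP : reflect _ ((i == f x) && (j == s x))).
  by move: ij; rewrite (eqP ei) (eqP ej) fsb eqxx.
have [[ei ej]|n2] := altP (andP : reflect _ ((i == s x) && (j == f x))).
  by move: ij; rewrite (eqP ei) (eqP ej) fsb eqxx.
by rewrite subrr mulr0.
Qed.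

Let h_even : (h <= ls_part g false)%VS.
Proof.
apply/subvP => X /osp_cartanP[c hc]; rewrite sub_partE; apply/eqP.
by have := comb_even c; rewrite -hc.
Qed.

Let Hvec x : exists H : subvs_of h, vs (vsval H) = Hx x.
Proof.
have e : Hx x = comb (fun y => (x == y)%:R).
  rewrite /osp_comb (bigD1 x) //= eqxx scale1r big1 ?addr0 // => y yx.
  by rewrite eq_sym (negbTE yx) scale0r.
pose X : g := vsproj U (Hx x).
have vX : vs X = Hx x by rewrite /vs vsprojK // e osp_comb_in.
have hX : X \in h by apply/osp_cartanP; exists (fun y => (x == y)%:R); rewrite -e -vX.
by exists (vsproj h X); rewrite vsprojK.
Qed.

Let vs_br H X : vs (ls_br (vsval H) X) = vs (vsval H) *m vs X - vs X *m vs (vsval H).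
Proof.
have [c hc] := cart H.
by rewrite /vs sub_brE sbr_even // -/(vs _) hc comb_even.
Qed.

Let wt i : weight h := linfun (fun H : subvs_of h => ('i *: (S *m vs (vsval H))) i i : C^o).

Let wtE i H : wt i H = ('i *: (S *m vs (vsval H))) i i.
Proof.
rewrite linfun_apply // => a H1 H2.
have -> : vs (vsval (a *: H1 + H2)) = a *: vs (vsval H1) + vs (vsval H2).
  by rewrite -vs_linear; congr vs; exact: linearP.
rewrite mulmxDr -scalemxAr scalerDr scalerA mulrC -scalerA.
by rewrite [LHS]mxE [X in X + _]mxE.
Qed.

Let wt_comb i H c : vs (vsval H) = comb c ->
  wt i H = \sum_x c x * (pair_sign f s i x)%:~R.
Proof. by move=> hc; rewrite wtE hc -[LHS]/(weight_diag c i i) weight_diagE eqxx. Qed.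

Let wt_Hx i H x : vs (vsval H) = Hx x -> wt i H = (pair_sign f s i x)%:~R.
Proof.
move=> hc; rewrite (@wt_comb _ _ (fun y => (x == y)%:R)).
  rewrite (bigD1 x) //= eqxx mul1r big1 ?addr0 // => y yx.
  by rewrite eq_sym (negbTE yx) mul0r.
rewrite hc /osp_comb (bigD1 x) //= eqxx scale1r big1 ?addr0 // => y yx.
by rewrite eq_sym (negbTE yx) scale0r.
Qed.

Let theta i j : weight h := - (wt i + wt j).
(** The matrix of u^T J X v in the weight basis, V being symmetric. Unlike the conjugate of X by V,
    it is symmetric up to signs, so the positions (i, j) and (j, i) of equal weight carry the same
    information. *)
Let Phi (X : g) : 'M[C]_N := V *m (J *m vs X) *m V.

Let Phi_linear : linear Phi.
Proof.
move=> a X Y; rewrite /Phi vs_linear (mulmxDr J) (mulmxDr V) (mulmxDl _ _ V).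
by rewrite -!scalemxAr -scalemxAl.
Qed.

Let Phi_inj X : Phi X = 0 -> X = 0.
Proof.
move=> e; apply: vs_inj; have uV := weight_basis_unit C m n.
have := congr1 (fun M => invmx J *m (invmx V *m M *m invmx V)) e.
by rewrite mulmx0 mul0mx mulmx0 /Phi -!mulmxA mulmxV // mulmx1 mulKmx // mulKmx ?osp_J_unit.
Qed.

(** A Cartan element is a skew matrix, and for a skew block D the condition D^T = Omega D Omega says
    that D commutes with Omega. *)
Let J_comb c : J *m comb c = comb c *m J.
Proof.
have tr_comb : (comb c)^T = - comb c.
  rewrite linear_sum -sumrN; apply: eq_bigr => x _; apply/matrixP => i j.
  rewrite !mxE -mulrN -mulrN opprB; congr (_ * (_ * _)).
  by rewrite ![(j == _) && _]andbC.
have := osp_comb_in c; rewrite -{1}[comb c]submxK => /osp_block[hA hC _ hD].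
have e := comb_even c; rewrite /mxpart in e.
have trE : (comb c)^T = block_mx (- ulsubmx (comb c)) 0 0 (Omega C n *m drsubmx (comb c) *m Omega C n).
  by rewrite -{1}e tr_block_mx !trmx0 hA hD.
have := congr1 (@drsubmx _ _ _ _ _) tr_comb; rewrite trE block_mxKdr => hD2.
have drN : drsubmx (- comb c) = - drsubmx (comb c) by apply/matrixP => i j; rewrite !mxE.
rewrite drN in hD2.
rewrite -e /J !mulmx_block !(mul0mx, mulmx0, mul1mx, mulmx1, addr0, add0r); congr block_mx.
have := congr1 (fun M => M *m Omega C n) hD2.
by rewrite -mulmxA Omega_sqr mulmxN mulmx1 mulNmx => /oppr_inj.
Qed.

(** J commutes with H, and V diagonalizes H from the right and, up to sign, from the left. *)
Let Phi_weight (H : subvs_of h) X i j : Phi (ls_br (vsval H) X) i j = theta i j H * Phi X i j.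
Proof.
have [c hc] := cart H.
have -> : Phi (ls_br (vsval H) X) = - (weight_diag c *m Phi X + Phi X *m weight_diag c).
  rewrite /Phi vs_br hc (mulmxBr J) (mulmxBr V) (mulmxBl _ _ V) [in RHS]opprD; congr (_ - _).
    by rewrite (mulmxA J) J_comb -(mulmxA (comb c)) (mulmxA V (comb c)) weight_basis_comb !mulNmx !mulmxA.
  by rewrite !mulmxA -(mulmxA _ (comb c) V) comb_weight_basis !mulmxA.
have dE : weight_diag c = diag_mx (\row_k wt k H).
  apply/matrixP => k l; rewrite weight_diagE !mxE (wt_comb k hc).
  by case: eqP.
rewrite dE mul_diag_mx mul_mx_diag !mxE /theta opp_lfunE add_lfunE mulNr mulrDl.
by rewrite [X in _ + X]mulrC.
Qed.

Let V_block i j : V i j != 0 -> (i < m)%N = (j < m)%N.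
Proof.
rewrite -{1}weight_basis_even mxpartEij addbF.
by case: ((i < m)%N =P (j < m)%N) => //; rewrite eqxx.
Qed.

Let Phi_sym X i j :
  Phi X i j = (if (i < m)%N && (j < m)%N then -1 else 1) * Phi X j i.
Proof.
have E Y k l : (V *m Y *m V) k l = \sum_a \sum_b V k a * Y a b * V b l.
  rewrite mxE exchange_big; apply: eq_bigr => b _ /=; rewrite mxE mulr_suml.
  by [].
rewrite /Phi !E [in RHS]exchange_big mulr_sumr; apply: eq_bigr => a _ /=.
rewrite mulr_sumr; apply: eq_bigr => b _.
have Vsym k l : V k l = V l k by rewrite -{1}(weight_basis_tr C m n) mxE.
rewrite (Vsym j b) (Vsym a i).
have [->|nza] := eqVneq (V i a) 0; first by rewrite !(mul0r, mulr0).
have [->|nzb] := eqVneq (V b j) 0; first by rewrite !(mul0r, mulr0).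
rewrite (V_block nza) -(V_block nzb) (osp_J_sym a b (vsU X)).
move: (V i a) (V b j) ((J *m vs X) b a) (if _ then _ else _) => p q r t.
by rewrite mulrCA mulrA mulrAC -!mulrA [q * _]mulrC -mulrA mulrCA.
Qed.

Let theta_Hx i j H x : vs (vsval H) = Hx x ->
  theta i j H = - (pair_sign f s i x + pair_sign f s j x)%:~R :> C.
Proof.
move=> e; rewrite /theta opp_lfunE add_lfunE !(wt_Hx _ e).
by rewrite intrD.
Qed.

Let theta_sum i j H c : vs (vsval H) = comb c ->
  theta i j H = - \sum_x c x * (pair_sign f s i x + pair_sign f s j x)%:~R :> C.
Proof.
move=> e; rewrite /theta opp_lfunE add_lfunE !(wt_comb _ e) -big_split; congr (- _).
by apply: eq_bigr => x _; rewrite intrD mulrDr.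
Qed.

Let theta_eq_sign i j k l x : theta i j = theta k l ->
  pair_sign f s i x + pair_sign f s j x = pair_sign f s k x + pair_sign f s l x.
Proof.
move=> e; have [H hH] := Hvec x; have := congr1 (fun t : weight h => t H : C) e.
by rewrite /= !(theta_Hx _ _ hH) => /oppr_inj /intr_inj.
Qed.

Let theta0_sign i j x : theta i j = 0 -> pair_sign f s i x + pair_sign f s j x = 0.
Proof.
move=> e; have [H hH] := Hvec x; have := congr1 (fun t : weight h => t H : C) e.
by rewrite /= (theta_Hx _ _ hH) zero_lfunE => /eqP; rewrite oppr_eq0 intr_eq0 => /eqP.
Qed.

Let theta_neq0_sign i j : theta i j != 0 ->
  exists x, pair_sign f s i x + pair_sign f s j x != 0.
Proof.
move=> nz; apply/existsP; apply: contraNT nz => /existsPn h0; apply/eqP/lfunP => H.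
have [c hc] := cart H; rewrite (theta_sum _ _ hc) zero_lfunE big1 ?oppr0 // => x _.
by have := h0 x; rewrite negbK => /eqP->; rewrite mulr0.
Qed.

Let f_inj : injective f := @osp_fst_inj m n.
Let s_inj : injective s := @osp_snd_inj m n.
Let fs_ne x y : f x != s y := osp_fst_snd x y.
Let out_uniq := @osp_outside_unique m n.

Let theta_inj X i j k l : theta i j = theta k l -> theta i j != 0 ->
  Phi X k l = 0 -> Phi X i j = 0.
Proof.
move=> e nz z.
have [[-> ->]//|[-> ->]] := pair_sign_sum f_inj s_inj fs_ne out_uniq
  (fun x => theta_eq_sign x e) (theta_neq0_sign nz).
by rewrite Phi_sym z mulr0.
Qed.

Let zero_weight_comm X H : (forall i j, Phi X i j != 0 -> theta i j = 0) ->
  ls_br (vsval H) X = 0.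
Proof.
move=> h0; apply: Phi_inj; apply/matrixP => i j; rewrite Phi_weight [RHS]mxE.
have [->|nz] := eqVneq (Phi X i j) 0; first by rewrite mulr0.
by rewrite (h0 _ _ nz) zero_lfunE mul0r.
Qed.

Let zero_even X : X \in ls_part g false ->
  (forall i j, Phi X i j != 0 -> theta i j = 0) -> X \in h.
Proof.
move=> hX h0; apply/osp_cartanP; set Y := vs X.
(* The entry (i, j) of [H_x, X] = 0, divided by the imaginary unit in H_x. *)
have comm x i j : ((i == f x)%:R * Y (s x) j - (i == s x)%:R * Y (f x) j =
    Y i (f x) * (j == s x)%:R - Y i (s x) * (j == f x)%:R :> C).
  have [H hH] := Hvec x; have := congr1 vs (zero_weight_comm H h0).
  rewrite vs_br hH -/Y -[vs 0]/(0 : 'M[C]_N) => /eqP; rewrite subr_eq0 => /eqP e.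
  have nzi : ('i : C) != 0 by apply: neq0Ci.
  have de k l : (delta_mx k l *m Y) i j = (i == k)%:R * Y l j.
    rewrite mxE (bigD1 l) //= mxE eqxx andbT big1 ?addr0 // => a al.
    by rewrite mxE (negbTE al) andbF mul0r.
  have ed k l : (Y *m delta_mx k l) i j = Y i k * (j == l)%:R.
    rewrite mxE (bigD1 k) //= mxE eqxx big1 ?addr0 // => a al.
    by rewrite mxE (negbTE al) mulr0.
  have := congr1 (fun M : 'M_N => M i j) e.
  rewrite /osp_Hx -scalemxAl -scalemxAr mulmxBl mulmxBr.
  rewrite [LHS]mxE [RHS]mxE => /(mulfI nzi).
  by rewrite [LHS]mxE [RHS]mxE [X in _ + X = _]mxE [X in _ = _ + X]mxE !de !ed.
have z (u : C) : u = - u -> u = 0.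
  by move/eqP; rewrite -addr_eq0 -mulr2n mulrn_eq0 /= => /eqP.
(* Commutation makes the two diagonal entries of a pair equal, whereas membership in osp makes them
   zero in the orthogonal block and opposite in the symplectic one. *)
have diag x : Y (f x) (f x) = 0 /\ Y (s x) (s x) = 0.
  have := comm x (f x) (s x).
  rewrite !eqxx (negbTE (fs_ne x x)) eq_sym (negbTE (fs_ne x x)).
  rewrite !mul1r !mul0r !mulr1 !mulr0 !subr0 => e.
  suff e' : Y (s x) (s x) = - Y (f x) (f x).
    suff : Y (f x) (f x) = 0 by rewrite -e => ->.
    by apply: z; rewrite -{1}e e'.
  case: x e => [k|a] /= e.
    have h1 := osp_J_sym (f (inl k)) (f (inl k)) (vsU X).
    have h2 := osp_J_sym (s (inl k)) (s (inl k)) (vsU X).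
    move: h1 h2; rewrite /= (ltn_ord (ev k)) (ltn_ord (od k)) /= -/Y !J_row_l !mulN1r.
    by move=> /z -> /z ->; rewrite oppr0.
  have := osp_J_sym (f (inr a)) (s (inr a)) (vsU X).
  by rewrite /= ltnNge leq_addr /= mul1r -/Y (J_row_f Y a) (J_row_s Y a).
(* The entry of H_x at its pair is the imaginary unit, which fixes the coefficients. *)
exists (fun x => - 'i * Y (f x) (s x)); apply/matrixP => i j.
rewrite /osp_comb summxE.
have termE x : ((- 'i * Y (f x) (s x)) *: Hx x) i j =
    Y (f x) (s x) * (((i == f x) && (j == s x))%:R - ((i == s x) && (j == f x))%:R).
  by rewrite mxE osp_HxE mulrACA mulNr -expr2 sqrCi opprK mul1r.
under eq_bigr do rewrite termE.
case: (pair_spec f s i) => [[x ->]|[x ->]|[hf hs]].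
- rewrite (bigD1 x) //= eqxx (negbTE (fs_ne x x)) subr0 big1 => [|y yx]; last first.
    by rewrite (inj_eq f_inj) eq_sym (negbTE yx) (negbTE (fs_ne x y)) subrr mulr0.
  rewrite addr0 /=; have := comm x (s x) j.
  rewrite eqxx eq_sym (negbTE (fs_ne x x)) mul0r mul1r sub0r (diag x).2 mul0r subr0.
  have [->|js] := eqVneq j (s x); first by move=> _; rewrite mulr1.
  by rewrite !mulr0 => /eqP; rewrite oppr_eq0 => /eqP.
- rewrite (bigD1 x) //= eqxx eq_sym (negbTE (fs_ne x x)) sub0r big1 => [|y yx]; last first.
    by rewrite (inj_eq s_inj) [x == y]eq_sym (negbTE yx) eq_sym (negbTE (fs_ne y x)) subrr mulr0.
  rewrite addr0 /=; have := comm x (f x) j.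
  rewrite eqxx (negbTE (fs_ne x x)) mul0r mul1r subr0 (diag x).1 mul0r sub0r.
  by move=> ->; rewrite mulrN.
rewrite big1 => [|y _]; last by rewrite (negbTE (hf y)) (negbTE (hs y)) subrr mulr0.
case: (pair_spec f s j) => [[y ->]|[y ->]|[hf' hs']].
- have := comm y i (s y); rewrite (negbTE (hf y)) (negbTE (hs y)) !mul0r subr0 eqxx.
  by rewrite eq_sym (negbTE (fs_ne y y)) mulr1 mulr0 subr0 => <-.
- have := comm y i (f y); rewrite (negbTE (hf y)) (negbTE (hs y)) !mul0r subr0 eqxx.
  by rewrite (negbTE (fs_ne y y)) mulr1 mulr0 sub0r => /eqP; rewrite eq_sym oppr_eq0 => /eqP.
(* Both indices are the unpaired one, whose diagonal entry vanishes by skewness of the orthogonal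
   block. *)
have -> : j = i by apply: out_uniq.
have /andP[im _] := osp_outside hf hs.
have := osp_J_sym i i (vsU X); rewrite im /= -/Y mulN1r.
by case: (split_ordP i) im => i' -> // _; rewrite J_row_l => /z.
Qed.

(** Weight 0 at an entry (i, j) forces a paired index to face its partner. Every symplectic index is
    paired within the symplectic block, so it cannot face an orthogonal one. *)
Let zero_odd X : X \in ls_part g true ->
  (forall i j, Phi X i j != 0 -> theta i j = 0) -> X = 0.
Proof.
rewrite sub_partE => /eqP hX h0; apply: Phi_inj; apply/matrixP => i j; rewrite [RHS]mxE.
have Phi_odd : mxpart true (Phi X) = Phi X.
  apply: (@mxpart_mul _ _ _ true false); last exact: weight_basis_even.
  apply: (@mxpart_mul _ _ _ false true); first exact: weight_basis_even.
  by apply: (@mxpart_mul _ _ _ false true); first exact: osp_J_even.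
apply/eqP; apply: contraT => nz; have th := h0 _ _ nz.
have : (i < m)%N != (j < m)%N.
  move: nz; rewrite -Phi_odd mxpartEij.
  by case: ((i < m)%N =P (j < m)%N) => //= _; rewrite eqxx.
have low x : (m <= f x)%N = (m <= s x)%N.
  case: x => [k|a] /=; last by rewrite !leq_addr.
  by rewrite leqNgt (ltn_ord (ev k)) leqNgt (ltn_ord (od k)).
have key k l : (forall x, pair_sign f s k x + pair_sign f s l x = 0) ->
    (k < m)%N -> (m <= l)%N -> False.
  move=> e km ml; case: (pair_spec f s l) => [[x lx]|[x lx]|[hf hs]].
  - have [h1 _] := pair_sign_opp f_inj s_inj fs_ne (e x).
    by move: km; rewrite (h1 lx) ltnNge -low -lx ml.
  - have [_ h1] := pair_sign_opp f_inj s_inj fs_ne (e x).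
    by move: km; rewrite (h1 lx) ltnNge low -lx ml.
  by have /andP[] := osp_outside hf hs; rewrite ltnNge ml.
case: (ltnP i m) => hi; case: (ltnP j m) => hj // _; exfalso.
  by apply: (key i j) => // x; apply: theta0_sign.
by apply: (key j i) => // x; rewrite addrC; apply: theta0_sign.
Qed.

Let nondeg X : X \in ls_part g false ->
  (forall Y : g, Y \in ls_part g false -> form X Y = 0) -> X = 0.
Proof.
rewrite sub_partE => /eqP hX h0; apply: vs_inj.
have [hA _ _ hD] : [/\ (ulsubmx (vs X))^T = - ulsubmx (vs X),
    dlsubmx (vs X) = - (Omega C n *m (ursubmx (vs X))^T),
    (dlsubmx (vs X))^T = ursubmx (vs X) *m Omega C n
    & (drsubmx (vs X))^T = Omega C n *m drsubmx (vs X) *m Omega C n].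
  by apply: osp_block; rewrite submxK.
have eX : vs X = block_mx (ulsubmx (vs X)) 0 0 (drsubmx (vs X)) by rewrite -[LHS]hX.
set A := ulsubmx (vs X) in hA eX; set D := drsubmx (vs X) in hD eX.
(* Arbitrary blocks Z1 and Z2 are projected to osp up to a factor 2. By the symmetries of A and D
   the pairing with the projection is twice the pairing with the blocks, so all matrices may be used
   as tests. *)
have sub_str Z1 Z2 : \tr (A *m Z1) - \tr (D *m Z2) = 0.
  pose Y := block_mx (Z1 - Z1^T) 0 0 (Z2 + Omega C n *m Z2^T *m Omega C n).
  have YU : Y \in U.
    apply/osp_spaceP; rewrite /Y !(block_mxKul, block_mxKur, block_mxKdl, block_mxKdr).
    split; rewrite ?trmx0 ?mulmx0 ?oppr0 //.
      by rewrite linearB /= trmxK opprB.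
    have -> : (Z2 + Omega C n *m Z2^T *m Omega C n)^T = Z2^T + Omega C n *m Z2 *m Omega C n.
      by rewrite linearD /= !trmx_mul trmxK tr_Omega mulNmx !mulmxN opprK mulmxA.
    rewrite mulmxDr mulmxDl addrC; congr (_ + _); rewrite !mulmxA Omega_sqr !mulNmx mul1mx.
    by rewrite -mulmxA Omega_sqr mulmxN mulmx1 opprK.
  have := h0 (vsproj U Y); rewrite sub_partE /mx_form vsprojK // -/(vs X) => h.
  have /h /eqP : mxpart false Y == Y.
    by rewrite /mxpart /Y block_mxKul block_mxKdr.
  rewrite mulf_eq0 invr_eq0 pnatr_eq0 /= eX /Y mulmx_block !(mul0mx, mulmx0, addr0, add0r).
  rewrite /str block_mxKul block_mxKdr mulmxBr mulmxDr !linearD linearN /=.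
  have -> : \tr (A *m Z1^T) = - \tr (A *m Z1).
    by rewrite -mxtrace_tr trmx_mul trmxK hA mulmxN linearN /= mxtrace_mulC.
  have -> : \tr (D *m (Omega C n *m Z2^T *m Omega C n)) = \tr (D *m Z2).
    by rewrite mulmxA mxtrace_mulC !mulmxA -hD -trmx_mul mxtrace_tr mxtrace_mulC.
  by rewrite opprK opprD addrACA -mulr2n mulrn_eq0 /= => /eqP.
clearbody A D; have A0 : A = 0.
  apply/matrixP => i j; have := sub_str (delta_mx j i) 0.
  rewrite mulmx0 mxtrace0 subr0 /mxtrace (bigD1 i) //= big1 => [|k ki].
    rewrite addr0 mxE (bigD1 j) //= !mxE !eqxx mulr1 big1 ?addr0 => [->//|l lj].
    by rewrite mxE (negbTE lj) mulr0.
  by rewrite mxE big1 // => l _; rewrite mxE (negbTE ki) andbF mulr0.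
have D0 : D = 0.
  apply/matrixP => i j; have := sub_str 0 (delta_mx j i).
  rewrite mulmx0 mxtrace0 sub0r /mxtrace (bigD1 i) //= big1 => [|k ki].
    rewrite addr0 mxE (bigD1 j) //= !mxE !eqxx mulr1 big1 ?addr0 => [/eqP|l lj].
      by rewrite oppr_eq0 => /eqP.
    by rewrite mxE (negbTE lj) mulr0.
  by rewrite mxE big1 // => l _; rewrite mxE (negbTE ki) andbF mulr0.
by rewrite eX A0 D0 block_mx0.
Qed.

Lemma osp_root_structure : root_structure form h.
Proof.
apply: (weight_model_root_structure h_even Phi_linear Phi_inj Phi_weight theta_inj
  (supertrace_form_invariant _ _ _) nondeg _ zero_even zero_odd) => H H'.
apply: vs_inj; rewrite vs_br.
have [c ->] := cart H; have [c' ->] := cart H'.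
have uV := weight_basis_unit C m n.
have e b : comb b = V *m weight_diag b *m invmx V by rewrite -comb_weight_basis mulmxK.
have dC : weight_diag c *m weight_diag c' = weight_diag c' *m weight_diag c :> 'M[C]_N.
  have dE b : weight_diag b = diag_mx (\row_k weight_diag b k k) :> 'M[C]_N.
    apply/matrixP => k l; rewrite [RHS]mxE [in RHS]mxE.
    by case: eqP => [->//|/eqP kl]; rewrite weight_diagE (negbTE kl).
  by rewrite (dE c) (dE c') !mulmx_diag; congr diag_mx; apply/rowP => i; rewrite !mxE mulrC.
rewrite (e c) (e c') !mulmxA !mulmxKV // -!(mulmxA V) dC subrr.
by [].
Qed.

End OrthosymplecticRoots.

(** * F(4) *)

Section SuperTraceForm.
Variables (C : numClosedFieldType) (g : lieSuper C).
Implicit Types (X Y Z : g) (f k : 'End(g)).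
Local Notation tr := (@endo_trace C g).
Let pi0 : 'End(g) := daddv_pi (ls_part g false) (ls_part g true).
Let pi1 : 'End(g) := daddv_pi (ls_part g true) (ls_part g false).
Let S : 'End(g) := pi0 - pi1.
Let ad X : 'End(g) := linfun (ls_br X).

Let adE X Y : ad X Y = ls_br X Y. Proof. by rewrite lfunE. Qed.

Let trD a f k : tr (a *: f + k) = a * tr f + tr k.
Proof.
rewrite /endo_trace mulr_sumr -big_split; apply: eq_bigr => i _ /=.
by rewrite add_lfunE scale_lfunE linearP.
Qed.

Let trZ a f : tr (a *: f) = a * tr f.
Proof.
have tr0 : tr 0 = 0.
  by rewrite /endo_trace big1 // => i _; rewrite zero_lfunE linear0.
by rewrite -[a *: f]addr0 trD tr0 addr0.
Qed.

Let trC f k : tr (f \o k)%VF = tr (k \o f)%VF.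
Proof.
pose b := vbasis {:g}.
have trE f' k' : tr (f' \o k')%VF = \sum_(i < \dim {:g}) \sum_(j < \dim {:g}) coord b j (k' b`_i) * coord b i (f' b`_j).
  apply: eq_bigr => i _; rewrite comp_lfunE {1}(coord_vbasis (memvf (k' b`_i))).
  by rewrite !linear_sum; apply: eq_bigr => j _; rewrite !linearZ.
rewrite !trE exchange_big; apply: eq_bigr => i _; apply: eq_bigr => j _.
by rewrite mulrC.
Qed.

Let S_part z X : X \in ls_part g z -> S X = (-1) ^+ z *: X.
Proof.
move=> hX; rewrite add_lfunE opp_lfunE.
case: z hX => hX; rewrite ?expr1 ?expr0 ?scale1r ?scaleN1r.
  have e : pi1 X = X by apply: daddv_pi_id; rewrite // capvC ls_partI.
  have := daddv_pi_add (ls_partI g) (w := X); rewrite ls_partD memvf => /(_ isT).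
  rewrite -/pi0 -/pi1 e => /(canRL (addrK _)) ->.
  by rewrite subrr sub0r.
have e : pi0 X = X by apply: daddv_pi_id; rewrite // ls_partI.
have := daddv_pi_add (ls_partI g) (w := X); rewrite ls_partD memvf => /(_ isT).
rewrite -/pi0 -/pi1 e => /(canRL (addKr _)) ->.
by rewrite addNr subr0.
Qed.

Let lfun_part_ext f k : (forall z X, X \in ls_part g z -> f X = k X) -> f = k.
Proof.
move=> h; apply/lfunP; apply: lie_cases => [X Y e1 e2|z X hX]; last exact: h hX.
by rewrite !linearD /= e1 e2.
Qed.

Let adS a X : X \in ls_part g a -> (ad X \o S = (-1) ^+ a *: (S \o ad X))%VF.
Proof.
move=> hX; apply: lfun_part_ext => z Y hY.
rewrite comp_lfunE scale_lfunE comp_lfunE (S_part hY) !adE (S_part (ls_br_part hX hY)).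
by rewrite brZr scalerA signr_addb mulrA -expr2 sqrr_sign mul1r.
Qed.

Let ad_br a b X Y : X \in ls_part g a -> Y \in ls_part g b ->
  (ad (ls_br X Y) = ad X \o ad Y - (-1) ^+ (a && b) *: (ad Y \o ad X))%VF.
Proof.
move=> hX hY; apply/lfunP => Z; rewrite add_lfunE opp_lfunE scale_lfunE !comp_lfunE !adE.
by rewrite (ls_jacobi Z hX hY) addrK.
Qed.

Let form_E X Y : F4_form X Y = 6^-1 * tr (S \o (ad X \o ad Y))%VF.
Proof. by []. Qed.

Let ad_linear a X Y : ad (a *: X + Y) = a *: ad X + ad Y.
Proof. by apply/lfunP => Z; rewrite add_lfunE scale_lfunE !adE ls_brDl. Qed.

Let shift b X f : X \in ls_part g b ->
  tr (S \o (f \o ad X))%VF = (-1) ^+ b * tr (S \o (ad X \o f))%VF.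
Proof.
by move=> hX; rewrite comp_lfunA trC comp_lfunA (adS hX) -comp_lfunZl trZ comp_lfunA.
Qed.

Let odd_trace f : (f \o S = - (S \o f))%VF -> tr (S \o f)%VF = 0.
Proof.
move=> e; have h : tr (S \o f)%VF = - tr (S \o f)%VF.
  by rewrite {1}trC e -scaleN1r trZ mulN1r.
apply/eqP; move/eqP: h; rewrite -addr_eq0 -mulr2n -mulr_natr mulf_eq0 => /orP[//|].
by rewrite pnatr_eq0.
Qed.

Lemma F4_form_invariant : invariant_form (@F4_form C g).
Proof.
have fDl Y : linear (fun X => F4_form X Y : C^o).
  move=> a X X'; rewrite !form_E ad_linear.
  rewrite (comp_lfunDl (a *: ad X)) comp_lfunDr -(comp_lfunZl a (ad X)) -comp_lfunZr trD.
  rewrite mulrDr mulrCA.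
  by [].
have fDr X : linear (F4_form X : g -> C^o).
  move=> a Y Y'; rewrite !form_E ad_linear.
  rewrite comp_lfunDr comp_lfunDr -comp_lfunZr -comp_lfunZr trD mulrDr mulrCA.
  by [].
have fDl1 X X' Y : F4_form (X + X') Y = F4_form X Y + F4_form X' Y.
  by have := fDl Y 1 X X'; rewrite !scale1r.
have fDr1 X Y Y' : F4_form X (Y + Y') = F4_form X Y + F4_form X Y'.
  by have := fDr X 1 Y Y'; rewrite !scale1r.
split=> //.
- move=> z X Y hX hY; rewrite form_E odd_trace ?mulr0 //.
  rewrite -comp_lfunA (adS hY) -comp_lfunZr (comp_lfunA (ad X) S) (adS hX) -comp_lfunZl scalerA.
  by case: z {hX hY}; rewrite ?expr0 ?expr1 ?mul1r ?mulr1 scaleN1r comp_lfunA.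
- by move=> z X Y hX hY; rewrite !form_E (shift _ hY) mulrCA.
- apply: lie_cases => [X X' e1 e2 Y Z|a X hX].
    by rewrite brDl !fDl1 e1 e2.
  apply: lie_cases => [Y Y' e1 e2 Z|b Y hY].
    by rewrite brDl brDr fDl1 fDr1 e1 e2.
  apply: lie_cases => [Z Z' e1 e2|c Z hZ]; first by rewrite brDr !fDr1 e1 e2.
  rewrite !form_E (ad_br hX hY) (ad_br hY hZ); congr (_ * _).
  have compBl f1 f2 c' f3 : ((f1 - c' *: f2) \o f3 = f1 \o f3 - c' *: (f2 \o f3))%VF.
    by rewrite -!scaleNr comp_lfunDl -comp_lfunZl.
  have compBr f1 f2 c' f3 : (f3 \o (f1 - c' *: f2) = f3 \o f1 - c' *: (f3 \o f2))%VF.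
    by rewrite -!scaleNr comp_lfunDr -comp_lfunZr.
  have trB c' f1 f2 : tr (f1 - c' *: f2) = tr f1 - c' * tr f2.
    by rewrite addrC -scaleNr trD addrC mulNr.
  rewrite compBl !compBr !trB.
  have -> : tr (S \o (ad X \o (ad Z \o ad Y)))%VF
      = (-1) ^+ b * tr (S \o (ad Y \o ad X \o ad Z))%VF.
    by rewrite (comp_lfunA (ad X) (ad Z)) (shift _ hY) (comp_lfunA (ad Y)).
  rewrite mulrA (comp_lfunA (ad X)); congr (_ - _).
  (* A product of odd total parity has supertrace zero, and in the even case the two signs agree. *)
  have odd0 : a (+) b (+) c -> tr (S \o (ad Y \o ad X \o ad Z))%VF = 0.
    move=> odd; apply: odd_trace.
    rewrite -!comp_lfunA (adS hZ) -!comp_lfunZr.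
    rewrite (comp_lfunA (ad X) S) (adS hX) -comp_lfunZl -comp_lfunZr.
    rewrite !comp_lfunA (adS hY) -!comp_lfunZl !scalerA -scaleN1r; congr (_ *: _).
    by move: odd; clear; case: a b c => -[] [] // _; rewrite ?(expr0, expr1) ?mulrNN ?(mul1r, mulr1).
  move: odd0; case: a b c {hX hY hZ} => -[] [] /= odd0;
    first [by rewrite odd0 // !mulr0 | by rewrite ?(expr0, expr1) ?mulrNN ?(mul1r, mulr1)].
Qed.
End SuperTraceForm.

(** * The Cartan subalgebra of F(4) *)

Section F4Cartan.
Variables (C : numClosedFieldType) (g : lieSuper C) (omega : g -> g) (h : {vspace g}).
Hypothesis cartan : F4_cartan omega h.
Implicit Types X Y : g.

Lemma F4_cartan_even : (h <= ls_part g false)%VS.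
Proof.
have [K [T [[[_ KU _] _] [_ TK _ _] hT]]] := cartan.
apply/subvP => X /hT[Y [Z [TY TZ ->]]].
by have [Y0 _] := KU _ (TK _ TY); have [Z0 _] := KU _ (TK _ TZ); rewrite rpredD ?memvZ.
Qed.

(* For an invariant inner product, ad X is skew, so (ad X)^2 W = 0 forces ad X W = 0. *)
Lemma F4_cartan_abelian X Y : X \in h -> Y \in h -> ls_br X Y = 0.
Proof.
have [K [T [[[_ KU [ip [_ ipD ip0 ip_skew]]] _] [[_ _ Tbr] TK [n nil] _] hT]]] := cartan.
have TU W : T W -> real_even omega W by move/TK/KU.
have ip0l U W : real_even omega U -> real_even omega W -> ip 0 W = 0.
  move=> hU hW; have r1 : (-1 : C) \is Num.real by rewrite rpredN rpred1.
  by have := ipD (-1) U U W r1 hU hU hW; rewrite scaleN1r addNr mulN1r addNr.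
have step k U W : T U -> T W -> iter k.+1 (ls_br U) W = 0 -> ls_br U W = 0.
  move=> TUU; elim: k W => [//|k IH] W TW; rewrite iterSr => /(IH _ (Tbr _ _ TUU TW)) e.
  apply/eqP; apply: contraT => /(ip0 _ (TU _ (Tbr _ _ TUU TW))).
  have := ip_skew _ (ls_br U W) W (TK _ TUU) (TU _ (Tbr _ _ TUU TW)) (TU _ TW).
  rewrite e (ip0l W W (TU _ TW) (TU _ TW)) => /eqP; rewrite eq_sym oppr_eq0 => /eqP e'.
  by rewrite {1}e' ltxx.
have ab U W : T U -> T W -> ls_br U W = 0.
  move=> TUU TW; apply: (step n) => //.
  have /= := nil [tuple of nseq n U] W; rewrite -[foldr _ _ _]/(foldr _ _ _).
  have -> : foldr (@ls_br _ g) W (nseq n U) = iter n (ls_br U) W by elim: (n) => //= k ->.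
  by move=> -> //; [rewrite br0r | move=> i; rewrite (tnth_nth 0) nth_nseq ltn_ord].
move=> /hT[X1 [X2 [T1 T2 ->]]] /hT[Y1 [Y2 [U1 U2 ->]]].
by rewrite !brDl !brDr !brZl !brZr !ab // !scaler0 !addr0.
Qed.

End F4Cartan.

Section WeightSums.
Variables (C : numClosedFieldType) (g : lieSuper C) (h : {vspace g}).
Hypothesis h_even : (h <= ls_part g false)%VS.
Implicit Types (X Y : g) (H : subvs_of h) (w : weight h).

Lemma weight_sum_stable z (ws : seq (weight h)) H X :
  X \in (\sum_(w <- ws) rootsp z w)%VS -> ls_br (vsval H) X \in (\sum_(w <- ws) rootsp z w)%VS.
Proof.
move=> hX; suff : (\sum_(w <- ws) rootsp z w <=
    linfun (ls_br (vsval H)) @^-1: \sum_(w <- ws) rootsp z w)%VS.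
  by move/subvP/(_ _ hX); rewrite -memv_preim lfunE.
apply: sumv_seq_sub => w hw; apply/subvP => Y hY; rewrite -memv_preim lfunE /=.
rewrite (rootspE H hY) memvZ //.
exact: subvP (sumv_seq_sup (fun w => rootsp z w) hw) _ hY.
Qed.

(** For H separating w from w1, ad H - w1(H) scales a vector of weight w by a nonzero factor and
    removes the summand of weight w1. *)
Lemma weight_sum_disjoint z w (ws : seq (weight h)) : w \notin ws ->
  (rootsp z w :&: \sum_(w' <- ws) rootsp z w' = 0)%VS.
Proof.
move=> hw; apply/eqP; rewrite -subv0; apply/subvP => X; rewrite memv_cap => /andP[hX].
elim: ws hw => [|w1 ws IH]; first by rewrite big_nil.
rewrite inE negb_or big_cons => /andP[ne /IH{}IH] /memv_addP[A hA [B hB eX]].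
apply: IH; have /lfunPn[H hH] := ne.
have d0 : w H - w1 H != 0 :> C by rewrite subr_eq0.
have e : (w H - w1 H : C) *: X = ls_br (vsval H) B - (w1 H : C) *: B.
  rewrite scalerBl -(rootspE H hX) eX brDr (rootspE H hA) scalerDr opprD addrACA.
  by rewrite subrr add0r.
rewrite -[X](scalerK d0) e; apply: memvZ; rewrite rpredB ?memvZ //.
exact: weight_sum_stable.
Qed.

Lemma dim_weight_sum z (ws : seq (weight h)) : uniq ws ->
  \dim (\sum_(w <- ws) rootsp z w) = (\sum_(w <- ws) \dim (rootsp z w))%N.
Proof.
elim: ws => [|w ws IH]; first by rewrite !big_nil dimv0.
rewrite /= !big_cons => /andP[hw /IH <-].
by rewrite dimv_disjoint_sum // weight_sum_disjoint.
Qed.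

End WeightSums.

(** * The dimension of the even part of F(4) *)

Section F4EvenDimension.
Variables (C : numClosedFieldType) (g : lieSuper C) (f : 'M[C]_7 -> 'M[C]_2 -> g).
Hypothesis f_iso : lie_iso predT (@so_mx C 7) (@sl2_mx C) (fun X => X \in ls_part g false) f.

Lemma so_mx_linear n a (A A' : 'M[C]_n) : so_mx A -> so_mx A' -> so_mx (a *: A + A').
Proof. by rewrite /so_mx linearP /= => -> ->; rewrite scalerN opprD. Qed.

Lemma so_mx0 n : so_mx (0 : 'M[C]_n).
Proof. by rewrite /so_mx trmx0 oppr0. Qed.

Lemma sl2_mx_linear a (B B' : 'M[C]_2) : sl2_mx B -> sl2_mx B' -> sl2_mx (a *: B + B').
Proof. by rewrite /sl2_mx linearP /= => -> ->; rewrite addr0 mulr0. Qed.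

Lemma sl2_mx0 : sl2_mx (0 : 'M[C]_2).
Proof. by rewrite /sl2_mx mxtrace0. Qed.

Lemma F4_iso_linear a A A' B B' : so_mx A -> so_mx A' -> sl2_mx B -> sl2_mx B' ->
  f (a *: A + A') (a *: B + B') = a *: f A B + f A' B'.
Proof. by case: f_iso => _ + _ _ _; apply. Qed.

Lemma F4_iso0 : f 0 0 = 0.
Proof.
have := F4_iso_linear (-1) (so_mx0 7) (so_mx0 7) sl2_mx0 sl2_mx0.
by rewrite !scaler0 !addr0 scaleN1r addNr.
Qed.

Lemma F4_iso_split A B : so_mx A -> sl2_mx B -> f A B = f A 0 + f 0 B.
Proof.
move=> hA hB; have := F4_iso_linear 1 hA (so_mx0 7) sl2_mx0 hB.
by rewrite !scale1r addr0 add0r.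
Qed.

Let so_basis : seq g := [seq f (delta_mx (inord i) (inord j) - delta_mx (inord j) (inord i)) 0
  | i <- iota 0 7, j <- iota 0 i].

Let sl_basis : seq g := [:: f 0 (delta_mx 0 1); f 0 (delta_mx 1 0);
  f 0 (delta_mx 0 0 - delta_mx 1 1)].

Let so_delta (i j : 'I_7) : so_mx (delta_mx i j - delta_mx j i : 'M[C]_7).
Proof. by rewrite /so_mx linearB /= !trmx_delta opprB. Qed.

Let so_in_span A : so_mx A -> f A 0 \in <<so_basis>>%VS.
Proof.
move=> hA; pose P A' := so_mx A' /\ f A' 0 \in <<so_basis>>%VS.
have P0 : P 0 by split; [exact: so_mx0 | rewrite F4_iso0 mem0v].
have PD a A1 A2 : P A1 -> P A2 -> P (a *: A1 + A2).
  case=> [h1 m1] [h2 m2]; split; first exact: so_mx_linear.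
  have := F4_iso_linear a h1 h2 sl2_mx0 sl2_mx0; rewrite scaler0 addr0 => ->.
  by rewrite rpredD ?memvZ.
have PD1 A1 A2 : P A1 -> P A2 -> P (A1 + A2) by move=> h1 /(PD 1 _ _ h1); rewrite scale1r.
have PZ a A1 : P A1 -> P (a *: A1) by move=> /(PD a _ _)/(_ P0); rewrite addr0.
have Plt (i j : 'I_7) : (j < i)%N -> P (delta_mx i j - delta_mx j i).
  move=> ji; split; first exact: so_delta.
  apply: memv_span; apply/allpairsPdep; exists (i : nat), (j : nat).
  by rewrite !mem_iota !inord_val !add0n ltn_ord ji.
have Pall (i j : 'I_7) : P (delta_mx i j - delta_mx j i).
  have [/Plt//|ij|/val_inj->] := ltngtP j i; last by rewrite subrr.
  by rewrite -opprB -scaleN1r; apply: PZ; apply: Plt.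
suff [] : P A by [].
(* Averaging the expansion of A in matrix units with that of - A^T. *)
have -> : A = 2^-1 *: \sum_i \sum_j A i j *: (delta_mx i j - delta_mx j i).
  have n2 : (2 : C) != 0 by rewrite pnatr_eq0.
  apply: (canRL (scalerK n2)).
  transitivity (\sum_i \sum_j A i j *: (delta_mx i j : 'M[C]_7)
      - \sum_i \sum_j A i j *: (delta_mx j i : 'M[C]_7)); last first.
    rewrite -sumrB; apply: eq_bigr => i _; rewrite -sumrB; apply: eq_bigr => j _.
    by rewrite scalerBr.
  rewrite -matrix_sum_delta scaler_nat mulr2n; congr (_ + _).
  rewrite exchange_big -[LHS]opprK -{1}hA {1}[A^T]matrix_sum_delta; congr (- _).
  by apply: eq_bigr => i _; apply: eq_bigr => j _; rewrite mxE.
apply: (PZ); apply: (big_ind P P0 PD1) => i _; apply: (big_ind P P0 PD1) => j _.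
exact: (PZ).
Qed.

Let sl_delta : [/\ sl2_mx (delta_mx 0 1 : 'M[C]_2), sl2_mx (delta_mx 1 0 : 'M[C]_2)
  & sl2_mx (delta_mx 0 0 - delta_mx 1 1 : 'M[C]_2)].
Proof.
by split; rewrite /sl2_mx /mxtrace !big_ord_recl big_ord0 !mxE /= ?subr0 ?sub0r ?addr0 ?subrr.
Qed.

Let sl_in_span B : sl2_mx B -> f 0 B \in <<sl_basis>>%VS.
Proof.
move=> hB; have [h1 h2 h3] := sl_delta.
have -> : B = B 0 1 *: delta_mx 0 1 + (B 1 0 *: delta_mx 1 0 +
    (B 0 0 *: (delta_mx 0 0 - delta_mx 1 1) + 0)).
  have tr0 : B 0 0 + B 1 1 = 0.
    have := hB; rewrite /sl2_mx /mxtrace !big_ord_recl big_ord0 addr0 => <-.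
    by congr (_ + B _ _); apply/val_inj.
  rewrite addr0; apply/matrixP => i j; rewrite !mxE.
  have c2 (k : 'I_2) : k = 0 \/ k = 1.
    by case: k => [[|[|//]] hk]; [left|right]; apply/val_inj.
  move/eqP: tr0; rewrite addrC addr_eq0 => /eqP tr0.
  by case: (c2 i) => ->; case: (c2 j) => -> /=;
    rewrite ?(subr0, oppr0, mulr0, mulr1, add0r, addr0, sub0r, mulrN1) ?tr0 ?opprK.
have e a B1 B2 : sl2_mx B1 -> sl2_mx B2 -> f 0 (a *: B1 + B2) = a *: f 0 B1 + f 0 B2.
  move=> k1 k2; have := F4_iso_linear a (so_mx0 7) (so_mx0 7) k1 k2.
  by rewrite scaler0 addr0.
have k3 := sl2_mx_linear (B 0 0) h3 sl2_mx0.
have k2 := sl2_mx_linear (B 1 0) h2 k3; have k0 := sl2_mx0.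
rewrite (e _ _ _ h1 k2) (e _ _ _ h2 k3) (e _ _ _ h3 k0).
by rewrite F4_iso0 !rpredD ?mem0v // memvZ // memv_span // !inE eqxx ?orbT.
Qed.

(** Spanning lists of 21 + 3 vectors. An upper bound is enough, as h and the twenty root spaces
    already account for 24 dimensions. *)
Lemma F4_even_dim : (\dim (ls_part g false) <= 24)%N.
Proof.
have sub : (ls_part g false <= <<so_basis>> + <<sl_basis>>)%VS.
  apply/subvP => X; case: f_iso => _ _ _ _ h /h[A [B [hA hB ->]]].
  by rewrite F4_iso_split // memv_add ?so_in_span ?sl_in_span.
apply: leq_trans (dimvS sub) _; apply: leq_trans (dimv_add_leqif _ _) _.
have h1 := dim_span so_basis; have h2 := dim_span sl_basis.
by apply: leq_trans (leq_add h1 h2) _.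
Qed.

End F4EvenDimension.

(** * Even roots of F(4) *)

Section F4Coordinates.
Variables (C : numClosedFieldType) (g : lieSuper C) (h : {vspace g}).
Variables (e : 'I_3 -> weight h) (d : weight h).
Hypothesis coords : F4_coordinates e d.
Implicit Types w : weight h.

Let es : 4.-tuple (weight h) := [tuple of d :: map e (ord_tuple 3)].

Let es_basis : basis_of fullv es.
Proof. by case: coords. Qed.

Let esE (i : 'I_3) : es`_(lift ord0 i) = e i.
Proof. by rewrite -tnth_nth tnthS tnth_map tnth_ord_tuple. Qed.

Definition F4_cd : {linear weight h -> C^o} := coord es ord0.
Definition F4_cf (i : 'I_3) : {linear weight h -> C^o} := coord es (lift ord0 i).
Local Notation cd := F4_cd.
Local Notation cf := F4_cf.

Lemma F4_cd_d : cd d = 1.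
Proof. exact: (coord_free ord0 ord0 (basis_free es_basis)). Qed.

Lemma F4_cd_e i : cd (e i) = 0.
Proof. by rewrite -esE; exact: (coord_free (lift ord0 i) ord0 (basis_free es_basis)). Qed.

Lemma F4_cf_d i : cf i d = 0.
Proof. exact: (coord_free ord0 (lift ord0 i) (basis_free es_basis)). Qed.

Lemma F4_cf_e i j : cf i (e j) = (i == j)%:R.
Proof.
rewrite -esE; apply: etrans (coord_free (lift ord0 j) (lift ord0 i) (basis_free es_basis)) _.
by rewrite (inj_eq lift_inj) eq_sym.
Qed.

Lemma F4_coord_exp w : w = cd w *: d + \sum_i cf i w *: e i.
Proof.
rewrite {1}(coord_basis es_basis (memvf w)) big_ord_recl; congr (_ + _).
by apply: eq_bigr => i _; rewrite esE.
Qed.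

Lemma F4_dim_cartan : \dim h = 4%N.
Proof.
have : \dim {:weight h} = 4%N.
  by rewrite -(span_basis es_basis) (eqnP (basis_free es_basis)) size_tuple.
by rewrite dimvf /dim /= muln1.
Qed.

Lemma ltpairsP n (ij : 'I_n * 'I_n) : (ij \in ltpairs n) = (ij.1 < ij.2)%N.
Proof. by rewrite mem_filter mem_enum andbT. Qed.

Lemma F4_pos0P w : reflect
  [\/ w = d, exists i, w = e i, exists i j : 'I_3, (i < j)%N /\ w = e i + e j
    | exists i j : 'I_3, (i < j)%N /\ w = e i - e j] (w \in F4_pos0 e d).
Proof.
rewrite /F4_pos0 in_fset /= inE !mem_cat; apply: (iffP idP).
  case/or4P => [/eqP->|/imageP[i _ ->]|/mapP[[i j]]|/mapP[[i j]]].
  - exact: Or41.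
  - by apply: Or42; exists i.
  - by rewrite ltpairsP => ij ->; apply: Or43; exists i, j.
  - by rewrite ltpairsP => ij ->; apply: Or44; exists i, j.
case=> [->|[i ->]|[i [j [ij ->]]]|[i [j [ij ->]]]]; apply/or4P.
- by apply: Or41.
- by apply: Or42; apply/imageP; exists i.
- by apply: Or43; apply/mapP; exists (i, j); rewrite ?ltpairsP.
- by apply: Or44; apply/mapP; exists (i, j); rewrite ?ltpairsP.
Qed.

Lemma F4_root_pos w : w \in F4_pos0 e d -> is_root false w.
Proof. by case: coords => _ ->  ->. Qed.

Lemma F4_rootN w : is_root false (- w) = is_root false w.
Proof. by case: coords => _ r; rewrite !r opprK orbC. Qed.

Lemma F4_root_d : is_root false d.
Proof. by apply/F4_root_pos/F4_pos0P; apply: Or41. Qed.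

Lemma F4_root_e i : is_root false (e i).
Proof. by apply/F4_root_pos/F4_pos0P; apply: Or42; exists i. Qed.

Lemma F4_root_eDe i j : i != j -> is_root false (e i + e j).
Proof.
rewrite neq_ltn => /orP[] ij; apply/F4_root_pos/F4_pos0P; apply: Or43.
  by exists i, j.
by exists j, i; rewrite addrC.
Qed.

Lemma F4_root_eBe i j : i != j -> is_root false (e i - e j).
Proof.
rewrite neq_ltn => /orP[] ij; last rewrite -F4_rootN opprB; apply/F4_root_pos/F4_pos0P;
  apply: Or44; first by exists i, j.
by exists j, i.
Qed.

Let third (i j : 'I_3) : exists k, (k != i) && (k != j).
Proof.
by apply/existsP; case: i => [[|[|[|//]]] hi]; case: j => [[|[|[|//]]] hj];
  apply/existsP; solve [by exists (inord 0); rewrite -!val_eqE /= inordK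
    | by exists (inord 1); rewrite -!val_eqE /= inordK
    | by exists (inord 2); rewrite -!val_eqE /= inordK].
Qed.

(** The features of the even roots that later exclude a weight: d does not mix with the e_i, no
    coordinate exceeds 1 in absolute value, and some e_i is always absent. *)
Lemma F4_root_coord w : is_root false w ->
  (cd w = 1 \/ cd w = -1) /\ (forall i, cf i w = 0) \/
  [/\ cd w = 0, forall i, [\/ cf i w = 0, cf i w = 1 | cf i w = -1]
    & exists i, cf i w = 0].
Proof.
suff pos v : v \in F4_pos0 e d ->
    cd v = 1 /\ (forall i, cf i v = 0) \/
    [/\ cd v = 0, forall i, [\/ cf i v = 0, cf i v = 1 | cf i v = -1] & exists i, cf i v = 0].
  case: coords => _ -> /orP[/pos[[h1 h2]|h1]|/pos[[]|[]]]; [by left; split; [left|]|by right| |].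
    rewrite linearN => h1 h2; left; split; first by right; rewrite -h1 opprK.
    by move=> i; apply/eqP; rewrite -oppr_eq0 -linearN h2.
  rewrite linearN => h1 h2 [i h3]; right; split.
  - by apply/eqP; rewrite -oppr_eq0 h1.
  - move=> j; have := h2 j; rewrite linearN => -[/eqP|/eqP|/eqP].
    + by rewrite oppr_eq0 => /eqP; constructor 1.
    + by rewrite eqr_oppLR => /eqP; constructor 3.
    + by rewrite eqr_opp => /eqP; constructor 2.
  - by exists i; apply/eqP; rewrite -oppr_eq0 -linearN h3.
move/F4_pos0P => [->|[i ->]|[i [j [ij ->]]]|[i [j [ij ->]]]].
- by left; split=> [|i]; rewrite ?F4_cd_d ?F4_cf_d.
- right; split=> [|k|]; first exact: F4_cd_e.
    by rewrite F4_cf_e; case: eqP => _; [constructor 2|constructor 1].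
  by have [k /andP[/negbTE ki _]] := third i i; exists k; rewrite F4_cf_e ki.
- have ne : (i == j) = false by apply/negbTE; rewrite neq_ltn ij.
  right; split=> [|k|]; first by rewrite linearD /= !F4_cd_e addr0.
    rewrite linearD /= !F4_cf_e; case: (eqVneq k i) => [->|_].
      by rewrite ne addr0; constructor 2.
    by case: (k == j); rewrite add0r; [constructor 2|constructor 1].
  have [k /andP[/negbTE ki /negbTE kj]] := third i j.
  by exists k; rewrite linearD /= !F4_cf_e ki kj addr0.
- have ne : (i == j) = false by apply/negbTE; rewrite neq_ltn ij.
  right; split=> [|k|]; first by rewrite linearB /= !F4_cd_e subr0.
    rewrite linearB /= !F4_cf_e; case: (eqVneq k i) => [->|_].
      by rewrite ne subr0; constructor 2.
    by case: (k == j); rewrite sub0r; [constructor 3|rewrite oppr0; constructor 1].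
  have [k /andP[/negbTE ki /negbTE kj]] := third i j.
  by exists k; rewrite linearB /= !F4_cf_e ki kj subr0.
Qed.

Hypothesis h_even : (h <= ls_part g false)%VS.
Hypothesis h_abelian : forall X Y, X \in h -> Y \in h -> ls_br X Y = 0.
Hypothesis dim_even : (\dim (ls_part g false) <= 24)%N.

Let i0 : 'I_3 := Ordinal (isT : (0 < 3)%N).
Let i1 : 'I_3 := Ordinal (isT : (1 < 3)%N).
Let i2 : 'I_3 := Ordinal (isT : (2 < 3)%N).
Let ps : seq (weight h) := [:: d; e i0; e i1; e i2; e i0 + e i1; e i0 + e i2; e i1 + e i2;
  e i0 - e i1; e i0 - e i2; e i1 - e i2].
Let rts := ps ++ [seq - w | w <- ps].

Let rts_root w : w \in rts -> is_root false w.
Proof.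
have ps_root : all (is_root false) ps.
  by rewrite /= F4_root_d !F4_root_e !F4_root_eDe ?F4_root_eBe.
rewrite /rts mem_cat => /orP[/(allP ps_root)//|/mapP[v /(allP ps_root) hv ->]].
by rewrite F4_rootN.
Qed.

(* The linear form with values 100, 1, 3, 9 on d, e_1, e_2, e_3 separates the roots. *)
Let uniq_weights : uniq (0 :: rts).
Proof.
pose phi w : C := cd w *+ 100 + cf i0 w + cf i1 w *+ 3 + cf i2 w *+ 9.
have phiD v w : phi (v + w) = phi v + phi w.
  rewrite /phi !linearD /= !mulrnDl; ring.
have phiN v : phi (- v) = - phi v by rewrite /phi !linearN /= !mulNrn; ring.
have phi0 : phi 0 = (0 : int)%:~R by rewrite /phi !linear0 !mul0rn !addr0.
have phid : phi d = (100 : int)%:~R by rewrite /phi F4_cd_d !F4_cf_d !mul0rn !addr0.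
have phie i : phi (e i) = (nth 0 [:: 1; 3; 9] i : int)%:~R.
  rewrite /phi F4_cd_e !F4_cf_e mul0rn add0r; case: i => [[|[|[|//]]] hi] /=;
  by rewrite ?mul0rn ?addr0 ?add0r.
apply: (@map_uniq _ _ phi).
have -> : map phi (0 :: rts) = [seq z%:~R | z <- [:: 0; 100; 1; 3; 9; 4; 10; 12; -2; -8; -6;
     -100; -1; -3; -9; -4; -10; -12; 2; 8; 6] : seq int].
  by rewrite /rts /ps /= !phiN !phiD !phiN phi0 phid !phie /= -!rmorphN -!rmorphD -!rmorphN.
by rewrite map_inj_uniq //; apply: intr_inj.
Qed.

Let D (w : weight h) : nat := \dim (rootsp false w).

Let h_weight0 : (h <= rootsp false (0%R : weight h))%VS.
Proof.
apply/subvP => X hX; apply/rootspP; split=> [|H]; first exact: (subvP h_even).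
by rewrite zero_lfunE scale0r h_abelian ?subvsP.
Qed.

Let sum_le (s : seq (weight h)) : uniq s -> (\sum_(w <- s) D w <= 24)%N.
Proof.
move=> us; rewrite -dim_weight_sum //; apply: leq_trans dim_even.
by apply: dimvS; apply: sumv_seq_sub => w _; apply: capvSl.
Qed.

Let size_sum (s : seq (weight h)) : {subset s <= rts} -> (size s <= \sum_(w <- s) D w)%N.
Proof.
move=> hs; rewrite -sum1_size big_seq [leqRHS]big_seq; apply: leq_sum => w /hs/rts_root.
by rewrite lt0n dimv_eq0 => /andP[].
Qed.

Let dim0 : (4 <= D (0%R : weight h))%N.
Proof. by rewrite -F4_dim_cartan dimvS. Qed.

(** The weight 0 space contains h, of dimension 4, and twenty root spaces take at least one
    dimension each, so 24 leaves no room for more. *)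
Lemma F4_weight0 : rootsp false (0 : weight h) = h.
Proof.
apply/eqP; rewrite eq_sym eqEdim h_weight0 F4_dim_cartan.
have := sum_le uniq_weights; rewrite big_cons.
have : (20 <= \sum_(w <- rts) D w)%N by apply: (@size_sum rts).
move=> h1 h2; rewrite -(leq_add2r 20); apply: leq_trans h2; by rewrite leq_add2l.
Qed.

(** The same count: a listed root leaves 19 others next to h, hence one dimension, and an unlisted
    weight leaves none. *)
Lemma F4_even_mult1 w : w != 0 -> (\dim (rootsp false w) <= 1)%N.
Proof.
move=> w0; have [wr|wr] := boolP (w \in rts).
  have := sum_le uniq_weights; rewrite big_cons (big_rem _ wr) /=.
  have : (19 <= \sum_(v <- rem w rts) D v)%N.
    by apply: leq_trans (size_sum _); [rewrite size_rem | move=> v /mem_rem].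
  move=> h1 h2; rewrite -(leq_add2r 23); apply: leq_trans h2.
  by rewrite addnCA leq_add2l (@leq_trans (4 + 19)%N) ?leq_add.
have us : uniq (w :: 0 :: rts) by rewrite cons_uniq uniq_weights inE negb_or w0 wr.
have := sum_le us; rewrite 2!big_cons.
have : (20 <= \sum_(v <- rts) D v)%N by apply: (@size_sum rts).
move=> h1 h2; apply: leq_trans (leqnSn 0); rewrite -(leq_add2r 24).
by apply: leq_trans h2; rewrite leq_add2l (@leq_trans (4 + 20)%N) ?leq_add.
Qed.

Lemma F4_even_span (U : {vspace g}) : (forall w : weight h, rootsp false w <= U)%VS ->
  (ls_part g false <= U)%VS.
Proof.
move=> hU; suff <- : (\sum_(w <- 0%R :: rts) rootsp false w)%VS = ls_part g false.
  by apply: sumv_seq_sub => w _; apply: hU.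
apply/eqP; rewrite eqEdim dim_weight_sum //; apply/andP; split.
  by apply: sumv_seq_sub => w _; apply: capvSl.
apply: leq_trans dim_even _; rewrite big_cons.
by apply: (@leq_trans (4 + 20)%N) => //; apply: leq_add dim0 (@size_sum rts _).
Qed.

End F4Coordinates.

Lemma traceless2_sqr (F : fieldType) (B : 'M[F]_2) : \tr B = 0 ->
  B *m B = (B 0 0 * B 0 0 + B 0 1 * B 1 0)%:M.
Proof.
move=> trB; have : B 0 0 + B 1 1 = 0.
  have := trB; rewrite /mxtrace !big_ord_recl big_ord0 addr0 => <-.
  by congr (_ + B _ _); apply/val_inj.
move/eqP; rewrite addrC addr_eq0 => /eqP e.
have c2 (k : 'I_2) : k = 0 \/ k = 1.
  by case: k => [[|[|//]] hk]; [left|right]; apply/val_inj.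
have l1 : lift ord0 ord0 = 1 :> 'I_2 by apply/val_inj.
apply/matrixP => i j; rewrite !mxE !big_ord_recl big_ord0 addr0 l1.
by case: (c2 i) => ->; case: (c2 j) => -> /=; rewrite ?e; ring.
Qed.

(** * Weight zero and nondegeneracy for F(4) *)

Section F4Weights.
Variables (C : numClosedFieldType) (g : lieSuper C) (omega : g -> g) (h : {vspace g}).
Variables (e : 'I_3 -> weight h) (d : weight h).
Hypotheses (F4 : is_F4 g) (cartan : F4_cartan omega h) (coords : F4_coordinates e d).
Implicit Types X Y Z : g.
Let h_even := F4_cartan_even cartan.
Let h_abelian := F4_cartan_abelian cartan.

Let dim_even : (\dim (ls_part g false) <= 24)%N.
Proof. by case: F4 => _ [f [gam [psi [hf _ _ _ _]]]]; apply: F4_even_dim hf. Qed.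

Let weight0 := F4_weight0 coords h_even h_abelian dim_even.
Let span_even := F4_even_span coords h_even h_abelian dim_even.

Let centralizer X : X \in ls_part g false -> (forall Y, Y \in h -> ls_br Y X = 0) -> X \in h.
Proof.
move=> Xg hX; rewrite -weight0; apply/rootspP; split=> // H.
by rewrite hX ?subvsP // zero_lfunE scale0r.
Qed.

(** A nonzero odd vector of weight 0 would force h to have no sl(2) component, whereas h is its own
    centralizer in the even part. *)
Lemma F4_odd_weight0 : rootsp true (0 : weight h) = 0%VS.
Proof.
have [_ [f [gam [psi [hf _ psi_inj odd_psi act]]]]] := F4.
have [fU fZ fbr finj fsurj] := hf.
have so0 : so_mx (0 : 'M[C]_7) := so_mx0 C 7; have sl0 : sl2_mx (0 : 'M[C]_2) := sl2_mx0 C.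
have slbr (B B' : 'M[C]_2) : sl2_mx (B *m B' - B' *m B).
  by rewrite /sl2_mx linearB /= mxtrace_mulC subrr.
have f0br B A' B' : sl2_mx B -> so_mx A' -> sl2_mx B' ->
    ls_br (f 0 B) (f A' B') = f 0 (B *m B' - B' *m B).
  by move=> k1 k2 k3; rewrite -fbr // mul0mx mulmx0 subrr.
have f0inj B : sl2_mx B -> f 0 B = 0 -> B = 0 by move=> k /(finj _ _ so0 k)[].
have f00 : f 0 0 = 0 := F4_iso0 hf.
(* Elements of h commute component by component, so the sl(2) component of an element of h
   centralizes h. *)
have proj A B : so_mx A -> sl2_mx B -> f A B \in h -> f 0 B \in h.
  move=> hA hB hAB; apply: centralizer; first exact: fU.
  move=> Y hY; have [A' [B' [hA' hB' eY]]] := fsurj _ (subvP h_even _ hY).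
  have := h_abelian hY hAB; rewrite eY -!fbr // => /(finj _ _ _ (slbr _ _))[].
    by rewrite /so_mx linearB /= !trmx_mul hA hA' !mulNmx !mulmxN !opprK opprB.
  by move=> _ ->; rewrite mulmx0 mul0mx subrr f00.
apply/eqP; rewrite -subv0; apply/subvP => X hX; rewrite memv0; apply: contraT => X0.
have [S eX] := (odd_psi X).1 (rootsp_part hX).
have S0 : S != 0 by apply: contra X0 => /eqP S0; rewrite eX S0 linear0.
(* Weight 0 gives S B^T = 0; this makes B nilpotent, ad of its image both nilpotent and
   diagonalizable, and finally B central in sl(2). *)
have B0 B : sl2_mx B -> f 0 B \in h -> B = 0.
  move=> hB hh.
  have SB : S *m B^T = 0.
    apply: psi_inj; rewrite linear0; have := act 0 B S so0 hB.
    rewrite -eX -(vsprojK hh) (rootspE _ hX) zero_lfunE scale0r.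
    rewrite /spin big1 => [|i _]; last by rewrite big1 // => j _; rewrite mxE scale0r.
    by rewrite scaler0 mul0mx add0r => <-.
  (* By Cayley-Hamilton B^2 is a scalar, and it annihilates the nonzero S. *)
  have BB : B *m B = 0.
    have e2 := traceless2_sqr hB; set c := (_ + _) in e2.
    have : S *m B^T *m B^T = c *: S.
      by rewrite -mulmxA -trmx_mul e2 tr_scalar_mx mul_mx_scalar.
    rewrite SB mul0mx => /esym/eqP; rewrite scaler_eq0 (negbTE S0) orbF => /eqP c0.
    by rewrite e2 c0 raddf0.
  have ad3 Y : Y \in ls_part g false ->
      ls_br (f 0 B) (ls_br (f 0 B) (ls_br (f 0 B) Y)) = 0.
    move=> /fsurj[A' [B' [hA' hB' ->]]]; rewrite !f0br //.
    rewrite -[RHS]f00; congr (f 0 _); set P := B *m B' *m B.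
    have -> : B *m (B *m B' - B' *m B) - (B *m B' - B' *m B) *m B = - P - P.
      by rewrite mulmxBr mulmxBl !mulmxA BB mul0mx sub0r -(mulmxA B') BB mulmx0 subr0.
    have BP : B *m P = 0 by rewrite /P !mulmxA BB !mul0mx.
    have PB : P *m B = 0 by rewrite /P -mulmxA BB mulmx0.
    by rewrite mulmxBr mulmxBl mulmxN mulNmx BP PB subrr.
  have central : (ls_part g false <= lker (linfun (ls_br (f 0%R B))))%VS.
    apply: span_even => w; apply/subvP => Y hY; rewrite memv_ker lfunE /=.
    have aE : ls_br (f 0 B) Y = (w (vsproj h (f 0 B)) : C) *: Y.
      by rewrite -{1}(vsprojK hh) (rootspE _ hY).
    have := ad3 Y (rootsp_part hY); rewrite aE !brZr aE !brZr aE !scalerA => /eqP.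
    by rewrite scaler_eq0 !mulf_eq0 -!orbA => /or4P[]/eqP->; rewrite ?scale0r ?scaler0.
  have comm B' : sl2_mx B' -> B *m B' = B' *m B.
    move=> hB'; apply/eqP; rewrite -subr_eq0; apply/eqP/f0inj; first exact: slbr.
    rewrite -(f0br _ 0) //; have := subvP central _ (fU _ _ so0 hB').
    by rewrite memv_ker lfunE => /eqP.
  have delta_tr (i j : 'I_2) : i != j -> sl2_mx (delta_mx i j : 'M[C]_2).
    move=> ij; rewrite /sl2_mx /mxtrace big1 // => k _; rewrite mxE.
    by case: eqP => // ->; rewrite (negbTE ij).
  have := comm _ (delta_tr 0 1 isT); have := comm _ (delta_tr 1 0 isT).
  have c2 (k : 'I_2) : k = 0 \/ k = 1.
    by case: k => [[|[|//]] hk]; [left|right]; apply/val_inj.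
  have l1 : lift ord0 ord0 = 1 :> 'I_2 by apply/val_inj.
  move=> /matrixP m1 /matrixP m2.
  have := m1 0 0; have := m1 1 0; have := m2 0 0; have := m2 0 1.
  rewrite !mxE !big_ord_recl !big_ord0 !l1 !mxE /= !(mulr0, mul0r, mulr1, mul1r, add0r, addr0).
  move=> a1 a2 a3 a4; have := hB; rewrite /sl2_mx /mxtrace !big_ord_recl big_ord0 l1 addr0.
  rewrite a1 -mulr2n => /eqP; rewrite mulrn_eq0 /= => /eqP b11.
  apply/matrixP => i j; rewrite mxE.
  by case: (c2 i) => ->; case: (c2 j) => ->; rewrite ?a1 ?b11 -?a2 ?a3 -?a4 ?a2 ?a4.
have d01 : sl2_mx (delta_mx 0 1 : 'M[C]_2).
  by rewrite /sl2_mx /mxtrace !big_ord_recl big_ord0 !mxE /= !addr0.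
(* With no sl(2) component in h, all of sl(2) centralizes h, so even this nilpotent element lies in
   h. *)
have : f 0 (delta_mx 0 1) \in h.
  apply: centralizer; first exact: fU.
  move=> Y hY; have [A' [B' [hA' hB' eY]]] := fsurj _ (subvP h_even _ hY).
  rewrite eY in hY *; rewrite -fbr // (B0 _ hB' (proj _ _ hA' hB' hY)).
  by rewrite !mulmx0 !mul0mx !subrr f00.
by move/(B0 _ d01)/matrixP/(_ 0 1)/eqP; rewrite !mxE pnatr_eq0 !eqxx.
Qed.

Variable D1 : {fset weight h}.
Hypothesis hD : positive_system (F4_pos0 e d) D1.
Variables (N : nat) (dd x : N.-tuple g).
Hypothesis d_basis : basis_of (n1_plus D1) dd.
Hypothesis x_basis : basis_of (n1_minus D1) x.
Hypothesis dx1 : forall i j, F4_form (tnth dd i) (tnth x j) = (i == j)%:R.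

(** The nonzero odd part contains a vector of nonzero weight, so n_1^+ or n_1^- is nonzero. Then the
    pairing of the adapted bases shows that the form is nonzero. *)
Let N_gt0 : (0 < N)%N.
Proof.
have [_ [f [gam [psi [hf _ psi_inj odd_psi act]]]]] := F4.
have g1 : ls_part g true != 0%VS.
  apply/negP => /eqP g10; have : psi (const_mx 1) \in ls_part g true.
    by apply/odd_psi; exists (const_mx 1).
  rewrite g10 memv0 => /eqP; rewrite -(linear0 psi) => /psi_inj /matrixP /(_ 0 0) /eqP.
  by rewrite !mxE oner_eq0.
have [al] := weight_vector_exists h_even g1 (subvv _)
  (fun H X hX => ls_br_part (subvP h_even _ (subvsP H)) hX)
  (fun H H' => h_abelian (subvsP H) (subvsP H')).
rewrite (capv_idPr (capvSl _ _)) => r0.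
have al0 : al != 0 by apply: contra r0 => /eqP->; apply/eqP/F4_odd_weight0.
case: (posnP N) => // N0.
have span0 (U : {vspace g}) (b : N.-tuple g) : basis_of U b -> U = 0%VS.
  move=> hb; apply/eqP; rewrite -dimv_eq0 -(span_basis hb) (eqnP (basis_free hb)).
  by rewrite size_tuple N0.
have e1 := span0 _ _ d_basis; have e2 := span0 _ _ x_basis.
have : is_root true al by rewrite /is_root al0.
case: hD => _ -> _ _ /orP[ha|ha]; apply: contraNT r0 => _; rewrite -subv0.
  by rewrite -e1; apply: sumv_seq_sup ha.
by rewrite -e2 -[al]opprK; apply: (@sumv_seq_sup _ _ _ _ (fun be => rootsp true (- be))).
Qed.

Let form_ok := F4_form_invariant g.

(** The radical is a graded ideal, hence zero or everything by simplicity, and (d_i, x_i) = 1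
    excludes the latter. *)
Lemma F4_form_nondeg X : X \in ls_part g false ->
  (forall Y, Y \in ls_part g false -> F4_form X Y = 0) -> X = 0.
Proof.
pose rad : {vspace g} :=
  lker (linfun (fun X : g => linfun (F4_form X : g -> C^o) : 'Hom(g, C^o))).
have rad_lin : linear (fun X : g => linfun (F4_form X : g -> C^o) : 'Hom(g, C^o)).
  move=> a U V; apply/lfunP => W; rewrite add_lfunE scale_lfunE.
  by rewrite !(linfun_apply (formDr form_ok _)) (formDl form_ok).
have radP U : U \in rad <-> forall V, F4_form U V = 0.
  rewrite memv_ker (linfun_apply rad_lin); split=> [/eqP/lfunP h0 V|h0].
    by have := h0 V; rewrite (linfun_apply (formDr form_ok _)) zero_lfunE.
  by apply/eqP/lfunP => V; rewrite (linfun_apply (formDr form_ok _)) zero_lfunE h0.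
have evenP U : U \in ls_part g false -> (forall V, V \in ls_part g false -> F4_form U V = 0) ->
    U \in rad.
  move=> hU h0; apply/radP; apply: lie_cases => [V V' v1 v2|[] V hV]; last exact: h0.
    by rewrite (form_addr form_ok) v1 v2 addr0.
  exact: (form_parity form_ok (z := false)).
have oddP U : U \in ls_part g true -> (forall V, V \in ls_part g true -> F4_form U V = 0) ->
    U \in rad.
  move=> hU h0; apply/radP; apply: lie_cases => [V V' v1 v2|[] V hV]; first 2 last.
  - exact: (form_parity form_ok (z := true)).
  - by rewrite (form_addr form_ok) v1 v2 addr0.
  exact: h0.
have graded : rad = (rad :&: ls_part g false + rad :&: ls_part g true)%VS.
  apply/eqP; rewrite eqEsubv; apply/andP; split; last first.
    by rewrite subv_add !capvSl.
  apply/subvP => U /radP hU.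
  have : U \in (ls_part g false + ls_part g true)%VS by rewrite ls_partD memvf.
  case/memv_addP => U0 hU0 [U1 hU1 eU]; rewrite eU; apply: memv_add; rewrite memv_cap ?hU0 ?hU1 andbT.
    apply: evenP => // V hV; have := hU V; rewrite eU (form_addl form_ok).
    by rewrite (form_parity form_ok (z := true) hU1 hV) addr0.
  apply: oddP => // V hV; have := hU V; rewrite eU (form_addl form_ok).
  by rewrite (form_parity form_ok (z := false) hU0 hV) add0r.
have ideal U V : V \in rad -> ls_br U V \in rad.
  have br_rad b W U' : W \in ls_part g b -> W \in rad -> ls_br U' W \in rad.
    move=> hW /radP h0; elim/lie_cases: U' => [U1 U2 r1 r2|a U' hU'].
      by rewrite brDl rpredD.
    rewrite (ls_skew hU' hW) rpredN memvZ //; apply/radP => Z.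
    by rewrite (form_inv form_ok).
  rewrite {1}graded => /memv_addP[V0 + [V1 + ->]]; rewrite !memv_cap => /andP[r0 p0] /andP[r1 p1].
  by rewrite brDr rpredD ?(br_rad false V0) ?(br_rad true V1).
have rad0 : rad = 0%VS.
  have [[_ simp] _] := F4; have [//|full] := simp rad graded ideal.
  pose i := Ordinal N_gt0; have /radP/(_ (tnth x i)) : tnth dd i \in rad by rewrite full memvf.
  by rewrite dx1 eqxx => /eqP; rewrite oner_eq0.
by move=> hX h0; apply/eqP; rewrite -memv0 -rad0; apply: evenP.
Qed.

Lemma F4_weight_structure : weight_structure (@F4_form C g) h.
Proof. by split=> //; [exact: F4_form_nondeg | exact: F4_odd_weight0]. Qed.

Lemma F4_mult1_even (w : weight h) : w != 0 -> (\dim (rootsp false w) <= 1)%N.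
Proof. exact: F4_even_mult1 coords h_even h_abelian dim_even w. Qed.

End F4Weights.

Lemma dim_le1P (F : fieldType) (V : vectType F) (U : {vspace V}) : (\dim U <= 1)%N ->
  exists w, forall u, u \in U -> exists a, u = a *: w.
Proof.
move=> dU; exists (vpick U) => u hu; apply/vlineP; suff /eqP-> : (<[vpick U]> == U)%VS by [].
rewrite eqEdim -memvE memv_pick dim_vline vpick0.
have [U0|U0] := eqVneq U 0%VS; first by rewrite U0 dimv0.
by [].
Qed.

(** * Two dual pairs for the same odd root *)

Section DualPairs.
Variables (C : numClosedFieldType) (g : lieSuper C) (form : g -> g -> C).
Variable h : {vspace g}.
Hypothesis rs : weight_structure form h.
Let form_ok := rs_form rs.
Let ce := cartan_even rs.
Implicit Types (X Y Z : g) (al be ga : weight h).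

Lemma wform_nondeg al : (forall be, wform form al be = 0) -> al = 0.
Proof.
move=> h0; have w0 : wdual form al = 0.
  apply: (form_cartan_nondeg rs) => H.
  have := h0 (flat h form H); rewrite (wformC rs) (wformE rs) (flatE rs).
  by rewrite (form_cartanC rs).
by apply/lfunP => H; rewrite -(wdualP rs) w0 (form0l form_ok) zero_lfunE.
Qed.

Lemma dual_vector z al X : spans h z -> nondegenerate form z -> X \in rootsp z al ->
  X != 0 -> exists2 Y, Y \in rootsp z (- al) & form X Y = 1.
Proof.
move=> sp nd hX X0; have [Y hY nY] : exists2 Y, Y \in rootsp z (- al) & Y \notin orth form X.
  apply/subvPn; apply: contra X0 => sub; apply/eqP/nd; first exact: rootsp_part hX.
  move=> Y Yz; apply/eqP; rewrite -(orthP rs); move: Y Yz; apply/subvP; apply: sp => be.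
  have [->//|ne] := eqVneq be (- al); apply/subvP => Y hY; rewrite (orthP rs).
  by rewrite (rootsp_orth ce form_ok hX hY) // addrC -[al]opprK subr_eq0.
rewrite (orthP rs) in nY; exists ((form X Y)^-1 *: Y); first exact: memvZ.
by rewrite (formZr form_ok) mulVf.
Qed.

Lemma br_wdual be ga z X : X \in rootsp z ga ->
  ls_br (vsval (wdual form be)) X = wform form ga be *: X.
Proof. by move=> hX; rewrite (rootspE _ hX) (wformE rs). Qed.

Lemma root_vectors be : rootsp false be != 0%VS ->
  exists E F, [/\ E \in rootsp false be, F \in rootsp false (- be)
    & ls_br E F = vsval (wdual form be)].
Proof.
move=> r0; have hE := memv_pick (rootsp false be); set E := vpick _ in hE.
have E0 : E != 0 by rewrite vpick0.
have [F hF f1] := dual_vector (rs_span rs) (rs_nondeg rs) hE E0.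
by exists E, F; split=> //; rewrite (br_rootsp_opp rs hE hF) f1 scale1r.
Qed.

(** E and F kill the root vector G of ga, hence so does [E, F] = t_be, which acts on G by (ga,
    be). *)
Lemma strongly_orthogonal be ga : rootsp false be != 0%VS -> rootsp false ga != 0%VS ->
  rootsp false (ga + be) = 0%VS -> rootsp false (ga - be) = 0%VS -> wform form ga be = 0.
Proof.
move=> /root_vectors[E [F [hE hF EF]]] g0 sp0 sm0.
have hG := memv_pick (rootsp false ga); set G := vpick _ in hG.
have EG : ls_br E G = 0.
  by apply/eqP; rewrite -memv0 -sp0 addrC (rootsp_br ce hE hG).
have FG : ls_br F G = 0.
  by apply/eqP; rewrite -memv0 -sm0 addrC (rootsp_br ce hF hG).
have := jacobi0 F G (rootsp_part hE); rewrite FG EG !br0r addr0 EF (br_wdual _ hG) => /esym/eqP.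
by rewrite scaler_eq0 vpick0 (negbTE g0) orbF => /eqP.
Qed.

Variables (al : weight h) (X1 X2 Y1 Y2 : g).
Hypotheses (hX1 : X1 \in rootsp true al) (hX2 : X2 \in rootsp true al).
Hypotheses (hY1 : Y1 \in rootsp true (- al)) (hY2 : Y2 \in rootsp true (- al)).
Hypothesis f11 : form X1 Y1 = 1.
Hypotheses (f21 : form X2 Y1 = 0) (f22 : form X2 Y2 = 1).
Local Notation t := (vsval (wdual form al)).
Let odd := rootsp_part.

Let br_t X Y : X \in rootsp true al -> Y \in rootsp true (- al) -> ls_br Y X = form X Y *: t.
Proof.
move=> hX hY; rewrite -(br_rootsp_opp rs hX hY).
exact: br_sym1 (rootsp_part hY) (rootsp_part hX).
Qed.

Let t_even : t \in ls_part g false.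
Proof. exact: subvP ce _ (subvsP _). Qed.

(** With k = (al, al), [Y1, [X1, X1]] = 2k X1 and [Y1, [X2, X1]] = k X2, while both inner brackets
    are multiples of one vector of weight 2 al. So k X1 and k X2 would be proportional, against the
    pairings with Y1 and Y2 unless k = 0. *)
Lemma dual_pairs_isotropic : (\dim (rootsp false (al + al)%R) <= 1)%N -> wform form al al = 0.
Proof.
move=> /dim_le1P[w hw]; set k := wform form al al; apply/eqP; apply: contraT => k0.
have act X : X \in rootsp true al ->
    ls_br Y1 (ls_br X X1) = (form X Y1 * k) *: X1 + k *: X.
  move=> hX; rewrite (jacobi11 _ (odd hY1) (odd hX)) (br_t hX hY1) (br_t hX1 hY1) f11 scale1r.
  rewrite brZl (br_wdual _ hX1) scalerA -(br_skew0 t_even (odd hX)) (br_wdual _ hX).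
  by [].
have [a ea] := hw _ (rootsp_br ce hX1 hX1); have [b eb] := hw _ (rootsp_br ce hX2 hX1).
have := act _ hX1; have := act _ hX2; rewrite ea eb !brZr f11 f21 mul0r scale0r add0r mul1r.
set W := ls_br Y1 w => eW2 eW1.
have := congr1 (fun Z => form Z Y1) eW1; have := congr1 (fun Z => form Z Y1) eW2.
rewrite (form_addl form_ok) !(formZl form_ok) f11 f21 mulr0 mulr1 => /eqP + h1.
rewrite mulf_eq0 => /orP[/eqP b0|/eqP W0].
  have := congr1 (fun Z => form Z Y2) eW2; rewrite !(formZl form_ok) b0 mul0r f22 mulr1.
  by move=> k00; rewrite -k00 eqxx in k0.
by move: h1; rewrite W0 mulr0 => /esym/eqP; rewrite -mulr2n mulrn_eq0 /= (negbTE k0).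
Qed.

Hypothesis isotropic : wform form al al = 0.

(* For Z = [e_be, Y_1], [Y_j, [X_i, Z]] = delta_ij (al, be) Z, whereas [X_i, Z] is a
   multiple of e_be. *)
Let shifted_zero be E : E \in rootsp false be -> (\dim (rootsp false be) <= 1)%N ->
  rootsp false (be - al - al) = 0%VS -> wform form be al != 0 -> ls_br E Y1 = 0.
Proof.
move=> hE /dim_le1P[w hw] r0 q0; apply/eqP; apply: contraT => Z0.
set Z := ls_br E Y1 in Z0; have hZ : Z \in rootsp true (be - al) := rootsp_br ce hE hY1.
have YZ Y : Y \in rootsp true (- al) -> ls_br Y Z = 0.
  by move=> hY; apply/eqP; rewrite -memv0 -r0 addrC (rootsp_br ce hY hZ).
have key X Y : X \in rootsp true al -> Y \in rootsp true (- al) ->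
    ls_br Y (ls_br X Z) = (form X Y * wform form be al) *: Z.
  move=> hX hY; rewrite (jacobi11 _ (odd hY) (odd hX)) (YZ _ hY) br0r subr0 (br_t hX hY) brZl.
  rewrite (br_wdual _ hZ) scalerA; congr (_ * _ *: _).
  by rewrite !(wformE rs) add_lfunE opp_lfunE -!(wformE rs) isotropic subr0.
have XZ X : X \in rootsp true al -> exists a, ls_br X Z = a *: w.
  by move=> hX; apply: hw; rewrite -[be](subrK al) addrC (rootsp_br ce hX hZ).
have [a ea] := XZ _ hX1; have [b eb] := XZ _ hX2.
have := key _ _ hX1 hY1; rewrite ea brZr f11 mul1r => k11.
have := key _ _ hX2 hY1; rewrite eb brZr f21 mul0r scale0r => /eqP.
have := key _ _ hX2 hY2; rewrite eb brZr f22 mul1r => k22.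
rewrite scaler_eq0 => /orP[/eqP b0|/eqP w0].
  by move/esym/eqP: k22; rewrite b0 scale0r scaler_eq0 (negbTE q0) (negbTE Z0).
by move/esym/eqP: k11; rewrite w0 scaler0 scaler_eq0 (negbTE q0) (negbTE Z0).
Qed.

(** Applied to be and - be, [shifted_zero] shows that E and F kill Y1, hence so does [E, F] = t_be,
    which scales Y1 by - (al, be). *)
Lemma dual_pairs_orthogonal be : rootsp false be != 0%VS ->
  (\dim (rootsp false be) <= 1)%N -> (\dim (rootsp false (- be)%R) <= 1)%N ->
  rootsp false (be - al - al) = 0%VS -> rootsp false (- be - al - al) = 0%VS ->
  wform form be al = 0.
Proof.
move=> /root_vectors[E [F [hE hF EF]]] d1 d2 r1 r2; apply/eqP; apply: contraT => q0.
have q0' : wform form (- be) al != 0.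
  by rewrite (wformE rs) opp_lfunE -(wformE rs) oppr_eq0.
have EY := shifted_zero hE d1 r1 q0; have FY := shifted_zero hF d2 r2 q0'.
have := jacobi0 F Y1 (rootsp_part hE); rewrite FY EY !br0r addr0 EF (br_wdual _ hY1) => /esym/eqP.
rewrite scaler_eq0 => /orP[|/eqP Y0].
  by rewrite (wformE rs) opp_lfunE -(wformE rs) (wformC rs) oppr_eq0 (negbTE q0).
by have := f11; rewrite Y0 (form0r form_ok) => /esym/eqP; rewrite oner_eq0.
Qed.

End DualPairs.

(** * Multiplicity one for the odd roots of F(4) *)

Section F4OddRoots.
Variables (C : numClosedFieldType) (g : lieSuper C) (omega : g -> g) (h : {vspace g}).
Variables (e : 'I_3 -> weight h) (d : weight h).
Hypotheses (F4 : is_F4 g) (cartan : F4_cartan omega h) (coords : F4_coordinates e d).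
Variable D1 : {fset weight h}.
Hypothesis hD : positive_system (F4_pos0 e d) D1.
Variables (N : nat) (dd x : N.-tuple g).
Hypothesis d_basis : basis_of (n1_plus D1) dd.
Hypothesis x_basis : basis_of (n1_minus D1) x.
Hypothesis dx1 : forall i j, F4_form (tnth dd i) (tnth x j) = (i == j)%:R.
Implicit Types (X Y : g) (al be w : weight h) (i j k : 'I_3).
Local Notation form := (@F4_form C g).
Local Notation wf := (wform form).
Local Notation cd := (F4_cd e d).
Local Notation cf := (F4_cf e d).

Let rs : weight_structure form h :=
  F4_weight_structure F4 cartan coords hD d_basis x_basis dx1.
Let form_ok := rs_form rs.
Let spans1 := spans_odd rs hD d_basis x_basis dx1.
Let nondeg1 := nondeg_odd rs hD d_basis x_basis dx1.

Let cd_d : cd d = 1 := F4_cd_d coords.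
Let cd_e i : cd (e i) = 0 := F4_cd_e coords i.
Let cf_d i : cf i d = 0 := F4_cf_d coords i.
Let cf_e i j : cf i (e j) = (i == j)%:R := F4_cf_e coords i j.

Let third i j : i != j -> exists k, [/\ k != i, k != j & forall l, [\/ l = i, l = j | l = k]].
Proof.
move=> ij; have [k /andP[ki kj]] : exists k, (k != i) && (k != j).
  apply/existsP; rewrite -[[exists _, _]]negbK negb_exists; apply/negP => /forallP all2.
  have : (#|[set: 'I_3]| <= #|[set i; j]|)%N.
    apply/subset_leq_card/subsetP => l _; have := all2 l.
    by rewrite negb_and !negbK !inE.
  by rewrite cardsT card_ord cards2 ij.
exists k; split=> // l; have full : [set i; j; k] = [set: 'I_3].
  apply/eqP; rewrite eqEcard subsetT cardsT card_ord setUC cardsU1 cards2 !inE ij.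
  by rewrite (negbTE ki) (negbTE kj).
have : l \in [set i; j; k] by rewrite full inE.
by rewrite !inE => /orP[/orP[]|] /eqP; [constructor 1|constructor 2|constructor 3].
Qed.

Let coord_cases w : rootsp false w != 0%VS ->
  (cd w = 1 \/ cd w = -1) /\ (forall i, cf i w = 0) \/
  [/\ cd w = 0, forall i, [\/ cf i w = 0, cf i w = 1 | cf i w = -1]
    & exists i, cf i w = 0].
Proof.
move=> r0; have [->|w0] := eqVneq w 0.
  by right; split=> [|i|]; [exact: linear0 | constructor 1; exact: linear0
    | exists ord0; exact: linear0].
by apply: (F4_root_coord coords); rewrite /is_root w0.
Qed.

Let no_mixed w i : cd w != 0 -> cf i w != 0 -> rootsp false w = 0%VS.
Proof.
move=> c0 f0; apply/eqP; apply: contraT => /coord_cases[[_ h0]|[h0 _ _]].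
  by rewrite h0 eqxx in f0.
by rewrite h0 eqxx in c0.
Qed.

Let no_full w : (forall i, cf i w != 0) -> rootsp false w = 0%VS.
Proof.
move=> f0; apply/eqP; apply: contraT => /coord_cases[[_ h0]|[_ _ [i h0]]].
  by have := f0 ord0; rewrite h0 eqxx.
by have := f0 i; rewrite h0 eqxx.
Qed.

Let no_double w i : cf i w = 2 -> rootsp false w = 0%VS.
Proof.
move=> f2; apply/eqP; apply: contraT => /coord_cases[[_ /(_ i)]|[_ /(_ i)]];
  rewrite f2; first by move=> /eqP; rewrite pnatr_eq0.
case=> /eqP; first by rewrite pnatr_eq0.
  by rewrite (eqr_nat _ 2 1).
by rewrite -addr_eq0 -(natrD _ 2 1) pnatr_eq0.
Qed.

Let root_sp w : is_root false w -> rootsp false w != 0%VS.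
Proof. by case/andP. Qed.

Let wfD v w be : wf (v + w) be = wf v be + wf w be.
Proof. by have := wformP rs 1 v w be; rewrite scale1r mul1r. Qed.

Let wfN v be : wf (- v) be = - wf v be.
Proof. by rewrite !(wformE rs) opp_lfunE. Qed.

Let orth_ed i : wf (e i) d = 0.
Proof.
apply: (strongly_orthogonal rs (root_sp (F4_root_d coords)) (root_sp (F4_root_e coords i))).
  by apply: (@no_mixed _ i); rewrite linearD /= ?cd_d ?cd_e ?cf_d ?cf_e ?eqxx ?add0r ?addr0 oner_eq0.
by apply: (@no_mixed _ i); rewrite linearB /= ?cd_d ?cd_e ?cf_d ?cf_e ?eqxx ?sub0r ?subr0
  ?oppr_eq0 oner_eq0.
Qed.

(** Strong orthogonality does not apply to e_i and e_j, whose sum is a root. It does apply to e_j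
    and e_i +- e_k, where all three coordinates would occur; adding the two relations gives the
    claim. *)
Let orth_ee i j : i != j -> wf (e i) (e j) = 0.
Proof.
move=> ij; have [k [ki kj full]] := third ij.
have ji : (j == i) = false by rewrite eq_sym (negbTE ij).
have ik : (i == k) = false by rewrite eq_sym (negbTE ki).
have jk : (j == k) = false by rewrite eq_sym (negbTE kj).
have plus : wf (e i + e k) (e j) = 0.
  apply: (strongly_orthogonal rs (root_sp (F4_root_e coords j))
      (root_sp (F4_root_eDe coords (negbT ik)))).
    apply: no_full => l; rewrite !linearD /= !cf_e.
    by case: (full l) => ->; rewrite ?eqxx ?(negbTE ij) ?(negbTE ki) ?(negbTE kj) ?ji ?ik ?jk /=
      ?(mulr0n, mulr1n) ?(oppr0, add0r, addr0, subr0, sub0r) ?oppr_eq0 oner_eq0.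
  apply: no_full => l; rewrite linearB linearD /= !cf_e.
  by case: (full l) => ->; rewrite ?eqxx ?(negbTE ij) ?(negbTE ki) ?(negbTE kj) ?ji ?ik ?jk /=
      ?(mulr0n, mulr1n) ?(oppr0, add0r, addr0, subr0, sub0r) ?oppr_eq0 oner_eq0.
have minus : wf (e i - e k) (e j) = 0.
  apply: (strongly_orthogonal rs (root_sp (F4_root_e coords j))
      (root_sp (F4_root_eBe coords (negbT ik)))).
    apply: no_full => l; rewrite linearD linearB /= !cf_e.
    by case: (full l) => ->; rewrite ?eqxx ?(negbTE ij) ?(negbTE ki) ?(negbTE kj) ?ji ?ik ?jk /=
      ?(mulr0n, mulr1n) ?(oppr0, add0r, addr0, subr0, sub0r) ?oppr_eq0 oner_eq0.
  apply: no_full => l; rewrite !linearB /= !cf_e.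
  by case: (full l) => ->; rewrite ?eqxx ?(negbTE ij) ?(negbTE ki) ?(negbTE kj) ?ji ?ik ?jk /=
      ?(mulr0n, mulr1n) ?(oppr0, add0r, addr0, subr0, sub0r) ?oppr_eq0 oner_eq0.
move: minus; rewrite wfD wfN => /eqP; rewrite subr_eq0 => /eqP ik_eq.
by move: plus; rewrite wfD -ik_eq -mulr2n => /eqP; rewrite mulrn_eq0 /= => /eqP.
Qed.

(** Equivalent to e_i + e_j and e_i - e_j being orthogonal, which holds strongly since 2 e_i and 2
    e_j are not roots. *)
Let kappaE i j : wf (e i) (e i) = wf (e j) (e j).
Proof.
have [->//|ij] := eqVneq i j.
have ji : (j == i) = false by rewrite eq_sym (negbTE ij).
have : wf (e i + e j) (e i - e j) = 0.
  apply: (strongly_orthogonal rs (root_sp (F4_root_eBe coords ij))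
      (root_sp (F4_root_eDe coords ij))).
    apply: (@no_double _ i); rewrite linearD linearD linearB /= !cf_e eqxx (negbTE ij).
    by rewrite addr0 subr0.
  apply: (@no_double _ j); rewrite linearB linearD linearB /= !cf_e eqxx ji.
  by rewrite add0r sub0r opprK.
rewrite (wformC rs) wfD wfN ![wf _ (e i + e j)](wformC rs) !wfD (orth_ee ij).
by rewrite (orth_ee (negbT ji)) addr0 add0r => /eqP; rewrite subr_eq0 => /eqP.
Qed.

Let wf_e al i : wf al (e i) = cf i al * wf (e i) (e i).
Proof.
rewrite !(wformE rs) {1}(F4_coord_exp coords al) add_lfunE scale_lfunE sum_lfunE.
rewrite -[d _](wformE rs) (wformC rs) orth_ed scaler0 add0r (bigD1 i) //= big1.
  by rewrite addr0 scale_lfunE.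
by move=> j ji; rewrite scale_lfunE -(wformE rs) orth_ee ?scaler0.
Qed.

Let wf_d al : wf al d = cd al * wf d d.
Proof.
rewrite !(wformE rs) {1}(F4_coord_exp coords al) add_lfunE scale_lfunE sum_lfunE.
by rewrite big1 ?addr0 // => j _; rewrite scale_lfunE -(wformE rs) orth_ed scaler0.
Qed.

Let kappa_neq0 i : wf (e i) (e i) != 0.
Proof.
apply/eqP => k0; have /andP[/eqP[]] := F4_root_e coords i.
by apply: (wform_nondeg rs) => be; rewrite (wformC rs) wf_e k0 mulr0.
Qed.

Let kappad_neq0 : wf d d != 0.
Proof.
apply/eqP => k0; have /andP[/eqP[]] := F4_root_d coords.
by apply: (wform_nondeg rs) => be; rewrite (wformC rs) wf_d k0 mulr0.
Qed.

Let wf_self al : wf al al = cd al ^+ 2 * wf d d + (\sum_i cf i al ^+ 2) * wf (e ord0) (e ord0).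
Proof.
rewrite (wformE rs) {1}(F4_coord_exp coords al) add_lfunE scale_lfunE sum_lfunE.
rewrite -[d _](wformE rs) (wformC rs) wf_d mulr_suml expr2 -mulrA; congr (_ + _).
apply: eq_bigr => i _; rewrite scale_lfunE -(wformE rs) (wformC rs) wf_e (kappaE i ord0).
by rewrite expr2 -mulrA.
Qed.

Let mult1 w : w != 0 -> (\dim (rootsp false w) <= 1)%N.
Proof. exact: F4_mult1_even F4 cartan coords w. Qed.

(* The root e_i separates an isotropic odd weight al from its neighbours unless
   +-e_i - 2 al is a root, in which case al = (+-d +- e_i)/2 and e_i + e_j does. *)
Let separating_root al : al != 0 -> wf al al = 0 -> exists be,
  [/\ is_root false be, wf be al != 0, rootsp false (be - al - al) = 0%VS
    & rootsp false (- be - al - al) = 0%VS].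
Proof.
move=> al0 iso; have [i ai] : exists i, cf i al != 0.
  apply/existsP; rewrite -[[exists _, _]]negbK negb_exists; apply/negP => /forallP a0.
  have cf0 i : cf i al = 0 by apply/eqP; have := a0 i; rewrite negbK.
  case/negP: al0; rewrite (F4_coord_exp coords al) big1 => [|i _]; last by rewrite cf0 scale0r.
  move/eqP: iso; rewrite wf_self big1 => [|i _]; last by rewrite cf0 expr0n.
  by rewrite mul0r addr0 mulf_eq0 (negbTE kappad_neq0) orbF expf_eq0 => /eqP->; rewrite scale0r addr0.
have wfi : wf (e i) al != 0 by rewrite (wformC rs) wf_e mulf_neq0.
have blocked s : (s = 1 \/ s = -1) -> rootsp false (s *: e i - al - al) != 0%VS -> exists be,
    [/\ is_root false be, wf be al != 0, rootsp false (be - al - al) = 0%VS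
      & rootsp false (- be - al - al) = 0%VS].
  move=> hs /coord_cases; have cdE : cd (s *: e i - al - al) = - cd al - cd al.
    by rewrite !linearB linearZ /= cd_e scaler0 sub0r.
  have cfE j : cf j (s *: e i - al - al) = s * (j == i)%:R - cf j al - cf j al.
    by rewrite !linearB linearZ /= cf_e.
  case=> [[c1 f0]|[c0 f0 _]].
    have [j ji] : exists j, j != i.
      have [e0|] := eqVneq i ord0; last by exists ord0; rewrite eq_sym.
      by exists ord_max; rewrite e0.
    have c2 : - cd al - cd al != 0.
      by rewrite -cdE; case: c1 => ->; rewrite ?oppr_eq0 oner_eq0.
    have aj : cf j al = 0.
      have := f0 j; rewrite cfE (negbTE ji) mulr0 sub0r -opprD -mulr2n => /eqP.
      by rewrite oppr_eq0 mulrn_eq0 /= => /eqP.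
    have ij : i != j by rewrite eq_sym.
    exists (e i + e j); split; first exact: F4_root_eDe coords _ _ ij.
    - by rewrite wfD (wformC rs (e i)) (wformC rs (e j)) (wf_e al i) (wf_e al j) aj mul0r addr0 mulf_neq0.
    - apply: (@no_mixed _ j); first by rewrite !linearB linearD /= !cd_e addr0 sub0r.
      by rewrite !linearB linearD /= !cf_e aj eqxx (negbTE ji) add0r !subr0 oner_eq0.
    - apply: (@no_mixed _ j); first by rewrite !linearB linearN linearD /= !cd_e addr0 oppr0 sub0r.
      by rewrite !linearB linearN linearD /= !cf_e aj eqxx (negbTE ji) add0r !subr0 oppr_eq0 oner_eq0.
  (* In this case d does not occur in al and all coordinates are real, so isotropy makes a sum of
     real squares vanish although [cf i al] is nonzero. *)
  have half (z : C) : - z - z \is Num.real -> z \is Num.real.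
    move=> hz; have -> : z = - (2^-1 * (- z - z)).
      by rewrite -opprD mulrN opprK -mulr2n -[z *+ 2]mulr_natl mulKf ?pnatr_eq0.
    by rewrite rpredN rpredM // rpredV realn.
  have a_real j : cf j al \is Num.real.
    apply: half; have hv : cf j (s *: e i - al - al) \is Num.real.
      by case: (f0 j) => ->; rewrite ?rpredN ?rpred0 ?rpred1.
    have -> : - cf j al - cf j al = cf j (s *: e i - al - al) - s * (j == i)%:R.
      by rewrite cfE [RHS]addrC -!addrA addKr.
    by rewrite rpredB ?rpredM ?realn //; case: hs => ->; rewrite ?rpredN rpred1.
  have cd0 : cd al = 0.
    by move/eqP: c0; rewrite cdE -opprD -mulr2n oppr_eq0 mulrn_eq0 /= => /eqP.
  move/eqP: iso; rewrite wf_self cd0 expr0n mul0r add0r mulf_eq0 (negbTE (kappa_neq0 _)) orbF.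
  rewrite psumr_eq0 => [|j _]; last by rewrite real_exprn_even_ge0.
  by move/allP/(_ i (mem_index_enum i)); rewrite expf_eq0 (negbTE ai).
have [r1|/blocked] := eqVneq (rootsp false (1 *: e i - al - al)) 0%VS; last by apply; left.
have [r2|/blocked] := eqVneq (rootsp false (-1 *: e i - al - al)) 0%VS; last by apply; right.
exists (e i); split=> //; first exact: F4_root_e coords i.
  by rewrite scale1r in r1.
by rewrite scaleN1r in r2.
Qed.

(** Pairing with a dual vector Y1 of X1 is injective on the root space: a nonzero X2 in its kernel
    would give two dual pairs, which make al isotropic and orthogonal to the root chosen not to be
    orthogonal to al. *)
Lemma F4_odd_mult1 al : al != 0 -> (\dim (rootsp true al) <= 1)%N.
Proof.
move=> al0; have [->|r0] := eqVneq (rootsp true al) 0%VS; first by rewrite dimv0.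
have hX1 := memv_pick (rootsp true al); set X1 := vpick _ in hX1.
have X10 : X1 != 0 by rewrite vpick0.
have [Y1 hY1 f11] := dual_vector rs spans1 nondeg1 hX1 X10.
apply: (dim_le1_functional (formDl form_ok Y1)) => X2 hX2 f21.
apply/eqP; apply: contraT => X20.
have [Y2 hY2 f22] := dual_vector rs spans1 nondeg1 hX2 X20.
have al2 : al + al != 0.
  by rewrite -mulr2n -scaler_nat scaler_eq0 pnatr_eq0.
have iso := dual_pairs_isotropic rs hX1 hX2 hY1 f11 f21 f22 (mult1 al2).
have [be [rbe nbe s1 s2]] := separating_root al0 iso.
have be0 : be != 0 by case/andP: rbe.
have nbe0 : - be != 0 by rewrite oppr_eq0.
have := dual_pairs_orthogonal rs hX1 hX2 hY1 hY2 f11 f21 f22 iso (root_sp rbe)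
  (mult1 be0) (mult1 nbe0) s1 s2.
by move/eqP; rewrite (negbTE nbe).
Qed.

Lemma F4_root_structure : root_structure form h.
Proof.
split; first exact: rs.
by case=> al; [exact: F4_odd_mult1 | exact: mult1].
Qed.

End F4OddRoots.

Lemma admissible_root_structure (C : numClosedFieldType) (G : datum C) (omega : dg G -> dg G)
    (D1 : {fset weight (dh G)}) (eps : C) (N : nat) (d x : N.-tuple (dg G)) :
  admissible G -> positive_system (dpos0 G) D1 ->
  omega_adapted (@dform _ G) d x omega D1 eps ->
  root_structure (@dform _ G) (dh G).
Proof.
move=> hG; case: G / hG omega D1 d x.
- by move=> m n r s _ _ mn _ omega D1 d x _ _; exact: sl_root_structure.
- by move=> n r s _ _ omega D1 d x _ _; exact: gl_root_structure.
- by move=> m n s _ _ omega D1 d x _ _; exact: osp_root_structure.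
- by move=> m n s _ _ _ omega D1 d x _ _; exact: osp_root_structure.
- move=> g h e d0 omega0 F4 _ cartan coords omega D1 d x hD1 [d_basis x_basis dx1 _].
  exact: F4_root_structure F4 cartan coords _ hD1 _ _ _ d_basis x_basis dx1.
Qed.

Theorem proposition37 (R : realType) (G : datum R[i]) (hG : admissible G)
    (D1 : {fset weight (dh G)}) (hD1 : positive_system (dpos0 G) D1)
    (eps : R[i]) (heps : eps = 1 \/ eps = -1)
    (N : nat) (d x : N.-tuple (dg G))
    (hadapted : omega_adapted (@dform _ G) d x (@domega _ G) D1 eps)
    (M : srep (dg G)) (hunitary : unitary (@domega _ G) M)
    (La : weight (dh G)) (hLa : highest_weight_rep M (dpos0 G) D1 La)
    (mu : weight (dh G))
    (hmu : has_constituent_L0 (osc_act (@dform _ G) d x (M := M))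
             (dpos0 G) mu) :
  let rho1 := half_sum D1 in
  let rho := half_sum (dpos0 G) - rho1 in
  let ip := wform (@dform _ G) in
  0 <= - eps * (ip (mu + rho1 + 2 *: rho) (mu + rho1)
                - ip (La + 2 *: rho) La).
Proof.
have rs := admissible_root_structure hG hD1 hadapted.
exact: (dirac_inequality rs hD1 heps hadapted hunitary hLa hmu).
Qed.
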